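(* There exists a polynomial-time algorithm that, given a graph $G$, outputs a set $Z\subseteq V(G)$ such that $G-Z$ is a bipartite permutation graph and $|Z|\le 9\cdot|Y|$ for every set $Y\subseteq V(G)$ such that $G-Y$ is a bipartite permutation graph (i.e., a $9$-approximation algorithm for vertex deletion into bipartite permutation graphs).
   Context: All graphs are finite, simple and undirected. A graph is a permutation graph if it is the intersection graph of a family of segments whose endpoints lie on two parallel lines $\ell_1,\ell_2$, one endpoint on each line (equivalently, its vertices can be labeled $1,\dots,n$ so that for some permutation $\pi$ of $\{1,\dots,n\}$, vertices $i,j$ are adjacent iff $(i-j)(\pi(i)-\pi(j))<0$). A bipartite permutation graph is a permutation graph that is bipartite. *)

(* Defs.v *)
From mathcomp Require Import all_boot.
Set Implicit Arguments. Unset Strict Implicit. Unset Printing Implicit Defensive.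

(* ---------- Graphs: a finite simple graph on 'I_n is a symmetric,
   irreflexive relation e.  G - Y is the subgraph induced on ~: Y. ---------- *)

Definition bipartite_on (n : nat) (e : rel 'I_n) (S : {set 'I_n}) : Prop :=
  exists col : 'I_n -> bool,
    forall x y, x \in S -> y \in S -> e x y -> col x != col y.

(* the subgraph induced by S is a permutation graph: intersection graph of
   segments joining two parallel lines, vertex x having endpoint p1 x on the
   first line and p2 x on the second line (endpoints pairwise distinct on each
   line); two segments cross iff their endpoints are in opposite orders.
   Equivalently: a labeling by positions p1 and a permutation pi with
   x ~ y iff (p1 x - p1 y)(p2 x - p2 y) < 0. *)
Definition perm_graph_on (n : nat) (e : rel 'I_n) (S : {set 'I_n}) : Prop :=
  exists p1 p2 : 'I_n -> nat,
    {in S &, injective p1} /\ {in S &, injective p2} /\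
    forall x y, x \in S -> y \in S -> x != y ->
      (e x y <-> (p1 x < p1 y) != (p2 x < p2 y)).

Definition bip_perm_on (n : nat) (e : rel 'I_n) (S : {set 'I_n}) : Prop :=
  bipartite_on e S /\ perm_graph_on e S.

(* ---------- Model of computation: successor RAM with indirect addressing
   (unit cost; only +1 / -1 arithmetic), polynomially equivalent to Turing
   machines. ---------- *)

Inductive instr : Type :=
| Inc of nat
| Dec of nat
| Jz of nat & nat
| Ld of nat & nat
| St of nat & nat
| Halt.

Definition program := seq instr.
Definition memory := nat -> nat.
Definition config : Type := (nat * memory)%type.

Definition upd (m : memory) (a v : nat) : memory :=
  fun b => if b == a then v else m b.

Definition step (P : program) (c : config) : config :=
  let: (pc, m) := c in
  match nth Halt P pc with
  | Inc i => (pc.+1, upd m i (m i).+1)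
  | Dec i => (pc.+1, upd m i (m i).-1)
  | Jz i l => if m i == 0 then (l, m) else (pc.+1, m)
  | Ld i j => (pc.+1, upd m i (m (m j)))
  | St i j => (pc.+1, upd m (m i) (m j))
  | Halt => (pc, m)
  end.

Definition run (P : program) (t : nat) (c : config) : config := iter t (step P) c.

Definition halted (P : program) (c : config) : bool :=
  if nth Halt P c.1 is Halt then true else false.

Definition adjn (n : nat) (e : rel 'I_n) (i j : nat) : bool :=
  match @insub nat (fun k => k < n) 'I_n i, @insub nat (fun k => k < n) 'I_n j with
  | Some x, Some y => e x y
  | _, _ => false
  end.

(* input encoding: M[0] = n, M[1 + i*n + j] = adjacency bit of (i,j), 0 elsewhere;
   program counter starts at 0 *)
Definition init_config (n : nat) (e : rel 'I_n) : config :=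
  (0, fun a => if a == 0 then n
               else if a <= n * n then
                      nat_of_bool (adjn e ((a.-1) %/ n) ((a.-1) %% n))
               else 0).

Definition output_set (n : nat) (c : config) : {set 'I_n} :=
  [set i : 'I_n | c.2 (1 + i) != 0].

(* Main.v *)
From Stdlib Require Import ZArith FunctionalExtensionality ClassicalEpsilon.
Require Import Defs.
From mathcomp Require Import all_boot zify.
Set Implicit Arguments. Unset Strict Implicit. Unset Printing Implicit Defensive.

(** Every deletion set meets every set of at most nine vertices that does not
    induce a bipartite permutation graph, so deleting disjoint sets of this kind
    greedily costs at most a factor nine. In the remaining graph every nine
    vertices are harmless, and a component is a bipartite permutation graph as
    soon as it has no hole, that is, no induced cycle of length at least five: a
    breadth-first layering from an extremal vertex then has nested layers, from
    which the two orders are read off.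

    In a component with a hole, the position of a vertex relative to a shortest
    hole defines an integer for each edge; these integers sum to zero on
    4-cycles, hence integrate to a potential on every hole-free connected part,
    but on no hole. Comparing potentials shows that a minimal deletion set has
    the form ((N(u) & N(v)) | (N(w) & N(x))) minus N[c], so a minimum one is found
    among n^5 candidates and this part of the deletion is optimal.

    The algorithm is a program in a small language of nested loops over vertices
    and boolean arrays, which is compiled to the RAM with a polynomial bound on
    the number of steps. *)

(** * Permutation models, asteroidal triples and holes *)

(** Nine is the approximation ratio, and it also makes every remaining hole have length at least 10.
    Along an edge the position on a shortest hole changes by at most 2, so around a 4-cycle the
    changes total at most 8 in absolute value; the total is a multiple of the hole length, hence 0.
    Winding around the hole thus becomes exact integer arithmetic. A minimal deletion set Y cuts
    this ring across. Each of its vertices is given two different heights by the potential on the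
    rest of the ring, one from each side of the cut. This keeps Y away from the middle of a hole
    that meets Y once; the nonneighbours of a middle vertex c contain Y, and they induce a bipartite
    permutation graph because every hole dominates c. In its model the two sides of the cut are
    separated, and each colour class of Y, being independent and touching both sides, has one common
    neighbour on each side. Two colours give the two pairs u, v and w, x. On the machine side,
    recognizing a bad set of nine vertices is no algorithmic problem: it is a fixed finite table,
    chosen classically and expanded into a decision tree. *)

Section Connect.
Variables (T : finType) (r : rel T).

Lemma connect_inv (P : T -> Prop) x y :
  (forall u v, r u v -> P u -> P v) -> connect r x y -> P x -> P y.
Proof.
move=> step /connectP[p]; elim: p x => [|v p IH] x /=; first by move=> _ ->.
by case/andP=> rxv pth ly Px; apply: IH pth ly (step _ _ rxv Px).
Qed.

Lemma connect_exit (P : pred T) x y :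
  connect r x y -> P x -> ~~ P y -> exists u v, [/\ r u v, P u & ~~ P v].
Proof.
move=> /connectP[p]; elim: p x => [|v p IH] x /=; first by move=> _ -> ->.
case/andP=> rxv pth ly Px nPy; case Pv: (P v); first exact: IH pth ly Pv nPy.
by exists x, v; rewrite Pv.
Qed.

Lemma connect_first x y : connect r x y -> x != y -> exists v, r x v.
Proof.
by case/connectP=> -[|v p] /=; [move=> _ ->; rewrite eqxx | case/andP=> ? _ _ _; exists v].
Qed.
End Connect.

Section Graph.
Variables (n : nat) (e : rel 'I_n).
Hypotheses (esym : symmetric e) (eirr : irreflexive e).
Local Notation T := 'I_n.
Implicit Types (S X Y : {set T}).

Definition er S : rel T := [rel p q | [&& p \in S, q \in S & e p q]].
Definition nonnb S x := [set q in S | (q != x) && ~~ e x q].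
Definition avoid2 S a b c d := [set q in S | ~~ e b q && ~~ e c q] :|: [set a; d].
(* With a shortest join of a and d outside N[b] and N[c], the path a-b-c-d is an
   induced cycle of length at least 5. *)
Definition hole4 S a b c d : bool :=
  [&& a \in S, b \in S, c \in S & d \in S] &&
  [&& e a b, e b c, e c d, ~~ e a c, ~~ e b d & ~~ e a d] &&
  connect (er (avoid2 S a b c d)) a d.
Definition nh S := [forall a, forall b, forall c, forall d, ~~ hole4 S a b c d].
Definition small_free S :=
  forall X, X \subset S -> #|X| <= 9 -> bip_perm_on e X.

Lemma er_sym S : symmetric (er S).
Proof. by move=> x y; rewrite /er /= esym; case: (x \in S); case: (y \in S). Qed.

Lemma er_csym S : connect_sym (er S).
Proof. exact: sym_connect_sym (er_sym S). Qed.

Lemma er_mono X S : X \subset S -> subrel (connect (er X)) (connect (er S)).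
Proof.
move=> sub; apply: connect_sub => u v /and3P[uX vX euv].
by apply: connect1; rewrite /er /= (subsetP sub _ uX) (subsetP sub _ vX).
Qed.

Lemma er_in S x y : connect (er S) x y -> x \in S -> y \in S.
Proof. by move=> c; apply: (connect_inv (P := fun v => v \in S)) c => u v /and3P[]. Qed.

Lemma er_edge S x y : x \in S -> y \in S -> e x y -> connect (er S) x y.
Proof. by move=> xS yS exy; apply: connect1; rewrite /er /= xS yS. Qed.

Lemma nhP S : reflect (forall a b c d, ~~ hole4 S a b c d) (nh S).
Proof.
apply: (iffP forallP) => [H a b c d|H a].
  by move/forallP: (H a) => /(_ b)/forallP/(_ c)/forallP/(_ d).
by apply/forallP=> b; apply/forallP=> c; apply/forallP=> d.
Qed.

Lemma small_freeS X S : X \subset S -> small_free S -> small_free X.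
Proof. by move=> sub sf Y YX; apply: sf; apply: subset_trans YX sub. Qed.

Lemma bipS X S : X \subset S -> bip_perm_on e S -> bip_perm_on e X.
Proof.
move=> /subsetP sub [[col bp] [p1 [p2 [i1 [i2 H]]]]]; split.
  by exists col => x y xX yX; apply: bp; apply: sub.
exists p1, p2; split; first by move=> x y xX yX; apply: i1; apply: sub.
split; first by move=> x y xX yX; apply: i2; apply: sub.
by move=> x y xX yX; apply: H; apply: sub.
Qed.

(** * The left-to-right order of a permutation model *)

Section Model.
Variables (S : {set T}) (p1 p2 : T -> nat).
Hypotheses (i1 : {in S &, injective p1}) (i2 : {in S &, injective p2}).
Hypothesis H : forall x y, x \in S -> y \in S -> x != y ->
      (e x y <-> (p1 x < p1 y) != (p2 x < p2 y)).

Definition lt x y := (p1 x < p1 y) && (p2 x < p2 y).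

Lemma lt_trans x y z : lt x y -> lt y z -> lt x z.
Proof. by case/andP=> a b /andP[c d]; rewrite /lt (ltn_trans a c) (ltn_trans b d). Qed.

Lemma lt_asym x y : lt x y -> lt y x -> False.
Proof. by move=> h1 h2; have := lt_trans h1 h2; rewrite /lt ltnn. Qed.

Lemma lt_irr x : lt x x = false.
Proof. by rewrite /lt ltnn. Qed.

Lemma lt_total x y : x \in S -> y \in S -> x != y -> ~~ e x y -> lt x y || lt y x.
Proof.
move=> xS yS xy nexy.
have n1 : p1 x != p1 y by apply: contra xy => /eqP/i1-> //.
have n2 : p2 x != p2 y by apply: contra xy => /eqP/i2-> //.
have := H xS yS xy; rewrite /lt; rewrite (negbTE nexy) => -[_ h].
have {h} : ~~ ((p1 x < p1 y) != (p2 x < p2 y)) by apply/negP=> /h.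
by move: n1 n2; rewrite negbK; case: (ltngtP (p1 x)); case: (ltngtP (p2 x)).
Qed.

Lemma lt_nadj x y : x \in S -> y \in S -> lt x y -> ~~ e x y.
Proof.
move=> xS yS l; have xy : x != y by apply: contraL l => /eqP->; rewrite lt_irr.
by apply/negP=> /(H xS yS xy); case/andP: l => -> ->.
Qed.

(** If [u] and [v] were on opposite sides of [z], transitivity would make them comparable, hence
    nonadjacent. So a walk outside the neighbourhood of [z] never changes sides. *)
Lemma lt_step z u v : z \in S -> u \in S -> v \in S -> v != z -> ~~ e z v -> e u v ->
  (lt u z -> lt v z) /\ (lt z u -> lt z v).
Proof.
move=> zS uS vS vz nzv euv; rewrite esym in nzv.
have := lt_total vS zS vz nzv.
split=> l; case/orP: H0 => // l'.
  by have := lt_nadj uS vS (lt_trans l l'); rewrite euv.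
by have := lt_nadj vS uS (lt_trans l' l); rewrite esym euv.
Qed.

Lemma lt_connect z X x y : z \in S -> X \subset nonnb S z ->
  connect (er X) x y -> (lt x z -> lt y z) /\ (lt z x -> lt z y).
Proof.
move=> zS /subsetP sub c.
pose P v := (lt x z -> lt v z) /\ (lt z x -> lt z v).
apply: (connect_inv (P := P) _ c) => // u v /and3P[uX vX euv] [h1 h2].
move: (sub _ uX) (sub _ vX); rewrite !inE => /and3P[uS _ _] /and3P[vS vz nv].
by case: (lt_step zS uS vS vz nv euv) => h3 h4; split; auto.
Qed.

Lemma lt_walk z x p : z \in S -> all (mem S) (x :: p) -> path e x p ->
  all (fun v => ~~ e z v) (x :: p) ->
  (lt x z -> lt (last x p) z) /\ (lt z x -> lt z (last x p)).
Proof.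
move=> zS; elim: p x => [|v p IH] x //= /and3P[xS vS pS] /andP[exv pth] /and3P[nx nv np].
have vz : v != z by apply: contraNneq nx => <-; rewrite esym.
have [h1 h2] := lt_step zS xS vS vz nv exv.
case: (IH v) => //=; [by rewrite vS | by rewrite nv | move=> h3 h4; split; auto].
Qed.
End Model.

(** Asking for a nonempty [p] is what makes the walk miss [z] itself: if [z] were on it, a neighbour
    of [z] would be on it too. *)
Definition avw z x y (p : seq T) :=
  [&& p != [::], path e x p, last x p == y & all (fun v => ~~ e z v) (x :: p)].

(** Three pairwise nonadjacent vertices are linearly ordered by [lt], and the walk between the outer
    two would have to pass the middle one without meeting its neighbourhood. *)
Lemma asteroidal_false S x y z p q r : bip_perm_on e S ->
  all (mem S) (x :: p) -> all (mem S) (y :: q) -> all (mem S) (z :: r) ->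
  avw z x y p -> avw x y z q -> avw y z x r -> False.
Proof.
case=> _ [p1 [p2 [i1 [i2 H]]]] pS qS rS.
case/and4P=> p0 pp /eqP lp np; case/and4P=> q0 pq /eqP lq nq; case/and4P=> r0 pr /eqP lr nr.
have xS : x \in S by case/andP: pS.
have yS : y \in S by case/andP: qS.
have zS : z \in S by case/andP: rS.
have neq a b s : s != [::] -> path e a s -> all (fun v => ~~ e b v) (a :: s) -> a != b.
  by case: s => //= v s _ /andP[eav _] /and3P[_ nv _]; apply: contraNneq nv => <-.
have xz := neq _ _ _ p0 pp np; have yx := neq _ _ _ q0 pq nq; have zy := neq _ _ _ r0 pr nr.
have nzx : ~~ e x z by rewrite esym; case/andP: np.
have nxy : ~~ e y x by rewrite esym; case/andP: nq.
have nyz : ~~ e z y by rewrite esym; case/andP: nr.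
have [a1 a2] := lt_walk i1 i2 H zS pS pp np; rewrite lp in a1 a2.
have [b1 b2] := lt_walk i1 i2 H xS qS pq nq; rewrite lq in b1 b2.
have [c1 c2] := lt_walk i1 i2 H yS rS pr nr; rewrite lr in c1 c2.
have t1 := lt_total i1 i2 H xS zS xz nzx.
have t2 := lt_total i1 i2 H yS xS yx nxy.
have t3 := lt_total i1 i2 H zS yS zy nyz.
have asym := @lt_asym p1 p2.
case/orP: t1 => h1.
  have h2 : lt p1 p2 x y by case/orP: t2 => // /b1 /(asym _ _ h1).
  exact: asym h2 (c2 (a1 h1)).
have h2 : lt p1 p2 y x by case/orP: t2 => // /b2 /asym /(_ h1).
exact: asym h2 (c1 (a2 h1)).
Qed.

Lemma hole4_rev S a b c d : hole4 S a b c d -> hole4 S d c b a.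
Proof.
case/andP=> /andP[/and4P[aS bS cS dS] /and4P[eab ebc ecd /and3P[nac nbd nad]]] con.
rewrite /hole4 aS bS cS dS (esym d c) ecd (esym c b) ebc (esym b a) eab.
rewrite (esym d b) nbd (esym c a) nac (esym d a) nad /=.
suff -> : avoid2 S d c b a = avoid2 S a b c d by rewrite er_csym.
by apply/setP=> q; rewrite !inE (andbC (~~ e c q)) (orbC (q == d)).
Qed.

(** Up to reversal the path [a-b-c-d] runs from left to right, and a vertex adjacent to neither [b]
    nor [c] lies left of [b] or right of both. The walk from [a] to [d] would have to jump from one
    side to the other. *)
Lemma hole4_false S a b c d : bip_perm_on e S -> hole4 S a b c d -> False.
Proof.
case=> _ [p1 [p2 [i1 [i2 H]]]].
have tot := lt_total i1 i2 H; have nadj := lt_nadj H.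
have main a' b' c' d' : hole4 S a' b' c' d' -> lt p1 p2 a' c' -> lt p1 p2 b' d' -> False.
  move=> {a b c d} /andP[/andP[/and4P[aS bS cS dS]
    /and4P[eab ebc ecd /and3P[nac nbd nad]]] con] l1 l2.
  pose O := [set q in S | ~~ e b' q && ~~ e c' q].
  have ad : a' != d' by apply: contraNneq nac => ->; rewrite esym.
  have side q : q \in O -> (lt p1 p2 q b') || (lt p1 p2 b' q && lt p1 p2 c' q).
    rewrite inE => /and3P[qS nb nc].
    have qb : q != b' by apply: contraNneq nc => ->; rewrite esym.
    have qc : q != c' by apply: contraNneq nb => ->.
    rewrite esym in nb; rewrite esym in nc.
    have := tot _ _ qS bS qb nb; have := tot _ _ qS cS qc nc.
    case/orP=> h1; case/orP=> h2; rewrite ?h1 ?h2 ?orbT //.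
    by have := nadj _ _ bS cS (lt_trans h2 h1); rewrite ebc.
  have dO : d' \notin O by rewrite inE ecd !andbF.
  (* The left end of the walk: an edge leaving this set would join two vertices separated by [b'] or
     [c'], or would be the missing edge between [a'] and [d']. *)
  pose P v := (v == a') || (v \in O) && lt p1 p2 v b'.
  have Pa : P a' by rewrite /P eqxx.
  have nPd : ~~ P d' by rewrite /P (negbTE dO) orbF eq_sym.
  have [u [v [/and3P[_ vA euv] Pu]]] := connect_exit con Pa nPd.
  move: vA euv; rewrite in_setU in_set2 => /or3P[vO|/eqP->|/eqP->] euv; last 2 first.
  - by rewrite /P eqxx.
  - move=> _; case/orP: Pu euv => [/eqP->|/andP[uO lu] eud]; first by rewrite (negbTE nad).
    have uS : u \in S by move: uO; rewrite inE => /andP[].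
    by have := nadj _ _ uS dS (lt_trans lu l2); rewrite eud.
  rewrite -/O in vO; have vS : v \in S by move: vO; rewrite inE => /andP[].
  rewrite /P vO negb_or /= => /andP[_ nlv].
  have := side _ vO; rewrite (negbTE nlv) /= => /andP[l3 l4].
  case/orP: Pu => [/eqP ua|/andP[uO lu]].
    by have := nadj _ _ aS vS (lt_trans l1 l4); rewrite -ua euv.
  have uS : u \in S by move: uO; rewrite inE => /andP[].
  by have := nadj _ _ uS vS (lt_trans lu l3); rewrite euv.
move=> hl; case/andP: (hl) => /andP[/and4P[aS bS cS dS]
    /and4P[eab ebc ecd /and3P[nac nbd nad]]] _.
have ac : a != c by apply: contraNneq nad => ->.
have bd : b != d by apply: contraNneq nad => <-.
have ad : a != d by apply: contraNneq nac => ->; rewrite esym.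
(* In the two mixed orders, whichever way [a] and [d] compare, one of the edges [ab], [cd] joins
   comparable vertices. *)
case/orP: (tot _ _ aS cS ac nac) => h1; case/orP: (tot _ _ bS dS bd nbd) => h2.
- exact: main hl h1 h2.
- case/orP: (tot _ _ aS dS ad nad) => h3.
    by have := nadj _ _ aS bS (lt_trans h3 h2); rewrite eab.
  by have := nadj _ _ dS cS (lt_trans h3 h1); rewrite esym ecd.
- case/orP: (tot _ _ aS dS ad nad) => h3.
    by have := nadj _ _ cS dS (lt_trans h1 h3); rewrite ecd.
  by have := nadj _ _ bS aS (lt_trans h2 h3); rewrite esym eab.
- exact: main (hole4_rev hl) h2 h1.
Qed.

Lemma bip_nh S : bip_perm_on e S -> nh S.
Proof. by move=> bp; apply/nhP=> a b c d; apply/negP; exact: hole4_false. Qed.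

(** * Configurations excluded on at most nine vertices *)

Section Small.
Variables (S : {set T}) (sf : small_free S).

Lemma small_list (L : seq T) : size L <= 9 -> all (mem S) L -> bip_perm_on e [set x in L].
Proof.
move=> sz LS; apply: sf; first by apply/subsetP=> x; rewrite inE => /(allP LS).
by rewrite cardsE; apply: leq_trans (card_size L) sz.
Qed.

Lemma triangle_free x y z : x \in S -> y \in S -> z \in S -> e x y -> e y z -> ~~ e x z.
Proof.
move=> xS yS zS exy eyz; apply/negP=> exz.
have [|[col bp] _] := @small_list [:: x; y; z] isT; first by rewrite /= xS yS zS.
have inL v : v \in [:: x; y; z] -> v \in [set q in [:: x; y; z]] by rewrite in_set.
have xL := inL x (mem_head _ _).
have yL : y \in [set q in [:: x; y; z]] by apply: inL; rewrite !inE eqxx orbT.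
have zL : z \in [set q in [:: x; y; z]] by apply: inL; rewrite !inE eqxx !orbT.
move: (bp _ _ xL yL exy) (bp _ _ yL zL eyz) (bp _ _ xL zL exz).
by case: (col x); case: (col y); case: (col z).
Qed.

Lemma asteroidal_small (L : seq T) x y z p q r :
  size L <= 9 -> all (mem S) L ->
  all (mem L) (x :: p) -> all (mem L) (y :: q) -> all (mem L) (z :: r) ->
  avw z x y p -> avw x y z q -> avw y z x r -> False.
Proof.
move=> sz LS pL qL rL; apply: (asteroidal_false (small_list sz LS)).
- by apply: sub_all pL => v; rewrite /= inE.
- by apply: sub_all qL => v; rewrite /= inE.
- by apply: sub_all rL => v; rewrite /= inE.
Qed.

(** The walk through [q] may have chords, as only a connection of [a] and [d] matters. Five is what
    [a], [b], [c], [d] leave of the nine vertices. *)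
Lemma cycle_small (q : seq T) a b c d :
  size q <= 5 -> all (mem S) [:: a, b, c, d & q] ->
  [&& e a b, e b c, e c d, ~~ e a c, ~~ e b d & ~~ e a d] ->
  path e a (rcons q d) -> all (fun v => ~~ e b v && ~~ e c v) q -> False.
Proof.
move=> sz LS edg pth nq.
have bp := @small_list [:: a, b, c, d & q] sz LS.
apply: (hole4_false (a := a) (b := b) (c := c) (d := d) bp).
rewrite /hole4 edg !inE !eqxx ?orbT /=.
have join x p : x = a \/ x \in q -> all (mem q) p -> path e x (rcons p d) ->
   connect (er (avoid2 [set x in [:: a, b, c, d & q]] a b c d)) x d; last first.
  by apply: join pth; [left | apply/allP].
have inA v : v \in q -> v \in avoid2 [set x in [:: a, b, c, d & q]] a b c d.
  by move=> vq; rewrite !inE vq !orbT (allP nq).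
elim: p x => [|v p IH] x xq /=.
  move=> _; rewrite andbT => exd; apply: er_edge exd; last by rewrite !inE eqxx ?orbT.
  by case: xq => [->|/inA]//; rewrite !inE eqxx ?orbT.
case/andP=> vq pq /andP[exv pth']; apply: connect_trans (IH v (or_intror vq) pq pth').
apply: er_edge exv; last exact: inA.
by case: xq => [->|/inA]//; rewrite !inE eqxx ?orbT.
Qed.
End Small.
End Graph.

(** * Layerings *)

Section Layers.
Variables (n : nat) (e : rel 'I_n).
Hypotheses (esym : symmetric e) (eirr : irreflexive e).
Local Notation T := 'I_n.
Local Notation er := (er e).
Implicit Types (S X Y : {set T}).

(** These axioms characterize the distance from [x] inside [S], without mentioning paths. *)
Definition layering S x (d : T -> nat) :=
  [/\ x \in S, d x = 0, {in S, forall v, d v = 0 -> v = x},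
      {in S &, forall u v, e u v -> d v <= (d u).+1}
    & {in S, forall v, 0 < d v -> exists2 u, u \in S & e u v /\ (d u).+1 = d v}].

Lemma layering_exists S x : x \in S -> {in S, forall v, connect (er S) x v} ->
  exists d, layering S x d.
Proof.
move=> xS con.
pose P v m := [exists p : m.-tuple T, path (er S) x p && (last x p == v)].
have PI v p : path (er S) x p -> last x p = v -> P v (size p).
  by move=> pp lp; apply/existsP; exists (in_tuple p); rewrite pp lp eqxx.
have PE v m : P v m -> exists p, [/\ path (er S) x p, last x p = v & size p = m].
  by case/existsP=> p /andP[pp /eqP lp]; exists p; rewrite size_tuple.
have [d dP] : exists d : T -> nat, forall v, v \in S -> P v (d v) /\ forall m, P v m -> d v <= m.
  apply: (@fin_all_exists T (fun=> nat) (fun v k => v \in S -> P v k /\ forall m, P v m -> k <= m)) => v.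
  case: (boolP (v \in S)) => vS; last by exists 0.
  have [p pp lp] := connectP (con v vS).
  have ex : exists m, P v m by exists (size p); apply: PI.
  by exists (ex_minn ex); case: ex_minnP.
have edge : {in S &, forall u v, e u v -> d v <= (d u).+1}.
  move=> u v uS vS euv; have [/PE[p [pp lp sp]] _] := dP u uS.
  have [_ /(_ (d u).+1)] := dP v vS; apply; rewrite -sp -(size_rcons p v).
  by apply: PI; rewrite ?last_rcons // rcons_path pp lp /er /= uS vS.
exists d; split=> //.
- have [_ /(_ 0)] := dP x xS; rewrite leqn0 => h; apply/eqP; apply: h.
  exact: (PI x [::]).
- by move=> v vS d0; have [] := dP v vS; rewrite d0 => /PE[[|a p] [_ <- //]].
- move=> v vS dv; have [/PE[p [pp lp sp]] _] := dP v vS.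
  case/lastP: p pp lp sp => [_ _ /= h|p w]; first by rewrite -h in dv.
  rewrite last_rcons rcons_path size_rcons => /andP[pp /and3P[lS _ ew]] wv sp.
  rewrite wv in ew; exists (last x p) => //; split=> //.
  apply/eqP; rewrite eqn_leq -{1}sp ltnS edge // andbT.
  by have [_] := dP _ lS; apply; apply: PI.
Qed.

Lemma layering_down S x d v : layering S x d -> v \in S ->
  connect (er ([set q in S | d q < d v] :|: [set v])) v x.
Proof.
case=> xS dx d0 dE dP; move: {2}(d v) (leqnn (d v)) => m.
elim: m v => [|m IH] v; first by rewrite leqn0 => /eqP/d0 h vS; rewrite h.
move=> dv vS; have [/d0->//|dv0] := posnP (d v).
have [u uS [euv du]] := dP v vS dv0.
apply: (@connect_trans _ _ u).
  by apply: er_edge; rewrite ?inE ?eqxx ?orbT ?uS -?du ?ltnSn //= esym.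
apply: er_mono (IH u _ uS); last by rewrite -ltnS du.
apply/subsetP=> q; rewrite !inE => /orP[/andP[-> h]|/eqP->]; apply/orP; left.
  by rewrite /= -du ltnW.
by rewrite uS -du /=.
Qed.

Section Free.
Variables (S : {set T}).
Hypotheses (sf : small_free e S) (nhS : nh e S).

(** Take an edge inside a layer and parents of its two ends. The parents are not adjacent by
    induction, triangles are excluded, and the parents are connected through lower layers, so a hole
    closes. *)
Lemma layering_bip x d : layering S x d -> {in S &, forall u v, e u v -> d u != d v}.
Proof.
move=> lay; have [xS dx d0 dE dP] := lay.
suff H m u v : u \in S -> v \in S -> d u = m -> d v = m -> e u v -> False.
  by move=> u v uS vS euv; apply/negP=> /eqP duv; apply: (H (d u) u v).
elim: m u v => [|m IH] u v uS vS du dv euv.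
  by move: euv; rewrite (d0 u) // (d0 v) // eirr.
have [|z zS [ezu dz]] := dP u uS; first by rewrite du.
have [|y yS [eyv dy]] := dP v vS; first by rewrite dv.
rewrite du in dz; rewrite dv in dy; case: dz dy => dz [dy].
have nzv : ~~ e z v := triangle_free sf zS uS vS ezu euv.
have nuy : ~~ e u y by apply: (triangle_free sf uS vS yS) => //; rewrite esym.
have nzy : ~~ e z y by apply/negP=> h; apply: (IH z y).
move/nhP: nhS => /(_ z u v y)/negP; apply.
rewrite /hole4 zS uS vS yS ezu euv (esym v y) eyv nzv nuy nzy /=.
have sub w : w \in S -> d w = m -> w \in [set z; y] ->
    connect (er (avoid2 e S z u v y)) w x.
  move=> wS dw win; apply: er_mono (layering_down lay wS).
  apply/subsetP=> q; rewrite !inE => /orP[/andP[qS]|/eqP->]; last first.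
    by move: win; rewrite !inE => ->; rewrite orbT.
  rewrite dw qS /= => h; apply/orP; left.
  have far t : t \in S -> d t = m.+1 -> ~~ e t q.
    by move=> tS dt; apply/negP=> etq; have := dE q t qS tS; rewrite esym etq dt => /(_ isT); move: h; clear; lia.
  by rewrite !far.
apply: connect_trans (sub z zS dz _) _; first by rewrite !inE eqxx.
by rewrite er_csym //; apply: sub; rewrite // !inE eqxx orbT.
Qed.

Lemma layering_adj x d : layering S x d ->
  {in S &, forall u v, e u v -> d v = (d u).+1 \/ d u = (d v).+1}.
Proof.
move=> lay u v uS vS euv; have := layering_bip lay uS vS euv.
have [_ _ _ dE _] := lay; have := dE u v uS vS euv; have := dE v u vS uS.
by rewrite esym => /(_ euv); clear; lia.
Qed.

(** Grow the component of [b] in [X] away from the neighbours of [a]. Where it first meets a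
    neighbour [w] of [a], the path [w-a-u-b] is closed by this component into a hole, unless [w] is
    already a common neighbour. *)
Lemma common_nbr u a b X : u \in S -> a \in S -> b \in S -> X \subset S ->
  e u a -> e u b -> {in X, forall q, ~~ e u q} -> a != b ->
  connect (er (X :|: [set a; b])) a b -> exists2 m, m \in X & e a m /\ e m b.
Proof.
move=> uS aS bS /subsetP XS eua eub uX ab con.
case: (pickP (fun m => [&& m \in X, e a m & e m b])) => [m /and3P[mX eam emb]|none].
  by exists m.
have nab : ~~ e a b by apply: (triangle_free sf aS uS bS) => //; rewrite esym.
pose X' := [set q in X | ~~ e a q].
pose C v := connect (er (X' :|: [set b])) b v.
have Cb : C b by apply: connect0.
have nCa : ~~ C a.
  apply/negP=> /er_in; rewrite !inE eqxx orbT => /(_ isT); rewrite (negbTE ab) orbF.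
  by case/andP=> /uX; rewrite eua.
rewrite er_csym // in con.
have [v [w [/and3P[_ wX evw] Cv nCw]]] := connect_exit con Cb nCa.
have vX : v \in X' :|: [set b] by apply: er_in Cv _; rewrite !inE eqxx orbT.
move: wX; rewrite !inE => /or3P[wX|/eqP wa|/eqP wb]; last by rewrite wb Cb in nCw.
- have eaw : e a w.
    apply: contraNT nCw => naw; apply: connect_trans Cv _.
    by apply: er_edge => //; rewrite !inE wX naw.
  have nwb : ~~ e w b by have := none w; rewrite wX eaw /= => ->.
  exfalso; move/nhP: nhS => /(_ w a u b)/negP; apply.
  rewrite /hole4 (XS w wX) aS uS bS (esym w a) eaw (esym a u) eua eub nab nwb.
  rewrite (esym w u) uX //=.
  have sub : X' :|: [set b] \subset avoid2 e S w a u b.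
    apply/subsetP=> q; rewrite !inE => /orP[/andP[qX naq]|->]; last by rewrite !orbT.
    by rewrite XS // naq uX.
  apply: (@connect_trans _ _ v).
    by apply: er_edge; [rewrite !inE eqxx !orbT | exact: subsetP sub _ vX | rewrite esym].
  by rewrite er_csym //; apply: er_mono Cv.
- move: evw; rewrite wa; move: vX; rewrite !inE => /orP[/andP[_ nav]|/eqP->].
    by rewrite esym (negbTE nav).
  by rewrite esym (negbTE nab).
Qed.

End Free.
End Layers.

(** * Hole-free graphs are bipartite permutation graphs *)

Section HoleFree.
Variables (n : nat) (e : rel 'I_n).
Hypotheses (esym : symmetric e) (eirr : irreflexive e).
Local Notation T := 'I_n.
Local Notation er := (er e).
Local Notation nonnb := (nonnb e).
Variables (S : {set T}).
Hypotheses (sf : small_free e S) (nhS : nh e S).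

Ltac edg := solve [assumption | rewrite esym; assumption].
Ltac edgs := rewrite /=; repeat (apply/andP; split); solve [exact isT | edg].
Ltac memL := by rewrite /= ?inE ?eqxx ?orbT.
Ltac avoids := apply/and4P; split; [exact isT | edgs | exact: eqxx | edgs].
Ltac asteroid L x y z p q r :=
  refine (@asteroidal_small _ _ esym _ sf L x y z p q r _ _ _ _ _ _ _ _);
  [exact isT | edgs | memL | memL | memL | avoids | avoids | avoids].

Lemma nonnbP x q : q \in nonnb S x -> [/\ q \in S, q != x & ~~ e x q].
Proof. by rewrite inE => /and3P[]. Qed.

(** * Common neighbours for two neighbours of a vertex *)

Section TwoStep.
Variables x z : T.
Hypotheses (xS : x \in S) (zS : z \in S) (exz : e x z).
Let Q := nonnb S x.
Let two v w := [exists s, [&& s \in Q, ~~ e z s, e v s & e s w]].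

Lemma two_stepI s v w : s \in Q -> ~~ e z s -> e v s -> e s w -> two v w.
Proof. by move=> sQ nzs evs esw; apply/existsP; exists s; rewrite sQ nzs evs. Qed.

(** If [s1] misses [v2] and [s2] misses [v0], then [x], [s1], [s2] form an asteroidal triple on
    seven vertices. *)
Lemma two_step_trans v0 v1 v2 : v0 \in Q -> v1 \in Q -> v2 \in Q ->
  e z v0 -> e z v1 -> e z v2 -> two v0 v1 -> two v1 v2 -> two v0 v2.
Proof.
move=> v0Q v1Q v2Q z0 z1 z2 /existsP[s1 /and4P[s1Q nzs1 e0 e1]] /existsP[s2 /and4P[s2Q nzs2 e3 e4]].
case: (boolP (e s1 v2)) => [h|n1]; first exact: two_stepI h.
case: (boolP (e v0 s2)) => [h|n2]; first exact: two_stepI h e4.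
have [v0S _ nx0] := nonnbP v0Q; have [v1S _ nx1] := nonnbP v1Q.
have [v2S _ nx2] := nonnbP v2Q; have [s1S _ nxs1] := nonnbP s1Q.
have [s2S _ nxs2] := nonnbP s2Q.
have n3 : ~~ e s1 s2 := triangle_free sf s1S v1S s2S e1 e3.
exfalso.
asteroid [:: x; z; v0; s1; v1; s2; v2] x s1 s2 [:: z; v0; s1] [:: v1; s2] [:: v2; z; x].
Qed.

Lemma two_step u w : u \in Q -> w \in Q -> e z u -> e z w -> u != w ->
  connect (er Q) u w -> exists2 s, s \in Q & [/\ ~~ e z s, e u s & e s w].
Proof.
move=> uQ wQ zu zw uw con.
suff /existsP[s /and4P[sQ nzs eus esw]] : two u w by exists s.
pose A := [pred v | (v \in Q) && e z v && ((v == u) || two u v)].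
pose O := [set q in Q | ~~ e z q].
have QS : Q \subset S by apply/subsetP=> q /nonnbP[].
have OS : O \subset S by apply/subsetP=> q; rewrite inE => /andP[/nonnbP[]].
(* The connecting walk is cut at its visits to the neighbours of [z]: [A] collects those reached by
   two-step moves, and between two visits the walk stays in [O]. *)
pose C v := A v || (v \in O) && [exists a, A a && connect (er (O :|: [set a])) a v].
have Cu : C u by rewrite /C /= uQ zu eqxx.
case: (boolP (C w)) => [|nCw].
  case/orP; first by rewrite /= [w == u]eq_sym (negbTE uw) => /andP[_].
  by rewrite inE zw andbF.
have [v [t [/and3P[vQ tQ evt] Cv nCt]]] := connect_exit con Cu nCw.
have [vS _ _] := nonnbP vQ; have [tS _ _] := nonnbP tQ.
case: (boolP (e z t)) => zt; last first.
  have tO : t \in O by rewrite inE tQ.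
  move: nCt; rewrite /C tO andTb negb_or => /andP[_ /negP[]].
  case/orP: Cv => [Av|/andP[vO /existsP[a /andP[Aa con']]]]; apply/existsP.
    by exists v; rewrite Av; apply: er_edge; rewrite // in_setU ?tO // in_set1 eqxx orbT.
  exists a; rewrite Aa; apply: connect_trans con' _.
  by apply: er_edge; rewrite // in_setU ?vO ?tO.
case/orP: Cv => [/andP[/andP[_ zv] _]|/andP[vO /existsP[a /andP[Aa con']]]].
  have := triangle_free sf vS zS tS; rewrite (esym v z) => /(_ zv zt).
  by rewrite evt.
have at' : a != t by apply: contraNneq nCt => <-; rewrite /C Aa.
case/andP: (Aa) => /andP[aQ za] au; have [aS _ _] := nonnbP aQ.
have nzO : {in O, forall q, ~~ e z q} by move=> q; rewrite inE => /andP[].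
have cat : connect (er (O :|: [set a; t])) a t.
  apply: (@connect_trans _ _ v); first by apply: er_mono con'; apply: setUS; rewrite sub1set !inE eqxx.
  by apply: er_edge; rewrite // in_setU ?vO // !inE eqxx ?orbT.
have [s sO [eas est]] := common_nbr esym sf nhS zS aS tS OS za zt nzO at' cat.
move: sO; rewrite inE => /andP[sQ nzs].
exfalso; move/negP: nCt; apply; apply/orP; left; rewrite /= tQ zt /=.
case/orP: au => [/eqP au|ua]; first by rewrite -au (two_stepI sQ nzs eas est) orbT.
by rewrite (@two_step_trans u a t) ?orbT // (two_stepI sQ nzs eas est).
Qed.
End TwoStep.

(** * Nested layers around an extremal root *)

Section Root.
Variables (x : T) (d : T -> nat).
Hypothesis lay : layering e S x d.
(** Extremality of the root: without its closed neighbourhood the graph stays connected, up to twins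
    of [x], which become isolated. *)
Hypothesis conQ : forall u w, u \in nonnb S x -> w \in nonnb S x ->
  [set q in S | e u q] != [set q in S | e x q] ->
  [set q in S | e w q] != [set q in S | e x q] ->
  connect (er (nonnb S x)) u w.

Let xS : x \in S. Proof. by case: lay. Qed.

Lemma deep_nonnb v : v \in S -> 1 < d v -> v \in nonnb S x.
Proof.
case: lay => _ dx _ dE _ vS dv; rewrite inE vS /=; apply/andP; split.
  by apply: contraTneq dv => ->; rewrite dx.
by apply/negP=> /(dE _ _ xS vS); rewrite dx; move: dv; clear; lia.
Qed.

Lemma far_nadj u v : u \in S -> v \in S -> (d u).+1 < d v -> ~~ e u v.
Proof.
case: lay => _ _ _ dE _ uS vS duv; apply/negP=> /(dE _ _ uS vS).
by move: duv; clear; lia.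
Qed.

Lemma same_nadj u v : u \in S -> v \in S -> d u = d v -> ~~ e u v.
Proof.
move=> uS vS duv; apply/negP=> euv.
by have := layering_bip esym eirr sf nhS lay uS vS euv; rewrite duv eqxx.
Qed.

Lemma layer1 u : u \in S -> d u = 1 -> e x u.
Proof.
case: lay => _ _ d0 _ dP uS du; have [|w wS [ewu dw]] := dP u uS; first by rewrite du.
by rewrite du in dw; case: dw => /(d0 _ wS) <-.
Qed.

(** The chain graph condition: no induced pair of disjoint edges between consecutive layers, so the
    neighbourhoods in the next layer are totally ordered by inclusion. *)
Definition nested i := forall u w y t, u \in S -> w \in S -> y \in S -> t \in S ->
  d u = i -> d w = i -> d y = i.+1 -> d t = i.+1 ->
  e u y -> e w t -> ~~ e u t -> ~~ e w y -> False.

Lemma nbrs_neq u w q : q \in S -> e u q != e w q ->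
  [set q in S | e u q] != [set q in S | e w q].
Proof.
by move=> qS; apply: contraNneq => /setP/(_ q); rewrite !inE qS /= => ->.
Qed.

(** Nothing lies beyond the root to complete an asteroidal triple with [y] and [t]. Instead,
    extremality supplies a common neighbour [q] of [u] and [w], then vertices [s] and [r] of layer 3
    linking [q] to [y] and [t]; the triple is [x], [s], [r], on eight vertices. *)
Lemma nested1 : nested 1.
Proof.
move=> u w y t uS wS yS tS du dw dy dt euy ewt nut nwy.
have exu := layer1 uS du; have exw := layer1 wS dw.
have yQ : y \in nonnb S x by rewrite deep_nonnb ?dy.
have tQ : t \in nonnb S x by rewrite deep_nonnb ?dt.
have con : connect (er (nonnb S x)) y t.
  apply: conQ => //.
    by apply: (nbrs_neq wS); rewrite (esym y) exw (negbTE nwy).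
  by apply: (nbrs_neq uS); rewrite (esym t) exu (negbTE nut).
have [_ _ nxy] := nonnbP yQ; have [_ _ nxt] := nonnbP tQ.
have nuw : ~~ e u w by apply: same_nadj; rewrite // du dw.
have QS : nonnb S x \subset S by apply/subsetP=> q /nonnbP[].
(* q is the last neighbour of u1 on a path from a to b *)
have lastn a b u1 u2 : u1 \in S -> u2 \in S -> d u1 = 1 -> d u2 = 1 -> ~~ e u1 u2 ->
    a \in nonnb S x -> b \in nonnb S x -> connect (er (nonnb S x)) a b ->
    e u1 a -> e u2 b -> ~~ e u1 b ->
    exists2 q, q \in nonnb S x & e u1 q && e u2 q && connect (er (nonnb S x)) q b.
  move=> u1S u2S d1 d2 n12 aQ bQ cab ea eb nb.
  have [bS _ _] := nonnbP bQ.
  pose O := [set q in nonnb S x | ~~ e u1 q].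
  have bO : b \in O by rewrite inE bQ.
  pose C := connect (er O) b.
  have nCa : ~~ C a by apply/negP=> /er_in/(_ bO); rewrite inE ea andbF.
  rewrite er_csym // in cab.
  have [v [q [/and3P[vQ qQ evq] Cv nCq]]] := connect_exit cab (connect0 _ b : C b) nCa.
  have vO := er_in Cv bO; have [qS _ nxq] := nonnbP qQ.
  have eq1 : e u1 q.
    apply: contraNT nCq => nq; apply: connect_trans Cv _.
    by apply: er_edge; rewrite // inE qQ.
  have OQ : O \subset nonnb S x by apply/subsetP=> s; rewrite inE => /andP[].
  have cqb : connect (er (nonnb S x)) q b.
    rewrite er_csym //; apply: connect_trans (er_mono OQ Cv) _.
    exact: er_edge.
  exists q => //; rewrite eq1 cqb /= andbT; apply: contraT => nq2; exfalso.
  (* If [q] missed [u2], the path [q-u1-x-u2] would be closed into a hole by the part of the walk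
     that avoids [u1]. *)
  move/nhP: nhS => /(_ q u1 x u2)/negP; apply.
  rewrite /hole4 qS u1S xS u2S (esym q) eq1 (esym u1 x) layer1 // (layer1 u2S) //.
  rewrite (esym q) nxq n12 (esym q) nq2 /=.
  have sub : O \subset avoid2 e S q u1 x u2.
    by apply/subsetP=> s; rewrite !inE => /andP[/and3P[-> _ ->] ->].
  apply: (@connect_trans _ _ v).
    apply: er_edge; [by rewrite !inE eqxx !orbT | exact: subsetP sub _ vO | by rewrite esym].
  have cvb : connect (er O) v b by rewrite er_csym.
  apply: connect_trans (er_mono sub cvb) _.
  apply: er_edge; [exact: subsetP sub _ bO | by rewrite !inE eqxx !orbT | by rewrite esym].
have [q qQ /andP[/andP[euq ewq] cqt]] := lastn y t u w uS wS du dw nuw yQ tQ con euy ewt nut.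
have [qS qx nxq] := nonnbP qQ.
have yq : y != q by apply: contraNneq nwy => ->.
have qt : q != t by apply: contraNneq nut => <-.
have cyq : connect (er (nonnb S x)) y q.
  by apply: connect_trans con _; rewrite er_csym.
have [s sQ [nus eys esq]] := two_step xS uS exu yQ qQ euy euq yq cyq.
have [r rQ [nwr eqr ert]] := two_step xS wS exw qQ tQ ewq ewt qt cqt.
have [sS sx nxs] := nonnbP sQ; have [rS rx nxr] := nonnbP rQ.
have ds : d s = 3.
  have := layering_adj esym eirr sf nhS lay yS sS eys; rewrite dy.
  case=> // -[/eqP]; rewrite eq_sym => /eqP ds; by have := layer1 sS ds; rewrite (negbTE nxs).
have dr : d r = 3.
  have := layering_adj esym eirr sf nhS lay tS rS; rewrite esym dt => /(_ ert).
  case=> // -[/eqP]; rewrite eq_sym => /eqP dr; by have := layer1 rS dr; rewrite (negbTE nxr).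
have nws : ~~ e w s by rewrite far_nadj // ds dw.
have nur : ~~ e u r by rewrite far_nadj // dr du.
(* Such a common neighbour [m] would close the 6-cycle [a-u1-x-u2-b-m]. *)
have jump a b m u1 u2 : a \in nonnb S x -> b \in nonnb S x -> m \in nonnb S x ->
   u1 \in S -> u2 \in S -> d u1 = 1 -> d u2 = 1 -> ~~ e u1 u2 ->
   e u1 a -> ~~ e u2 a -> e u2 b -> ~~ e u1 b -> ~~ e u1 m -> e a m -> e m b -> False.
  move=> aQ bQ mQ u1S u2S d1 d2 n12 e1 n2 e2 n1 nm eam emb.
  have [aS _ nxa] := nonnbP aQ; have [bS _ nxb] := nonnbP bQ; have [mS _ nxm] := nonnbP mQ.
  have := @cycle_small _ _ esym S sf [:: m; b] a u1 x u2 isT.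
  have ex1 := layer1 u1S d1; have ex2 := layer1 u2S d2.
  by apply; edgs.
have nst : ~~ e s t by apply/negP=> est; apply: (jump y t s u w).
have nyr : ~~ e y r by apply/negP=> eyr; apply: (jump y t r u w).
have nsr : ~~ e s r := triangle_free sf sS qS rS esq eqr.
asteroid [:: x; u; w; y; t; q; s; r] x s r [:: u; y; s] [:: q; r] [:: t; w; x].
Qed.

Ltac farn := match goal with |- is_true (~~ e ?a ?b) =>
  let ha := match goal with H : d a = _ |- _ => H end in
  let hb := match goal with H : d b = _ |- _ => H end in
  solve [ apply: far_nadj; [assumption | assumption | rewrite ha hb; clear; lia]
        | rewrite esym; apply: far_nadj; [assumption | assumption | rewrite ha hb; clear; lia]
        | apply: same_nadj; [assumption | assumption | by rewrite ha hb]] end.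
Ltac edg ::= solve [assumption | rewrite esym; assumption | farn].

Lemma common_parent i u w : nested i -> u \in S -> w \in S -> d u = i.+1 -> d w = i.+1 ->
  exists2 z, z \in S & [/\ d z = i, e z u & e z w].
Proof.
move=> nes uS wS du dw; case: lay => _ _ _ _ dP.
have [|z zS [ezu dz]] := dP u uS; first by rewrite du.
have [|z' z'S [ezw dz']] := dP w wS; first by rewrite dw.
rewrite du in dz; rewrite dw in dz'; case: dz dz' => dz [dz'].
case: (boolP (e z w)) => [h|n1]; first by exists z.
case: (boolP (e z' u)) => [h|n2]; first by exists z'.
by case: (nes z z' u w).
Qed.

Lemma parent i u : u \in S -> d u = i.+1 -> exists2 z, z \in S & d z = i /\ e z u.
Proof.
move=> uS du; case: lay => _ _ _ _ dP.
have [|z zS [ezu dz]] := dP u uS; first by rewrite du.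
by rewrite du in dz; case: dz => dz; exists z.
Qed.

(** The root is adjacent to the common parent [z], so the walk from [y] to [t] may not use [z]; the
    two-step link [s] replaces it. *)
Lemma nested2 : nested 2.
Proof.
move=> u w y t uS wS yS tS du dw dy dt euy ewt nut nwy.
have [z zS [dz ezu ezw]] := common_parent nested1 uS wS du dw.
have exz := layer1 zS dz.
have uQ : u \in nonnb S x by rewrite deep_nonnb ?du.
have wQ : w \in nonnb S x by rewrite deep_nonnb ?dw.
have yQ : y \in nonnb S x by rewrite deep_nonnb ?dy.
have tQ : t \in nonnb S x by rewrite deep_nonnb ?dt.
have [_ _ nxu] := nonnbP uQ; have [_ _ nxw] := nonnbP wQ.
have [_ _ nxy] := nonnbP yQ; have [_ _ nxt] := nonnbP tQ.
have uw : u != w by apply: contraNneq nwy => <-.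
have con : connect (er (nonnb S x)) u w.
  apply: conQ => //.
    by apply: (nbrs_neq yS); rewrite euy (negbTE nxy).
  by apply: (nbrs_neq tS); rewrite ewt (negbTE nxt).
have [s sQ [nzs eus esw]] := two_step xS zS exz uQ wQ ezu ezw uw con.
have [sS _ nxs] := nonnbP sQ.
asteroid [:: x; z; u; w; s; y; t] x y t [:: z; u; y] [:: u; s; w; t] [:: w; z; x].
Qed.

(** From layer 3 on, a vertex [q] two layers closer to the root than the common parent [z] takes the
    place of the root in the triple: the walk from [y] to [t] through [z] avoids its
    neighbourhood. *)
Lemma nestedP i : nested i.
Proof.
elim: i => [|[|[|i]] IH] u w y t uS wS yS tS du dw dy dt euy ewt nut nwy.
- case: lay => _ _ d0 _ _.
  by move: nwy; rewrite (d0 w) // -(d0 u) // euy.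
- exact: (nested1 uS wS yS tS).
- exact: (nested2 uS wS yS tS).
have [z zS [dz ezu ezw]] := common_parent IH uS wS du dw.
have [p pS [dp epz]] := parent zS dz.
have [q qS [dq eqp]] := parent pS dp.
asteroid [:: z; p; q; u; y; w; t] q y t [:: p; z; u; y] [:: u; z; w; t] [:: w; z; p; q].
Qed.

(** Together with [nestedP] this gives each layer a single linear preorder, along which the upper
    neighbourhoods grow while the lower ones shrink. *)
Lemma opposed i u w y z : u \in S -> w \in S -> y \in S -> z \in S ->
  d u = i.+1 -> d w = i.+1 -> d y = i.+2 -> d z = i ->
  e w y -> ~~ e u y -> e z w -> ~~ e z u -> False.
Proof.
move=> uS wS yS zS du dw dy dz ewy nuy ezw nzu.
have [z2 z2S [dz2 ez2u ez2w]] := common_parent (nestedP (i := i)) uS wS du dw.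
case: i => [|[|i]] in du dw dy dz dz2 *.
- case: lay => _ _ d0 _ _.
  by move: nzu; rewrite (d0 z) // layer1.
- have exz := layer1 zS dz; have exz2 := layer1 z2S dz2.
  have uQ : u \in nonnb S x by rewrite deep_nonnb ?du.
  have wQ : w \in nonnb S x by rewrite deep_nonnb ?dw.
  have yQ : y \in nonnb S x by rewrite deep_nonnb ?dy.
  have [_ _ nxu] := nonnbP uQ; have [_ _ nxw] := nonnbP wQ.
  have [_ _ nxy] := nonnbP yQ.
  have uw : u != w by apply: contraNneq nuy => ->.
  have con : connect (er (nonnb S x)) u w.
    apply: conQ => //.
      by apply: (nbrs_neq zS); rewrite (esym u) exz (negbTE nzu).
    by apply: (nbrs_neq yS); rewrite ewy (negbTE nxy).
  have [s sQ [nzs eus esw]] := two_step xS z2S exz2 uQ wQ ez2u ez2w uw con.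
  have [sS _ nxs] := nonnbP sQ.
  asteroid [:: x; z; z2; u; w; s; y] x y u [:: z; w; y] [:: w; s; u] [:: z2; x].
have [p pS [dp epz epz2]] := common_parent (nestedP (i := i.+1)) zS z2S dz dz2.
have [q qS [dq eqp]] := parent pS dp.
asteroid [:: q; p; z; z2; u; w; y] q y u [:: p; z; w; y] [:: w; z2; u] [:: z2; p; q].
Qed.

Definition up u := [set q in S | e u q && (d q == (d u).+1)].
Definition dn u := [set q in S | e u q && (d u == (d q).+1)].

Lemma up_dn_total u v : u \in S -> v \in S -> d u = d v ->
  (up u \subset up v) && (dn v \subset dn u) || (up v \subset up u) && (dn u \subset dn v).
Proof.
move=> uS vS duv.
have upn a b : a \in S -> b \in S -> d a = d b -> ~~ (up a \subset up b) ->
    exists y, [/\ y \in S, d y = (d a).+1, e a y & ~~ e b y].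
  move=> aS bS dab /subsetPn[y]; rewrite !inE => /and3P[yS eay /eqP dy].
  by rewrite yS dy dab eqxx andbT /= => nby; exists y; rewrite -dab.
have dnn a b : a \in S -> b \in S -> d a = d b -> ~~ (dn a \subset dn b) ->
    exists z, [/\ z \in S, d a = (d z).+1, e z a & ~~ e z b].
  move=> aS bS dab /subsetPn[z]; rewrite !inE => /and3P[zS eaz /eqP dz].
  by rewrite zS -dab dz eqxx andbT /= => nbz; exists z; rewrite !(esym z).
have nes a b : a \in S -> b \in S -> d a = d b -> ~~ (up a \subset up b) ->
    ~~ (up b \subset up a) -> False.
  move=> aS bS dab /upn-/(_ aS bS dab)[y [yS dy ey ny]] /upn.
  rewrite dab => /(_ bS aS erefl)[t [tS dt et nt]].
  by rewrite dab in dy; apply: (@nestedP (d b) a b y t).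
have opp a b : a \in S -> b \in S -> d a = d b -> ~~ (up a \subset up b) ->
    ~~ (dn a \subset dn b) -> False.
  move=> aS bS dab /upn-/(_ aS bS dab)[y [yS dy ey ny]] /dnn-/(_ aS bS dab)[z [zS dz ez nz]].
  by apply: (@opposed (d z) b a y z); rewrite -?dab // dy dz.
have nesd a b : a \in S -> b \in S -> d a = d b -> ~~ (dn a \subset dn b) ->
    ~~ (dn b \subset dn a) -> False.
  move=> aS bS dab /dnn-/(_ aS bS dab)[z [zS dz ez nz]] /dnn.
  rewrite -dab => /(_ bS aS erefl)[t [tS dt et nt]].
  apply: (@nestedP (d z) z t a b) => //.
  - by apply/eqP; rewrite -eqSS -dt dz.
  - by rewrite -dab.
case: (boolP (up u \subset up v)) => /= h1; case: (boolP (dn v \subset dn u)) => //= h2.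
- case: (boolP (up v \subset up u)) => /= h3.
    by apply: contraT => h4; case: (nesd u v).
  by case: (opp v u); rewrite -?duv.
- case: (boolP (up v \subset up u)) => /= h3.
    by apply: contraT => h4; case: (opp u v).
  by case: (nes u v).
- case: (boolP (up v \subset up u)) => /= h3.
    by apply: contraT => h4; case: (opp u v).
  by case: (nes u v).
Qed.

(** Since [up] grows while [dn] shrinks, this one number sorts a layer, and equal keys in a layer
    mean equal neighbourhoods on both sides. *)
Definition key u := #|up u| + (n - #|dn u|).

Lemma key_sub u v : u \in S -> v \in S -> d u = d v -> key u <= key v ->
  (up u \subset up v) && (dn v \subset dn u).
Proof.
move=> uS vS duv kuv; case/orP: (up_dn_total uS vS duv) => // /andP[h1 h2].
have cn (X : {set T}) : #|X| <= n by rewrite -[X in _ <= X](card_ord n) max_card.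
have := subset_leq_card h1; have := subset_leq_card h2; move: kuv; rewrite /key.
move: (cn (dn u)) (cn (dn v)) => c1 c2 k c3 c4.
have e1 : #|up u| <= #|up v| by move: c1 c2 k c3 c4; clear; lia.
have e2 : #|dn v| <= #|dn u| by move: c1 c2 k c3 c4; clear; lia.
have /eqP-> : up v == up u by rewrite eqEcard h1.
have /eqP-> : dn u == dn v by rewrite eqEcard h2.
by rewrite !subxx.
Qed.

Definition lo u v := (d u < d v) ||
  ((d u == d v) && ((key u < key v) || ((key u == key v) && (u < v)))).

Lemma lo_trans u v w : lo u v -> lo v w -> lo u w.
Proof. rewrite /lo; clear; lia. Qed.

Lemma lo_total u v : u != v -> lo u v || lo v u.
Proof. rewrite -val_eqE /lo /=; clear; lia. Qed.

Lemma lo_irr u : lo u u = false.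
Proof. by rewrite /lo; clear; lia. Qed.

Lemma lo_d u v : lo u v -> d u <= d v.
Proof. rewrite /lo; clear; lia. Qed.

Lemma lo_sub u v : u \in S -> v \in S -> lo u v -> d u = d v ->
  {in S, forall q, (d q = (d u).+1 -> e u q -> e v q) /\ (d u = (d q).+1 -> e v q -> e u q)}.
Proof.
move=> uS vS luv duv q qS.
have k : key u <= key v by move: luv duv; rewrite /lo; clear; lia.
have /andP[/subsetP h1 /subsetP h2] := key_sub uS vS duv k.
split=> [dq euq|dq evq].
  by have := h1 q; rewrite !inE qS euq dq eqxx => /(_ isT)/and3P[].
by have := h2 q; rewrite !inE qS evq -duv dq eqxx => /(_ isT)/and3P[].
Qed.

(* The relations [before true] and [before false] are the orders of the two endpoints. *)
Definition before b u v := if e u v then odd (d u) == b else lo u v.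

Lemma odd_adj u v : u \in S -> v \in S -> e u v -> odd (d v) = ~~ odd (d u).
Proof.
by move=> uS vS euv; case: (layering_adj esym eirr sf nhS lay uS vS euv) => -> //=; rewrite negbK.
Qed.

Lemma before_irr b u : before b u u = false.
Proof. by rewrite /before eirr lo_irr. Qed.

Lemma before_total b : {in S &, forall u v, u != v -> before b u v || before b v u}.
Proof.
move=> u v uS vS uv; rewrite /before (esym v u); case: ifP => euv; last exact: lo_total.
by rewrite (odd_adj uS vS euv); case: b; case: (odd _).
Qed.

(** Parity settles the cases with two or more edges. With exactly one edge, a wrong order would put
    two of the vertices in one layer, and [lo_sub] would move the edge to a nonadjacent pair. *)
Lemma before_trans b : {in S & &, forall u v w, before b u v -> before b v w -> before b u w}.
Proof.
move=> u v w uS vS wS; rewrite /before.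
have dcase a c : a \in S -> c \in S -> e a c -> d c = (d a).+1 \/ d a = (d c).+1.
  by move=> aS cS; apply: (layering_adj esym eirr sf nhS lay).
case: (boolP (e u v)) => euv; case: (boolP (e v w)) => evw.
- by move=> /eqP h1; rewrite (odd_adj uS vS euv) h1; case: b {h1}.
- move=> odu lvw; case: (boolP (e u w)) => euw //.
  have uw : u != w by apply: contraNneq evw => <-; rewrite esym.
  case/orP: (lo_total uw) => // lwu; exfalso.
  have h1 := lo_d lvw; have h2 := lo_d lwu.
  have dvu : d u = (d v).+1.
    by case: (dcase u v uS vS euv) => //; move: h1 h2; clear; lia.
  have [dwu|dwv] : d w = d u \/ d v = d w by move: dvu h1 h2; clear; lia.
    have [_ h] := lo_sub wS uS lwu dwu vS.
    by move: evw; rewrite esym h // dwu.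
  have [h _] := lo_sub vS wS lvw dwv uS.
  by move: euw; rewrite esym h // esym.
- move=> luv odv; case: (boolP (e u w)) => euw.
    by rewrite -(negbK (odd (d u))) -(odd_adj uS wS euw) (odd_adj vS wS evw) negbK.
  have uw : u != w by apply: contraNneq euv => ->; rewrite esym.
  case/orP: (lo_total uw) => // lwu; exfalso.
  have h1 := lo_d luv; have h2 := lo_d lwu.
  have dwv : d v = (d w).+1.
    by case: (dcase v w vS wS evw) => //; move: h1 h2; clear; lia.
  have [dwu|duv] : d w = d u \/ d u = d v by move: dwv h1 h2; clear; lia.
    have [h _] := lo_sub wS uS lwu dwu vS.
    by move: euv; rewrite h // esym.
  have [_ h] := lo_sub uS vS luv duv wS.
  by move: euw; rewrite h // duv.
- move=> luv lvw; case: (boolP (e u w)) => euw; last exact: lo_trans lvw.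
  exfalso; have h1 := lo_d luv; have h2 := lo_d lvw.
  have duw : d w = (d u).+1.
    by case: (dcase u w uS wS euw) => //; move: h1 h2; clear; lia.
  have [duv|dvw] : d u = d v \/ d v = d w by move: duw h1 h2; clear; lia.
    have [h _] := lo_sub uS vS luv duv wS.
    by move: evw; rewrite h.
  have [_ h] := lo_sub vS wS lvw dvw uS.
  by move: euv; rewrite esym h // ?dvw // esym.
Qed.

Lemma rank_lt (r : rel T) : irreflexive r -> {in S & &, forall u v w, r u v -> r v w -> r u w} ->
  {in S &, forall u v, u != v -> r u v || r v u} ->
  {in S &, forall u v, (#|[set y in S | r y u]| < #|[set y in S | r y v]|) = r u v}.
Proof.
move=> rirr rtr rtot.
have mono : {in S &, forall u v, r u v -> #|[set y in S | r y u]| < #|[set y in S | r y v]|}.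
  move=> u v uS vS ruv; apply: proper_card; apply/properP; split.
    by apply/subsetP=> y; rewrite !inE => /andP[yS ryu]; rewrite yS (rtr y u v).
  by exists u; rewrite !inE uS ?ruv ?rirr.
move=> u v uS vS; apply/idP/idP => [|ruv]; last exact: mono.
have [->|uv] := eqVneq u v; first by rewrite ltnn.
case/orP: (rtot u v uS vS uv) => // rvu; have := mono v u vS uS rvu.
by clear; lia.
Qed.

Lemma layering_bip_perm : bip_perm_on e S.
Proof.
split.
  exists (odd \o d) => u v uS vS euv /=.
  by rewrite (odd_adj uS vS euv); case: odd.
have rk b := rank_lt (before_irr b) (@before_trans b) (@before_total b).
have inj b : {in S &, injective (fun u => #|[set y in S | before b y u]|)}.
  move=> u v uS vS /= h; apply/eqP; apply: contraT => uv.
  by case/orP: (before_total b uS vS uv); rewrite -rk // h ltnn.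
exists (fun u => #|[set y in S | before false y u]|), (fun u => #|[set y in S | before true y u]|).
split; first exact: inj; split; first exact: inj.
move=> u v uS vS uv; rewrite !rk // /before.
by case: (e u v); [case: odd | rewrite eqxx].
Qed.
End Root.

(** The root has least degree in the last layer seen from [w]. Its neighbours all lie one layer
    earlier, so nonneighbours in earlier layers reach [w] through their parents. A last-layer vertex
    with no exit has its neighbourhood inside that of the root, and least degree makes the two
    equal. *)
Lemma root_exists w : w \in S -> {in S &, forall u v, connect (er S) u v} ->
  exists x d, layering e S x d /\ forall u w, u \in nonnb S x -> w \in nonnb S x ->
    [set q in S | e u q] != [set q in S | e x q] ->
    [set q in S | e w q] != [set q in S | e x q] ->
    connect (er (nonnb S x)) u w.
Proof.
move=> wS con.
have [dw lay] : exists d, layering e S w d by apply: layering_exists => // v vS; apply: con.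
have [_ dww d0 dE dP] := lay.
case: (arg_maxnP dw wS) => v0 v0S' v0max; have v0S : v0 \in S := v0S'.
pose D := dw v0; pose deg v := #|[set q in S | e v q]|.
have [x /andP[xS /eqP dx] xmin] : exists2 x, (x \in S) && (dw x == D) &
    forall v, (v \in S) && (dw v == D) -> deg x <= deg v.
  have P0 : (v0 \in S) && (dw v0 == D) by rewrite v0S eqxx.
  by case: (@arg_minnP _ v0 (fun v => (v \in S) && (dw v == D)) deg P0) => x; exists x.
have [d layx] : exists d, layering e S x d by apply: layering_exists => // v vS; apply: con.
have Nx q : q \in S -> e x q -> D = (dw q).+1.
  move=> qS exq; case: (layering_adj esym eirr sf nhS lay xS qS exq); rewrite dx // => h.
  by have := v0max q qS; rewrite -/D h; clear; lia.
have toW m : m \in nonnb S x -> dw m < D -> connect (er (nonnb S x)) m w.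
  move: {2}(dw m) (leqnn (dw m)) => k; elim: k m => [|k IH] m.
    by rewrite leqn0 => /eqP dm mQ _; have [mS _ _] := nonnbP mQ; rewrite (d0 m).
  move=> mk mQ mD; have [mS _ _] := nonnbP mQ.
  have [/(d0 _ mS)->//|dm] := posnP (dw m).
  have [p pS [epm dp]] := dP m mS dm.
  have pQ : p \in nonnb S x.
    rewrite inE pS /=; apply/andP; split.
      by apply: contraTneq mD => h; rewrite -dp h dx; clear; lia.
    by apply/negP=> /(Nx p pS) h; move: mD; rewrite h dp ltnn.
  apply: (@connect_trans _ _ p); first by apply: er_edge; rewrite // esym.
  by apply: IH => //; move: mk mD; rewrite -dp; clear; lia.
have far u : u \in nonnb S x -> [set q in S | e u q] != [set q in S | e x q] ->
    connect (er (nonnb S x)) u w.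
  move=> uQ nu; have [uS ux nxu] := nonnbP uQ.
  have [ltD|geD] := ltnP (dw u) D; first exact: toW.
  have duD : dw u = D by apply/eqP; rewrite eqn_leq geD andbT; apply: v0max.
  have : ~~ ([set q in S | e u q] \subset [set q in S | e x q]).
    apply: contra nu => sub; rewrite eqEcard sub /=.
    by apply: xmin; rewrite uS duD eqxx.
  case/subsetPn=> m; rewrite !inE => /andP[mS eum]; rewrite mS /= => nxm.
  have mQ : m \in nonnb S x.
    by rewrite inE mS nxm andbT; apply: contraNneq nxu => <-; rewrite esym.
  apply: (@connect_trans _ _ m); first exact: er_edge.
  apply: toW => //; case: (layering_adj esym eirr sf nhS lay uS mS eum).
    by have := v0max m mS; rewrite -/D duD; clear; lia.
  by rewrite duD => ->.
exists x, d; split=> // u v uQ vQ nu nv.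
by apply: connect_trans (far u uQ nu) _; rewrite er_csym //; apply: far.
Qed.

Lemma connected_bip_perm : {in S &, forall u v, connect (er S) u v} -> bip_perm_on e S.
Proof.
move=> con; have [->|/set0Pn[w wS]] := eqVneq S set0.
  split; first by exists xpredT => x y; rewrite inE.
  by exists val, val; split; [|split] => x y; rewrite inE.
have [x [d [lay conQ]]] := root_exists wS con.
exact: layering_bip_perm lay conQ.
Qed.

End HoleFree.

(** * Gluing components, and potentials of closed edge functions *)

Section Components.
Variables (n : nat) (e : rel 'I_n).
Hypotheses (esym : symmetric e) (eirr : irreflexive e).
Local Notation T := 'I_n.
Local Notation er := (er e).
Implicit Types (S X Y : {set T}).

Definition component S r := [set v | connect (er S) r v].

Lemma component_sub S r : r \in S -> component S r \subset S.
Proof. by move=> rS; apply/subsetP=> v; rewrite inE => /er_in; apply. Qed.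

Lemma component_closed S r u v : u \in component S r -> u \in S -> v \in S -> e u v -> v \in component S r.
Proof.
by rewrite !inE => ru uS vS euv; apply: connect_trans ru _; apply: er_edge.
Qed.

Lemma component_connected S r : {in component S r &, forall u v, connect (er (component S r)) u v}.
Proof.
have H v : v \in component S r -> connect (er (component S r)) r v.
  rewrite inE => c; apply: (connect_inv (P := fun w => connect (er (component S r)) r w) _ c) => // a b.
  case/and3P=> aS bS eab ra.
  have aC : a \in component S r.
    by apply: (er_in ra); rewrite inE connect0.
  apply: connect_trans ra _.
  by apply: er_edge; rewrite // (component_closed aC aS bS).
by move=> u v uC vC; apply: connect_trans (H v vC); rewrite er_csym //; apply: H.
Qed.

Lemma lex_lt (M a b c d : nat) : b < M -> d < M -> a != c ->
  (a * M + b < c * M + d) = (a < c).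
Proof. move=> bM dM; case: (ltngtP a c) => // h _; apply/idP; clear -bM dM h; nia. Qed.

Lemma lex_eq (M a b c d : nat) : b < M -> d < M -> a * M + b = c * M + d -> a = c.
Proof. move=> bM dM; case: (ltngtP a c) => // h; clear -bM dM h; nia. Qed.

(** The models are placed side by side: the root of a component, read as a number, selects a block
    of length [M] on both lines. *)
Lemma components_bip_perm S : {in S, forall r, bip_perm_on e (component S r)} -> bip_perm_on e S.
Proof.
move=> H.
pose P r (c : (T -> bool) * ((T -> nat) * (T -> nat))) := r \in S ->
  [/\ forall x y, x \in component S r -> y \in component S r -> e x y -> c.1 x != c.1 y,
      {in component S r &, injective c.2.1}, {in component S r &, injective c.2.2} &
      forall x y, x \in component S r -> y \in component S r -> x != y ->
      (e x y <-> (c.2.1 x < c.2.1 y) != (c.2.2 x < c.2.2 y))].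
have [f fP] : exists f, forall r, P r (f r).
  apply: (@fin_all_exists T (fun=> _) P) => r; case: (boolP (r \in S)) => rS.
    by have [[col bp] [p1 [p2 [i1 [i2 h]]]]] := H r rS; exists (col, (p1, p2)).
  by exists (xpredT, (fun=> 0, fun=> 0)) => h; rewrite h in rS.
pose rt v := fingraph.root (er S) v.
have rtP u v : (rt u == rt v) = connect (er S) u v by rewrite root_connect //; apply: er_csym.
have rtS v : v \in S -> rt v \in S by move=> vS; apply: er_in (connect_root _ v) vS.
have inC v : v \in component S (rt v) by rewrite inE er_csym // connect_root.
pose M := (\sum_r \sum_v ((f r).2.1 v + (f r).2.2 v)).+1.
have bnd r v : (f r).2.1 v < M /\ (f r).2.2 v < M.
  have : (f r).2.1 v + (f r).2.2 v < M.
    rewrite ltnS (bigD1 r) //= (bigD1 v) //=; clear; lia.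
  by clear; lia.
have inj (g : T -> T -> nat) : (forall r v, g r v < M) -> (forall r, r \in S -> {in component S r &, injective (g r)}) ->
    {in S &, injective (fun v => rt v * M + g (rt v) v)}.
  move=> gM gi u v uS vS /= h; have rr : rt u = rt v.
    by apply/val_inj; apply: lex_eq h.
  by move: h; rewrite rr => /addnI; apply: (gi (rt v)); rewrite ?rtS // -?rr inC.
split.
  exists (fun v => (f (rt v)).1 v) => u v uS vS euv.
  have rr : rt u = rt v by apply/eqP; rewrite rtP; apply: er_edge.
  have [h _ _ _] := fP (rt v) (rtS v vS).
  by rewrite rr; apply: h; rewrite // -rr.
exists (fun v => rt v * M + (f (rt v)).2.1 v), (fun v => rt v * M + (f (rt v)).2.2 v).
split; first apply: (inj (fun r v => (f r).2.1 v)).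
- by move=> r v; case: (bnd r v).
- by move=> r rS; case: (fP r rS).
split; first apply: (inj (fun r v => (f r).2.2 v)).
- by move=> r v; case: (bnd r v).
- by move=> r rS; case: (fP r rS).
move=> u v uS vS uv; have [rr|rr] := eqVneq (rt u) (rt v).
  have [_ _ _ h] := fP (rt v) (rtS v vS).
  by rewrite rr !ltn_add2l; apply: h; rewrite // -rr.
have [b1 b2] := bnd (rt u) u; have [b3 b4] := bnd (rt v) v.
rewrite !lex_lt // eqxx; split=> // euv.
by move: rr; rewrite rtP er_edge.
Qed.

Theorem hole_free_bip_perm S : small_free e S -> nh e S -> bip_perm_on e S.
Proof.
move=> sf nhS; apply: components_bip_perm => r rS.
have sub := component_sub rS.
apply: connected_bip_perm (component_connected (S := S) (r := r)) => //; first exact: small_freeS sub sf.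
apply/nhP=> a b c d; apply/negP=> /andP[/andP[/and4P[aC bC cC dC] edg] con].
have [aS bS cS dS] : [/\ a \in S, b \in S, c \in S & d \in S] by split; apply: (subsetP sub).
move/nhP: nhS => /(_ a b c d)/negP; apply; rewrite /hole4 aS bS cS dS edg.
apply: er_mono con; apply/subsetP=> q; rewrite !inE => /orP[/andP[qC h]|->]; last by rewrite orbT.
by rewrite h (er_in qC rS).
Qed.

Lemma union_bip_perm X Y : bip_perm_on e X -> bip_perm_on e Y ->
  {in X & Y, forall u v, ~~ e u v} -> bip_perm_on e (X :|: Y).
Proof.
move=> bX bY nXY; apply: components_bip_perm => r rS.
have mv u v : er (X :|: Y) u v -> (u \in X -> v \in X) /\ (u \in Y -> v \in Y).
  case/and3P=> _; rewrite inE => vXY euv; split=> [uX|uY].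
    by case/orP: vXY => // vY; have := nXY u v uX vY; rewrite euv.
  by case/orP: vXY => // vX; have := nXY v u vX uY; rewrite esym euv.
move: rS; rewrite inE => /orP[rX|rY].
  apply: bipS bX; apply/subsetP=> v; rewrite inE => c.
  by apply: (connect_inv (P := fun v => v \in X) _ c) => // u w /mv[].
apply: bipS bY; apply/subsetP=> v; rewrite inE => c.
by apply: (connect_inv (P := fun v => v \in Y) _ c) => // u w /mv[].
Qed.

Local Open Scope Z_scope.

(** The vertices need not be distinct, so the condition applies to every closed walk of four edges
    without side conditions. *)
Definition closed4 S (om : T -> T -> Z) := forall u v w z,
  u \in S -> v \in S -> w \in S -> z \in S -> e u v -> e v w -> e w z -> e z u ->
  om u v + om v w + om w z + om z u = 0.

Definition skew S (om : T -> T -> Z) := forall u v, u \in S -> v \in S -> e u v ->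
  om u v + om v u = 0.

(* Along a layering with nested layers any two parents of a vertex have a common
   parent, so a 1-cochain vanishing on 4-cycles integrates layer by layer. *)
Lemma potential S om : small_free e S -> nh e S -> {in S &, forall u v, connect (er S) u v} ->
  skew S om -> closed4 S om ->
  exists h : T -> Z, {in S &, forall u v, e u v -> h v = h u + om u v}.
Proof.
move=> sf nhS con sk cl.
have [->|/set0Pn[w wS]] := eqVneq S set0; first by exists (fun=> 0) => u v; rewrite inE.
have [x [d [lay conQ]]] := root_exists esym eirr sf nhS wS con.
have nes := nestedP esym eirr sf nhS lay conQ.
have adj := layering_adj esym eirr sf nhS lay.
have [_ dx d0 _ dP] := lay.
pose par v := odflt x [pick u in S | e u v && ((d u).+1 == d v)].
have parP v : v \in S -> (0 < d v)%N -> [/\ par v \in S, e (par v) v & (d (par v)).+1 = d v].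
  move=> vS dv; rewrite /par; case: pickP => [u /and3P[uS euv /eqP du]|none]; first by split.
  by have [u uS [euv du]] := dP v vS dv; have := none u; rewrite uS euv du eqxx.
have step m : exists h : T -> Z, {in S &, forall u v, (d v <= m)%N -> (d u).+1 = d v -> e u v -> h v = h u + om u v}.
  elim: m => [|m [h hP]].
    by exists (fun=> 0) => u v uS vS; rewrite leqn0 => /eqP->.
  exists (fun v => if d v == m.+1 then h (par v) + om (par v) v else h v).
  move=> u v uS vS; rewrite leq_eqVlt => /orP[/eqP dv|]; last first.
    move=> lt du euv.
    have nv : d v != m.+1 by move: lt; clear; lia.
    have nu : d u != m.+1 by move: lt du; clear; lia.
    by rewrite (negbTE nv) (negbTE nu); apply: hP.
  rewrite dv eqxx => -[du] euv; rewrite du (negbTE (_ : m != m.+1)); last by clear; lia.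
  have [|pS epv dp] := parP v vS; first by rewrite dv.
  rewrite dv in dp; case: dp => dp.
  (* In layer 0 both parents are the root itself; otherwise they have a common parent and a 4-cycle
     compares them. *)
  case: m => [|m] in hP du dv dp *.
    by rewrite (d0 u uS du) (d0 _ pS dp).
  have [q qS [dq equ eqp]] := common_parent lay (nes m) uS pS du dp.
  have h1 : h u = h q + om q u by apply: hP; rewrite // ?du ?dq.
  have h2 : h (par v) = h q + om q (par v) by apply: hP; rewrite // ?dp ?dq.
  have c4 : om q u + om u v + om v (par v) + om (par v) q = 0.
    by apply: cl; rewrite // esym.
  have s1 := sk _ _ pS vS epv; have s2 := sk _ _ qS pS eqp.
  by move: h1 h2 c4 s1 s2; clear; lia.
have [h hP] := step (\max_v d v); exists h => u v uS vS euv.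
have mx y : (d y <= \max_v d v)%N by apply: leq_bigmax.
case: (adj u v uS vS euv) => du; first exact: hP.
have := hP v u vS uS (mx u); rewrite -du => /(_ erefl); rewrite esym => /(_ euv).
by have := sk _ _ uS vS euv; clear; lia.
Qed.
End Components.

(** * Holes in graphs without small obstructions *)

Section Holes.
Variables (n : nat) (e : rel 'I_n).
Hypotheses (esym : symmetric e) (eirr : irreflexive e).
Local Notation T := 'I_n.
Local Notation er := (er e).
Implicit Types (S X Y : {set T}).

Definition hole S k (c : nat -> T) :=
  [/\ 4 < k, forall i, c i \in S, forall i, c (i + k) = c i,
      forall i, e (c i) (c i.+1) &
      forall a b, a.+2 <= b -> b.+2 <= a + k -> ~~ e (c a) (c b)].

Lemma hole_shift S k c m : hole S k c -> hole S k (fun i => c (m + i)).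
Proof.
case=> k4 cS per adj nadj; split=> // [i|i|a b h1 h2]; first by rewrite addnA.
  by rewrite addnS.
by apply: nadj; move: h1 h2; clear; lia.
Qed.

Lemma holeS X S k c : hole S k c -> (forall i, c i \in X) -> hole X k c.
Proof. by case=> k4 cS per adj nadj cX; split. Qed.

Lemma hole_mod S k c i j : hole S k c -> i = j %[mod k] -> c i = c j.
Proof.
case=> k4 _ per _ _.
have H m : c m = c (m %% k).
  rewrite {1}(divn_eq m k) addnC; elim: (m %/ k) => [|q IH]; first by rewrite addn0.
  by rewrite mulSn [k + _]addnC addnA per.
by rewrite (H i) (H j) => ->.
Qed.

Lemma hole_hole4 S k c : hole S k c -> hole4 e S (c 3) (c 2) (c 1) (c 0).
Proof.
case=> k4 cS per adj nadj.
have n13 : ~~ e (c 1) (c 3) by apply: nadj; move: k4; clear; lia.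
have n02 : ~~ e (c 0) (c 2) by apply: nadj; move: k4; clear; lia.
have n03 : ~~ e (c 0) (c 3) by apply: nadj; move: k4; clear; lia.
rewrite /hole4 !cS (esym (c 3) (c 2)) (esym (c 2) (c 1)) (esym (c 1) (c 0)) !adj.
rewrite (esym (c 3) (c 1)) n13 (esym (c 2) (c 0)) n02 (esym (c 3) (c 0)) n03 /=.
have H j : 3 + j <= k -> connect (er (avoid2 e S (c 3) (c 2) (c 1) (c 0))) (c 3) (c (3 + j)).
  elim: j => [|j IH] h; first by rewrite addn0.
  apply: connect_trans (IH _) _; first by move: h; clear; lia.
  have inA t : 2 < t <= k -> c t \in avoid2 e S (c 3) (c 2) (c 1) (c 0).
    move=> /andP[t3 tk]; rewrite !inE cS /=.
    have [->|t3'] := eqVneq t 3; first by rewrite eqxx !orbT.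
    have [->|tk'] := eqVneq t k; first by rewrite -(per 0) add0n eqxx !orbT.
    by rewrite !nadj //; move: t3 tk t3' tk'; clear; lia.
  by rewrite addnS; apply: er_edge; rewrite ?adj // inA //; move: h; clear; lia.
have := H (k - 3); rewrite subnKC; last by move: k4; clear; lia.
by rewrite -(per 0) add0n; apply.
Qed.

Lemma hole_not_bip S k c : hole S k c -> bip_perm_on e S -> False.
Proof. by move=> /hole_hole4 hl bp; apply: (hole4_false esym bp hl). Qed.

Lemma hole_ge10 S k c : small_free e S -> hole S k c -> 9 < k.
Proof.
move=> sf hl; rewrite ltnNge; apply/negP=> k9.
have [k4 cS per adj nadj] := hl.
pose X := [set c (nat_of_ord i) | i : 'I_k].
have cX i : c i \in X.
  have kp : 0 < k by move: k4; clear; lia.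
  by apply/imsetP; exists (Ordinal (ltn_pmod i kp)) => //=; apply: (hole_mod hl); rewrite modn_mod.
apply: (hole_not_bip (holeS hl cX)); apply: sf.
  by apply/subsetP=> v /imsetP[i _ ->].
by apply: leq_trans (leq_imset_card _ _) _; rewrite cardT size_enum_ord.
Qed.

(** A repeated vertex or a chord shortens the walk, so the induction is on its length. *)
Lemma induced_walk X a d : connect (er X) a d ->
  exists m f, [/\ f 0 = a, f m = d, forall i, i < m -> er X (f i) (f i.+1) &
    forall i j, i < j <= m -> f i != f j /\ (i.+1 < j -> ~~ e (f i) (f j))].
Proof.
case/connectP=> p pth lst.
have [m [f [f0 fm fE]]] : exists m f, [/\ f 0 = a, f m = d & forall i, i < m -> er X (f i) (f i.+1)].
  exists (size p), (fun i => nth a (a :: p) i); split=> //; first by rewrite -last_nth lst.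
  by move=> i h; have := pathP a pth i h.
elim: m {-2}m (leqnn m) f f0 fm fE {p pth lst} => [|N IH] m mN f f0 fm fE.
  by exists m, f; split=> // i j; move: mN; clear; lia.
pose bad (p : 'I_m.+1 * 'I_m.+1) := (p.1 < p.2) &&
  ((f p.1 == f p.2) || (p.1.+1 < p.2) && e (f p.1) (f p.2)).
case: (pickP bad) => [[i0 j0] /andP[/=]|none]; last first.
  exists m, f; split=> // i j /andP[ij jm].
  have im : i < m.+1 by move: ij jm; clear; lia.
  have := none (Ordinal im, Ordinal (jm : j < m.+1)); rewrite /bad /= ij /=.
  move/negbT; rewrite negb_or => /andP[-> h]; split=> // ij'.
  by move: h; rewrite ij'.
move: (ltn_ord j0); move: (nat_of_ord i0) (nat_of_ord j0) => i j {i0 j0 bad}; rewrite ltnS => jm ij.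
have inX t : t <= m -> 0 < m -> f t \in X.
  case: t => [|t] h m0; first by have /and3P[] := fE 0 m0.
  by have /and3P[] := fE t h.
case/orP=> [/eqP fij|/andP[ij' eij]].
  apply: (IH (m - (j - i)) _ (fun t => if t <= i then f t else f (t + (j - i)))) => /=.
  - by move: mN ij jm; clear; lia.
  - by [].
  - case: ifP => h; last by rewrite -fm; congr f; move: h ij jm; clear; lia.
    rewrite -fm; have -> : m = j by move: h ij jm; clear; lia.
    by rewrite -fij; congr f; move: h ij jm; clear; lia.
  - move=> t tm; have [h|h] := leqP t.+1 i.
      by rewrite (ltnW h); apply: fE; move: h ij jm; clear; lia.
    rewrite addSn; case: ifP => h'; last by apply: fE; move: tm ij jm; clear; lia.
    have -> : f t = f (t + (j - i)); last by apply: fE; move: tm ij jm; clear; lia.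
    have ti : t = i by move: h h'; clear; lia.
    by rewrite ti fij; congr f; move: ij; clear; lia.
apply: (IH (m - (j - i).-1) _ (fun t => if t <= i then f t else f (t + (j - i).-1))) => /=.
- by move: mN ij' jm; clear; lia.
- by [].
- have -> : (m - (j - i).-1 <= i) = false by move: ij' jm; clear; lia.
  by rewrite -fm; congr f; move: ij' jm; clear; lia.
- move=> t tm; have [h|h] := leqP t.+1 i.
    by rewrite (ltnW h); apply: fE; move: h ij jm; clear; lia.
  rewrite addSn; case: ifP => h'; last by apply: fE; move: tm ij' jm; clear; lia.
  have ti : t = i by move: h h'; clear; lia.
  have -> : (t + (j - i).-1).+1 = j by move: ti ij'; clear; lia.
  have m0 : 0 < m by move: ij jm; clear; lia.
  rewrite ti /er /= eij !inX //; move: ij jm; clear; lia.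
Qed.

Lemma hole_of_residues S k (G : nat -> T) : 4 < k -> (forall s, s < k -> G s \in S) ->
  (forall s, s.+1 < k -> e (G s) (G s.+1)) -> e (G k.-1) (G 0) ->
  (forall s s', s.+2 <= s' -> s' < k -> s'.+2 <= s + k -> ~~ e (G s) (G s')) ->
  hole S k (fun i => G (i %% k)).
Proof.
move=> k4 GS Gadj Gl Gn; have kp : 0 < k by move: k4; clear; lia.
split=> //.
- by move=> i; apply: GS; rewrite ltn_pmod.
- by move=> i; rewrite modnDr.
- move=> i; have [h|h] := ltnP (i %% k).+1 k.
    have -> : i.+1 %% k = (i %% k).+1 by rewrite -[i.+1]addn1 -modnDml addn1 modn_small.
    exact: Gadj.
  have ik : (i %% k).+1 = k by apply/eqP; rewrite eqn_leq h ltn_pmod.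
  have -> : i.+1 %% k = 0 by rewrite -[i.+1]addn1 -modnDml addn1 ik modnn.
  by have -> : i %% k = k.-1 by move: ik; clear; lia.
- move=> i j h1 h2.
  have [q jE] : exists q, j = i + q by exists (j - i); move: h1; clear; lia.
  have [h|h] := ltnP (i %% k + q) k.
    have jm : j %% k = i %% k + q by rewrite jE -modnDml modn_small.
    by rewrite jm; apply: Gn; move: h h1 h2 jE; clear; lia.
  have jm : j %% k = i %% k + q - k.
    rewrite jE -modnDml -{1}(subnK h) modnDr modn_small //.
    by have := ltn_pmod i kp; move: h h2 jE; clear; lia.
  rewrite esym jm; have := ltn_pmod i kp => ik.
  by apply: Gn; move: h h1 h2 jE ik; clear; lia.
Qed.

Lemma hole4_hole S a b c d : hole4 e S a b c d -> exists k f, hole S k f.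
Proof.
case/andP=> /andP[/and4P[aS bS cS dS] /and4P[eab ebc ecd /and3P[nac nbd nad]]] con.
have [m [f [f0 fm fE fI]]] := induced_walk con.
have ad : a != d by apply: contraNneq nac => ->; rewrite esym.
have m2 : 1 < m.
  case: m => [|[|m]] // in f0 fm fE fI *; first by rewrite -f0 fm eqxx in ad.
  by have /and3P[_ _] := fE 0 isT; rewrite f0 fm (negbTE nad).
have mid t : 0 < t < m -> [/\ f t \in S, ~~ e b (f t) & ~~ e c (f t)].
  move=> /andP[t0 tm]; have /and3P[+ _ _] := fE t tm; rewrite !inE.
  have [|ft _] := fI 0 t; first by rewrite t0 ltnW.
  have [|tf _] := fI t m; first by rewrite tm leqnn.
  rewrite -f0 -fm eq_sym (negbTE ft) (negbTE tf) !orbF => /and3P[]; by split.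
pose k := m + 3.
(* One turn of the hole: the induced walk from [a] to [d], then [c], then [b]. *)
pose G s := if s <= m then f s else if s == m.+1 then c else b.
have Gf s : s <= m -> G s = f s by rewrite /G => ->.
have Gc : G m.+1 = c by rewrite /G ltnn eqxx.
have Gb : G m.+2 = b.
  rewrite /G; have -> : (m.+2 <= m) = false by clear; lia.
  by have -> : (m.+2 == m.+1) = false by clear; lia.
have Gadj s : s.+1 < k -> e (G s) (G s.+1).
  move=> sk; have [h|h] := leqP s.+1 m.
    by rewrite !Gf ?(ltnW h) //; have /and3P[] := fE s h.
  have [->|sm] := eqVneq s m; first by rewrite Gf // Gc fm esym.
  have -> : s = m.+1 by move: h sk sm; rewrite /k; clear; lia.
  by rewrite Gb Gc esym.
have Gn s s' : s.+2 <= s' -> s' < k -> s'.+2 <= s + k -> ~~ e (G s) (G s').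
  move=> h1 h2 h3; rewrite /G; have [s'm|s'm] := leqP s' m.
    have -> : s <= m by move: h1 s'm; clear; lia.
    by have [|_] := fI s s'; [move: h1 s'm; clear; lia | apply].
  have sm : s <= m by move: h1 h2; rewrite /k; clear; lia.
  rewrite sm; have [s'E|s'E] := eqVneq s' m.+1.
    have [->|s0] := posnP s; first by rewrite f0.
    by have [|_ _] := mid s; [move: s0 h1 s'E; clear; lia | rewrite esym].
  have s0 : 0 < s by move: h2 h3 s'm s'E; rewrite /k; clear; lia.
  have [->|sm'] := eqVneq s m; first by rewrite fm esym.
  by have [|_] := mid s; [move: s0 sm sm'; clear; lia | rewrite esym].
have GS s : G s \in S.
  rewrite /G; case: ifP => h; last by case: ifP.
  have [->|s0] := posnP s; first by rewrite f0.
  have [->|sm'] := eqVneq s m; first by rewrite fm.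
  by have [|//] := mid s; move: s0 h sm'; clear; lia.
exists k, (fun i => G (i %% k)); apply: hole_of_residues => //.
  by rewrite /k; move: m2; clear; lia.
by rewrite /k addn3 /= Gb Gf // f0 esym.
Qed.

End Holes.

(** * How a vertex attaches to a hole *)

Section Around.
Variables (n : nat) (e : rel 'I_n).
Hypotheses (esym : symmetric e) (eirr : irreflexive e).
Local Notation T := 'I_n.
Local Notation er := (er e).
Variables (S : {set T}) (k : nat) (c : nat -> T).
Hypotheses (sf : small_free e S) (hl : hole e S k c).

Let k10 : 9 < k. Proof. exact: (hole_ge10 esym sf hl). Qed.
Let cS i : c i \in S. Proof. by case: hl. Qed.
Let cper i : c (i + k) = c i. Proof. by case: hl. Qed.
Let cadj a b : a.+1 = b -> e (c a) (c b). Proof. by move=> <-; case: hl. Qed.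
Let cnad a b : a.+2 <= b -> b.+2 <= a + k -> ~~ e (c a) (c b).
Proof. by case: hl => _ _ _ _; apply. Qed.

Ltac clia := first [clear -k10; lia | match goal with h1 : is_true (_ <= _), h2 : is_true (_ <= _) |- _ => clear -k10 h1 h2; lia end].
Ltac edg := solve
  [ assumption | rewrite esym; assumption | exact: cS
  | apply: cadj; clia | rewrite esym; apply: cadj; clia
  | apply: cnad; clia | rewrite esym; apply: cnad; clia ].
Ltac edgs := rewrite /=; repeat (apply/andP; split); solve [exact isT | edg].
Ltac memL := by rewrite /= ?inE ?eqxx ?orbT.
Ltac avoids := apply/and4P; split; [exact isT | edgs | exact: eqxx | edgs].
Ltac asteroid L x y z p q r :=
  refine (@asteroidal_small _ _ esym _ sf L x y z p q r _ _ _ _ _ _ _ _);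
  [exact isT | edgs | memL | memL | memL | avoids | avoids | avoids].
Ltac shortcyc q a b c d := refine (@cycle_small _ _ esym _ sf q a b c d _ _ _ _ _);
  [exact isT | edgs | edgs | edgs | edgs].

Lemma cyc_tri v i j : v \in S -> e v (c i) -> (i.+1 = j \/ j.+1 = i) -> ~~ e v (c j).
Proof.
move=> vS ev ij; apply: (triangle_free sf vS (cS i) (cS j)) => //.
by case: ij => h; [|rewrite esym]; apply: cadj.
Qed.

(** This lets a walk of the graph be shadowed on the hole: after possibly replacing the hole
    neighbour of [a] by one two steps away, an edge of the graph goes with one step along the hole.
    Otherwise an asteroidal triple or a short hole appears. The offset 3 keeps all indices
    natural. *)
Lemma slide a b i : a \in S -> b \in S -> e a (c (i + 3)) -> e a b ->
  [\/ e b (c (i + 2)), e b (c (i + 4)), e a (c (i + 5)) /\ e b (c (i + 6)) |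
      e a (c (i + 1)) /\ e b (c i)].
Proof.
move=> aS bS a3 ab.
case: (boolP (e b (c (i + 2)))) => b2; first by constructor 1.
case: (boolP (e b (c (i + 4)))) => b4; first by constructor 2.
have a2 : ~~ e a (c (i + 2)) by apply: (cyc_tri aS a3); clia.
have a4 : ~~ e a (c (i + 4)) by apply: (cyc_tri aS a3); clia.
have ba : e b a by rewrite esym.
have b3 : ~~ e b (c (i + 3)) by apply: (triangle_free sf bS aS (cS _)).
case: (boolP (e a (c (i + 5)))) => a5.
  case: (boolP (e b (c (i + 6)))) => b6; first by constructor 3.
  have a6 : ~~ e a (c (i + 6)) by apply: (cyc_tri aS a5); clia.
  have b5 : ~~ e b (c (i + 5)) by apply: (triangle_free sf bS aS (cS _)).
  exfalso.
  asteroid [:: c (i + 2); c (i + 3); c (i + 4); c (i + 5); c (i + 6); a; b]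
    (c (i + 2)) (c (i + 6)) b [:: c (i + 3); c (i + 4); c (i + 5); c (i + 6)]
    [:: c (i + 5); a; b] [:: a; c (i + 3); c (i + 2)].
case: (boolP (e a (c (i + 1)))) => a1.
  case: (boolP (e b (c i))) => b0; first by constructor 4.
  have a0 : ~~ e a (c i) by apply: (cyc_tri aS a1); clia.
  have b1 : ~~ e b (c (i + 1)) by apply: (triangle_free sf bS aS (cS _)).
  exfalso.
  asteroid [:: c i; c (i + 1); c (i + 2); c (i + 3); c (i + 4); a; b]
    (c i) (c (i + 4)) b [:: c (i + 1); c (i + 2); c (i + 3); c (i + 4)]
    [:: c (i + 3); a; b] [:: a; c (i + 1); c i].
exfalso.
have b1 : ~~ e b (c (i + 1)).
  by apply/negP=> b1; shortcyc [:: b] a (c (i + 3)) (c (i + 2)) (c (i + 1)).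
have b5 : ~~ e b (c (i + 5)).
  by apply/negP=> b5; shortcyc [:: b] a (c (i + 3)) (c (i + 4)) (c (i + 5)).
asteroid [:: c (i + 1); c (i + 2); c (i + 3); c (i + 4); c (i + 5); a; b]
  (c (i + 1)) (c (i + 5)) b [:: c (i + 2); c (i + 3); c (i + 4); c (i + 5)]
  [:: c (i + 4); c (i + 3); a; b] [:: a; c (i + 3); c (i + 2); c (i + 1)].
Qed.

(** Having a neighbour on the hole propagates along edges by [slide]. *)
Lemma dominating v : {in S &, forall u v, connect (er S) u v} -> v \in S ->
  exists i, e v (c i).
Proof.
move=> con vS; have con0 := con _ _ (cS 0) vS.
apply: (connect_inv (P := fun v => exists i, e v (c i)) _ con0) => [u w|]; last first.
  by exists 1; apply: cadj.
case/and3P=> uS wS euw [i eui].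
have eui' : e u (c (i + k - 3 + 3)).
  by rewrite subnK ?cper //; clear -k10; lia.
by case: (slide uS wS eui' euw) => [h|h|[_ h]|[_ h]]; eexists; exact: h.
Qed.

Lemma cyc_no3 v i : v \in S -> e v (c i) -> ~~ e v (c (i + 3)).
Proof.
move=> vS v0; apply/negP=> v3.
have v1 : ~~ e v (c (i + 1)) by apply: (cyc_tri vS v0); clia.
have v2 : ~~ e v (c (i + 2)) by apply: (cyc_tri vS v3); clia.
shortcyc [:: v] (c i) (c (i + 1)) (c (i + 2)) (c (i + 3)).
Qed.

Lemma cyc_4 v i : v \in S -> e v (c i) -> e v (c (i + 4)) -> e v (c (i + 2)).
Proof.
move=> vS v0 v4; apply: contraT => v2; exfalso.
have v1 : ~~ e v (c (i + 1)) by apply: (cyc_tri vS v0); clia.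
have v3 : ~~ e v (c (i + 3)) by apply: (cyc_tri vS v4); clia.
shortcyc [:: v; c (i + 4)] (c i) (c (i + 1)) (c (i + 2)) (c (i + 3)).
Qed.

Lemma cyc_run v i : v \in S -> e v (c i) -> e v (c (i + 2)) -> e v (c (i + 4)) ->
  ~~ e v (c (i + 6)).
Proof.
move=> vS v0 v2 v4; apply/negP=> v6.
have v1 : ~~ e v (c (i + 1)) by apply: (cyc_tri vS v0); clia.
have v3 : ~~ e v (c (i + 3)) by apply: (cyc_tri vS v2); clia.
have v5 : ~~ e v (c (i + 5)) by apply: (cyc_tri vS v4); clia.
asteroid [:: c i; c (i + 1); c (i + 2); c (i + 3); c (i + 4); c (i + 5); c (i + 6); v]
  (c (i + 1)) (c (i + 3)) (c (i + 5)) [:: c (i + 2); c (i + 3)] [:: c (i + 4); c (i + 5)]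
  [:: c (i + 6); v; c i; c (i + 1)].
Qed.

(** With the preceding lemmas, the neighbours of a vertex on the hole form a run of at most three
    vertices with gaps of two. *)
Lemma cyc_far v i j : v \in S -> e v (c i) -> 5 <= j - i -> j + 5 <= i + k -> ~~ e v (c j).
Proof.
move=> vS vi h1 h2; apply/negP=> vj.
have i' : i + k - 3 + 3 = i + k by rewrite subnK //; clear -k10; lia.
have {}vi : e v (c (i + k - 3 + 3)) by rewrite i' cper.
have {}vj : e v (c (j + k)) by rewrite cper.
have {}h1 : i + k - 3 + 3 + 5 <= j + k by clear -h1 k10; lia.
have {}h2 : j + k + 5 <= i + k - 3 + 3 + k by clear -h2 k10; lia.
move: (i + k - 3) (j + k) vi vj h1 h2 {i'} => {}i {}j v3 vj h1 h2.
have vj1 : ~~ e v (c j.+1) by apply: (cyc_tri vS vj); left.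
have vjp : ~~ e v (c j.-1) by apply: (cyc_tri vS vj); right; clear -h1; lia.
have v2 : ~~ e v (c (i + 2)) by apply: (cyc_tri vS v3); clia.
have v4 : ~~ e v (c (i + 4)) by apply: (cyc_tri vS v3); clia.
case: (boolP (e v (c (i + 5)))) => v5.
  have v6 : ~~ e v (c (i + 6)) by apply: (cyc_tri vS v5); clia.
  asteroid [:: c (i + 2); c (i + 3); v; c (i + 5); c (i + 6); c j; c j.+1]
    (c (i + 2)) (c (i + 6)) (c j.+1) [:: c (i + 3); v; c (i + 5); c (i + 6)]
    [:: c (i + 5); v; c j; c j.+1] [:: c j; v; c (i + 3); c (i + 2)].
case: (boolP (e v (c (i + 1)))) => v1.
  have v0 : ~~ e v (c i) by apply: (cyc_tri vS v1); clia.
  asteroid [:: c i; c (i + 1); v; c (i + 3); c (i + 4); c j; c j.-1]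
    (c i) (c (i + 4)) (c j.-1) [:: c (i + 1); v; c (i + 3); c (i + 4)]
    [:: c (i + 3); v; c j; c j.-1] [:: c j; v; c (i + 1); c i].
asteroid [:: c (i + 1); c (i + 2); c (i + 3); c (i + 4); c (i + 5); v; c j]
  (c (i + 1)) (c (i + 5)) (c j) [:: c (i + 2); c (i + 3); c (i + 4); c (i + 5)]
  [:: c (i + 4); c (i + 3); v; c j] [:: v; c (i + 3); c (i + 2); c (i + 1)].
Qed.
End Around.

(** * Winding around a hole *)

Section Winding.
Variables (n : nat) (e : rel 'I_n).
Hypotheses (esym : symmetric e) (eirr : irreflexive e).
Local Notation T := 'I_n.
Local Notation er := (er e).
Variable (S : {set T}).
Hypotheses (sf : small_free e S).

Definition wide c v i := e v (c i) && e v (c (i + 4)).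
Definition leap c v w i :=
  [&& e v w, e v (c i), e v (c (i + 2)), e w (c (i + 3)) & e w (c (i + 5))].
(* Either forbidden pattern gives a hole of length k - 2, so a shortest hole is tight. *)
Definition tight k (c : nat -> T) := [/\ hole e S k c,
  forall v i, v \in S -> ~~ wide c v i & forall v w i, v \in S -> w \in S -> ~~ leap c v w i].

(** The vertex [v] replaces [c 1], [c 2], [c 3]; the work is to show that it has no further
    neighbour on the hole. *)
Lemma wide_shorten k c v : hole e S k c -> v \in S -> wide c v 0 -> exists c', hole e S (k - 2) c'.
Proof.
move=> hl vS /andP[v0 v4]; have k10 := hole_ge10 esym sf hl.
have v2 := cyc_4 esym sf hl vS v0 v4; rewrite !add0n in v2 v4.
have [_ cS per adj nadj] := hl.
have vj j : 5 <= j < k -> ~~ e v (c j).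
  move=> /andP[j5 jk].
  have [h|h] := leqP 9 j.
    by apply: (cyc_far esym sf hl vS v4); move: h jk k10; clear; lia.
  have [->|j6] := eqVneq j 6; first exact: (cyc_run esym sf hl vS v0 v2 v4).
  have [j8|j8] := eqVneq j 8; last first.
    have [->|j5'] := eqVneq j 5; first by apply: (cyc_tri esym sf hl vS v4); left.
    by apply: (cyc_far esym sf hl vS v2); move: h j5 j6 j5' j8 k10; clear; lia.
  (* For [k] equal to 10, [c 8] is only four steps from [c 2] around the other side; a neighbour
     there would complete the forbidden run [c 8], [c 0], [c 2], [c 4]. *)
  rewrite j8; have [k10'|k10'] := eqVneq k 10; last first.
    by apply: (cyc_far esym sf hl vS v2); move: k10 k10'; clear; lia.
  have p2 : c (8 + 2) = c 0 by have := per 0; rewrite k10'.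
  have p4 : c (8 + 4) = c 2 by have := per 2; rewrite k10'.
  have p6 : c (8 + 6) = c 4 by have := per 4; rewrite k10'.
  apply/negP=> v8; have := cyc_run esym sf hl vS v8.
  by rewrite p2 p4 p6 v4 => /(_ v0 v2).
pose G s := if s == 0 then v else c (s + 3).
exists (fun i => G (i %% (k - 2))); apply: hole_of_residues => //.
- by move: k10; clear; lia.
- by move=> [|s] _; rewrite /G /=.
- by move=> [|s] _; rewrite /G //=.
- have -> : (k - 2).-1 = (k - 4).+1 by move: k10; clear; lia.
  rewrite /G /=; have -> : (k - 4).+1 + 3 = 0 + k by move: k10; clear; lia.
  by rewrite per esym.
- move=> [|s] [|s'] // h1 h2 h3; rewrite /G /=; first by apply: vj; move: h1 h2 h3; clear; lia.
  by apply: nadj; move: h1 h2 h3 k10; clear; lia.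
Qed.

(** The edge from [v] to [w] replaces the four vertices [c 1] to [c 4]. *)
Lemma leap_shorten k c v w : hole e S k c -> (forall v i, v \in S -> ~~ wide c v i) ->
  v \in S -> w \in S -> leap c v w 0 -> exists c', hole e S (k - 2) c'.
Proof.
move=> hl nw vS wS /and5P[vw v0 v2 w3 w5]; have k10 := hole_ge10 esym sf hl.
have [_ cS per adj nadj] := hl; rewrite !add0n in v2 w3 w5.
have nwide u i j : u \in S -> j = i + 4 -> e u (c i) -> ~~ e u (c j).
  by move=> uS -> ei; have := nw u i uS; rewrite /wide ei.
have vj j : 5 <= j < k -> ~~ e v (c j).
  move=> /andP[j5 jk].
  have [->|j5'] := eqVneq j 5; first by apply: (cyc_far esym sf hl vS v0); move: k10; clear; lia.
  have [->|j6] := eqVneq j 6; first exact: (nwide v 2).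
  have [jk1|jk1] := eqVneq j.+1 k.
    by apply: (cyc_tri esym sf hl vS (i := k)); [rewrite -[k]add0n per | right].
  have [jk2|jk2] := eqVneq j.+2 k.
    apply/negP=> vj; have := nwide v j (2 + k) vS _ vj; rewrite per v2 => h.
    by have := h _; move: jk2; clear; lia.
  by apply: (cyc_far esym sf hl vS v2); move: j5 j5' j6 jk jk1 jk2; clear; lia.
have wj j : 6 <= j <= k -> ~~ e w (c j).
  move=> /andP[j6 jk].
  have [->|j6'] := eqVneq j 6; first by apply: (cyc_tri esym sf hl wS w5); left.
  have [->|j7] := eqVneq j 7; first exact: (nwide w 3).
  have [jk1|jk1] := eqVneq j.+1 k.
    apply/negP=> wj; have := nwide w j (3 + k) wS _ wj; rewrite per w3 => h.
    by have := h _; move: jk1; clear; lia.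
  have [jk0|jk0] := eqVneq j k.
    apply/negP=> wj; have := cyc_no3 esym sf hl wS wj.
    by rewrite jk0 addnC per w3.
  by apply: (cyc_far esym sf hl wS w3); move: j6 j6' j7 jk jk1 jk0; clear; lia.
pose G s := if s == 0 then v else if s == 1 then w else c (s + 3).
exists (fun i => G (i %% (k - 2))); apply: hole_of_residues => //.
- by move: k10; clear; lia.
- by move=> [|[|s]] _; rewrite /G /=.
- by move=> [|[|s]] _; rewrite /G //=.
- have -> : (k - 2).-1 = (k - 5).+2 by move: k10; clear; lia.
  rewrite /G /=; have -> : (k - 5).+2 + 3 = 0 + k by move: k10; clear; lia.
  by rewrite per esym.
- move=> [|[|s]] [|[|s']] // h1 h2 h3; rewrite /G /=.
  + by apply: vj; move: h1 h2 h3; clear; lia.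
  + by apply: wj; move: h1 h2; clear; lia.
  + by apply: nadj; move: h1 h2 h3 k10; clear; lia.
Qed.

Lemma tight_exists k c : hole e S k c -> exists k' c', tight k' c'.
Proof.
elim: k {-2}k (leqnn k) c => [|N IH] k kN c hl.
  by have := hole_ge10 esym sf hl; move: kN; clear; lia.
have k10 := hole_ge10 esym sf hl; have kp : 0 < k by move: k10; clear; lia.
have k2 : k - 2 <= N by move: kN k10; clear; lia.
have red i t : c (i %% k + t) = c (i + t) by apply: (hole_mod hl); rewrite modnDml.
have red0 i : c (i %% k) = c i by apply: (hole_mod hl); rewrite modn_mod.
case: (pickP (fun p : T * 'I_k => (p.1 \in S) && wide c p.1 p.2)) => [[v i] /= /andP[vS wd]|nw].
  have [|c' /(IH _ k2)//] := wide_shorten (hole_shift i hl) vS.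
  by move: wd; rewrite /wide /= addn0 add0n.
have {}nw v i : v \in S -> ~~ wide c v i.
  move=> vS; have := nw (v, Ordinal (ltn_pmod i kp)); rewrite /= vS /wide /= red red0.
  by move=> ->.
case: (pickP (fun p : T * T * 'I_k => [&& p.1.1 \in S, p.1.2 \in S & leap c p.1.1 p.1.2 p.2]))
    => [[[v w] i] /= /and3P[vS wS lp]|nl].
  have nw' u j : u \in S -> ~~ wide (fun t => c (i + t)) u j.
    by move=> uS; have := nw u (i + j) uS; rewrite /wide addnA.
  have [|c' /(IH _ k2)//] := leap_shorten (hole_shift i hl) nw' vS wS.
  by move: lp; rewrite /leap /= addn0 !add0n.
exists k, c; split=> // v w i vS wS.
have := nl (v, w, Ordinal (ltn_pmod i kp)); rewrite /= vS wS /leap /= !red red0.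
by move=> ->.
Qed.

(** * Positions along a tight hole *)

Section Position.
Variables (k : nat) (c : nat -> T).
Hypotheses (ti : tight k c) (con : {in S &, forall u v, connect (er S) u v}).
Let hl : hole e S k c. Proof. by case: ti. Qed.
Let k10 : 9 < k. Proof. exact: (hole_ge10 esym sf hl). Qed.
Let kp : 0 < k. Proof. by move: k10; clear; lia. Qed.

Lemma tight_nbrs v i t : v \in S -> e v (c i) -> e v (c (i + t)) -> t < k ->
  [\/ t = 0, t = 2 | t.+2 = k].
Proof.
move=> vS vi vt tk; have [_ nw _] := ti; have [_ _ per _ _] := hl.
have vik : e v (c (i + k)) by rewrite per.
have [->|t0] := eqVneq t 0; first by constructor 1.
have [->|t2] := eqVneq t 2; first by constructor 2.
have [<-|tk2] := eqVneq t.+2 k; first by constructor 3.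
exfalso; have [t1|t1] := eqVneq t 1.
  by have := cyc_tri esym sf hl vS vi (or_introl erefl); rewrite -[i.+1]addn1 -t1 vt.
have [t3|t3] := eqVneq t 3.
  by have := cyc_no3 esym sf hl vS vi; rewrite -t3 vt.
have [t4|t4] := eqVneq t 4.
  by have := nw v i vS; rewrite /wide vi -t4 vt.
have [tk1|tk1] := eqVneq t.+1 k.
  have := cyc_tri esym sf hl vS vt (or_introl erefl).
  by rewrite -addnS tk1 vik.
have [tk3|tk3] := eqVneq (t + 3) k.
  by have := cyc_no3 esym sf hl vS vt; rewrite -addnA tk3 vik.
have [tk4|tk4] := eqVneq (t + 4) k.
  by have := nw v (i + t) vS; rewrite /wide vt -addnA tk4 vik.
have := cyc_far esym sf hl vS vi (j := i + t); rewrite vt => h.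
by have : false by apply: h; move: t0 t1 t2 t3 t4 tk1 tk2 tk3 tk4 tk; clear; lia.
Qed.

(** On a tight hole a vertex has one neighbour, or two at distance 2 whose middle becomes its
    position. Only the class modulo [k] matters, and domination rules out the default 0. *)
Definition pos v :=
  if [pick i : 'I_k | e v (c i) && e v (c (i + 2))] is Some i then i.+1
  else if [pick i : 'I_k | e v (c i)] is Some i then nat_of_ord i else 0.

Local Open Scope Z_scope.
Local Notation Zn := Z.of_nat.

Definition cong i j := exists q, (Zn i = Zn j + q * Zn k).

Lemma cong_add i : cong i (i %% k)%N.
Proof. by exists (Zn (i %/ k)%N); have := divn_eq i k; clear; nia. Qed.

Lemma cong_c i j : cong i j -> c i = c j.
Proof.
case=> q h; apply: (hole_mod hl).
have [a [b ab]] : exists a b : nat, (i + a * k = j + b * k)%N.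
  have [q0|q0] := Z_le_gt_dec 0 q.
    by exists 0%N, (Z.to_nat q); move: h; rewrite -{1}(Z2Nat.id q) //; clear; nia.
  exists (Z.to_nat (- q)), 0%N; have : Zn (Z.to_nat (- q)) = - q by rewrite Z2Nat.id //; clear -q0; lia.
  by move: h; clear; nia.
by rewrite -(modnMDl a) addnC ab addnC modnMDl.
Qed.

(** Here the length of the hole is used: for integers this small, congruence modulo [k] is
    equality. *)
Lemma small_multiple z : -9 <= z * Zn k <= 9 -> z * Zn k = 0.
Proof.
have kz : 10 <= Zn k by move: k10; clear; lia.
move=> h; have [z0|[->|z0]] := Z.lt_trichotomy z 0; last 2 first; [by [] | |].
  by move: h kz z0; clear; nia.
by move: h kz z0; clear; nia.
Qed.

(** The offset is nonzero only when [v] has two neighbours on the hole; the last clause then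
    recovers both of them. *)
Lemma posP v j : v \in S -> e v (c j) ->
  exists d, [/\ -1 <= d <= 1, exists q, (Zn j = Zn (pos v) + d + q * Zn k) &
    d <> 0 -> forall i t, cong i (pos v) -> (t.+1 = i \/ i.+1 = t)%N -> e v (c t)].
Proof.
move=> vS ej.
have dist i : e v (c i) -> exists d q, Zn j = Zn i + d + q * Zn k /\ (d = 0 \/ d = 2 \/ d = -2).
  move=> ei; have [t tk [q tq]] : exists2 t, (t < k)%N & exists q, (Zn j = Zn i + Zn t + q * Zn k).
    exists ((j + (i * k - i)) %% k)%N; first by rewrite ltn_pmod.
    have [q h] := cong_add (j + (i * k - i))%N; exists (q - Zn i).
    have ik : (i <= i * k)%N by rewrite leq_pmulr.
    move: h ik; move: (_ %% _)%N => m; clear; nia.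
  have ct : c (i + t)%N = c j by symmetry; apply: cong_c; exists q; move: tq; clear; lia.
  have [] := tight_nbrs vS ei (t := t); rewrite ?ct // => h.
  - by exists 0, q; split; [move: tq h; clear; lia | left].
  - by exists 2, q; split; [move: tq h; clear; lia | right; left].
  - by exists (-2), (q + 1); split; [move: tq h; clear; lia | right; right].
rewrite /pos; case: pickP => [i /andP[ei ei2]|none].
  have [d [q [h1 h2]]] := dist _ ei; have [d' [q' [h3 h4]]] := dist _ ei2.
  have dd : d = 0 \/ d = 2.
    have : (q' - q) * Zn k = d - d' - 2 by move: h1 h3; clear; lia.
    by move: (@small_multiple (q' - q)) h2 h4; clear; lia.
  exists (d - 1); split; first by move: dd; clear; lia.
    by exists q; move: h1; clear; lia.
  move=> _ i' t ci [] h.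
    have -> : c t = c i by apply: cong_c; case: ci => r hr; exists r; move: hr h; clear; lia.
    exact: ei.
  have -> : c t = c (i + 2)%N by apply: cong_c; case: ci => r hr; exists r; move: hr h; clear; lia.
  exact: ei2.
case: pickP => [i ei|none']; last first.
  have := none' (Ordinal (ltn_pmod j kp)) => /=.
  by rewrite (hole_mod hl (modn_mod j k)) ej.
have [d [q [h1 h2]]] := dist _ ei; exists 0; split=> //; exists q.
suff d0 : d = 0 by move: h1; rewrite d0.
case: h2 => // h2; exfalso.
have pair a b : e v (c a) -> e v (c b) -> cong b (a + 2)%N -> False.
  move=> ea eb cb; have := none (Ordinal (ltn_pmod a kp)) => /=.
  rewrite (hole_mod hl (modn_mod a k)) ea.
  have -> : c (a %% k + 2)%N = c b; last by rewrite eb.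
  rewrite (cong_c cb); apply: (hole_mod hl); exact: modnDml.
case: h2 => h2.
  by apply: (pair i j) => //; exists q; move: h1 h2; clear; lia.
by apply: (pair j i) => //; exists (- q); move: h1 h2; clear; lia.
Qed.

(** By [slide] the edge has hole neighbours one step apart, each within 1 of the position, so the
    positions differ by at most 3. A difference of 3 is exactly a leap, which tightness excludes. *)
Lemma pos_edge v w : v \in S -> w \in S -> e v w ->
  exists d q, -2 <= d <= 2 /\ Zn (pos w) = Zn (pos v) + d + q * Zn k.
Proof.
move=> vS wS vw; have [i ei] := dominating esym sf hl con vS.
have [_ nw nl] := ti; have [_ _ per _ _] := hl.
have [a [b [va wb ab]]] : exists a b, [/\ e v (c a), e w (c b) & (a.+1 = b \/ b.+1 = a)%N].
  have ei' : e v (c (i + k - 3 + 3)%N) by rewrite subnK ?per //; move: k10; clear; lia.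
  case: (slide esym sf hl vS wS ei' vw) => [h|h|[h1 h2]|[h1 h2]].
  - by exists (i + k - 3 + 3)%N, (i + k - 3 + 2)%N; split=> //; clear; lia.
  - by exists (i + k - 3 + 3)%N, (i + k - 3 + 4)%N; split=> //; clear; lia.
  - by exists (i + k - 3 + 5)%N, (i + k - 3 + 6)%N; split=> //; clear; lia.
  - by exists (i + k - 3 + 1)%N, (i + k - 3)%N; split=> //; clear; lia.
have [d [dd [q hq] dn]] := posP vS va; have [d' [dd' [q' hq'] dn']] := posP wS wb.
have noleap x y s t : x \in S -> y \in S -> e x y -> e x (c s) -> e y (c t) -> (s.+1 = t)%N ->
    (forall i t, cong i (pos x) -> (t.+1 = i \/ i.+1 = t)%N -> e x (c t)) ->
    (forall i t, cong i (pos y) -> (t.+1 = i \/ i.+1 = t)%N -> e y (c t)) ->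
    cong s (pos x).+1 -> cong t.+1 (pos y) -> False.
  move=> xS yS xy xs yt st hx hy cs ct.
  have cs' : cong (s + k).-1 (pos x).
    by case: cs => r hr; exists (r + 1); move: hr kp; clear; lia.
  have ct' : cong (t + k).+1 (pos y).
    by case: ct => r hr; exists (r + 1); move: hr; clear; lia.
  have := nl x y (s + k - 2)%N xS yS; rewrite /leap xy => /negP; apply.
  have e1 : e x (c (s + k - 2)%N) by apply: (hx _ _ cs'); move: k10; clear; lia.
  have e2 : e x (c (s + k - 2 + 2)%N) by apply: (hx _ _ cs'); move: k10; clear; lia.
  have e3 : e y (c (s + k - 2 + 3)%N) by apply: (hy _ _ ct'); move: k10 st; clear; lia.
  have e4 : e y (c (s + k - 2 + 5)%N) by apply: (hy _ _ ct'); move: k10 st; clear; lia.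
  by rewrite e1 e2 e3 e4.
case: ab => ab.
  exists (d + 1 - d'), (q - q'); split; last by move: hq hq' ab; clear; lia.
  suff nd : ~ (d = 1 /\ d' = -1) by move: nd dd dd'; clear; lia.
  case=> d1 d1'; apply: (noleap v w a b) => //.
  - by apply: dn; rewrite d1.
  - by apply: dn'; rewrite d1'.
  - by exists q; move: hq d1; clear; lia.
  - by exists q'; move: hq' d1'; clear; lia.
exists (d - 1 - d'), (q - q'); split; last by move: hq hq' ab; clear; lia.
suff nd : ~ (d = -1 /\ d' = 1) by move: nd dd dd'; clear; lia.
case=> d1 d1'; apply: (noleap w v b a) => //.
- by rewrite esym.
- by apply: dn'; rewrite d1'.
- by apply: dn; rewrite d1.
- by exists q'; move: hq' d1'; clear; lia.
- by exists q; move: hq d1; clear; lia.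
Qed.

(* The signed number of steps from v to w along the hole. *)
Definition omega v w :=
  let d := (Zn (pos w) - Zn (pos v)) mod Zn k in if d <=? 2 then d else d - Zn k.

Lemma omegaP v w : v \in S -> w \in S -> e v w ->
  -2 <= omega v w <= 2 /\ exists q, omega v w = Zn (pos w) - Zn (pos v) + q * Zn k.
Proof.
move=> vS wS vw; have [d [q [dd h]]] := pos_edge vS wS vw.
rewrite /omega; set m := _ mod _.
have mE : m = d mod Zn k.
  rewrite /m; have -> : Zn (pos w) - Zn (pos v) = d + q * Zn k by move: h; clear; lia.
  by rewrite Z_mod_plus_full.
have md : m = if 0 <=? d then d else d + Zn k.
  rewrite mE; case: Z.leb_spec => d0; first by rewrite Z.mod_small //; move: dd k10 d0; clear; lia.
  by rewrite -(Z_mod_plus_full d 1) Z.mod_small; move: dd k10 d0; clear; lia.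
case: (Z.leb_spec 0 d) md => d0 md; case: Z.leb_spec => m2.
- by split; [move: md dd d0; clear; lia | exists (- q); move: md h; clear; lia].
- by move: md dd m2; clear; lia.
- by move: md dd m2 d0 k10; clear; lia.
- by split; [move: md dd d0; clear; lia | exists (- q); move: md h; clear; lia].
Qed.

Lemma omega_skew : skew e S omega.
Proof.
move=> u v uS vS uv; have [b1 [q1 h1]] := omegaP uS vS uv.
have [|b2 [q2 h2]] := omegaP vS uS; first by rewrite esym.
have := @small_multiple (q1 + q2); move: b1 b2 h1 h2; clear; lia.
Qed.

(** Four values of size at most 2 add up to at most 8, and the sum is a multiple of [k]. *)
Lemma omega_closed4 : closed4 e S omega.
Proof.
move=> u v w z uS vS wS zS uv vw wz zu.
have [b1 [q1 h1]] := omegaP uS vS uv; have [b2 [q2 h2]] := omegaP vS wS vw.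
have [b3 [q3 h3]] := omegaP wS zS wz; have [b4 [q4 h4]] := omegaP zS uS zu.
have := @small_multiple (q1 + q2 + q3 + q4); move: b1 b2 b3 b4 h1 h2 h3 h4; clear; lia.
Qed.

Lemma pos_cycle t : exists q, Zn (pos (c t)) = Zn t + q * Zn k.
Proof.
have [_ cS per adj _] := hl.
have e1 : e (c t) (c t.+1) := adj t.
have e2 : e (c t) (c (t + k).-1).
  have tk : (t + k = (t + k).-1.+1)%N by move: kp; clear; lia.
  by rewrite -[c t]per {1}tk esym; apply: adj.
have [d1 [b1 [q1 h1] _]] := posP (cS t) e1; have [d2 [b2 [q2 h2] _]] := posP (cS t) e2.
have h3 : (q2 - q1 - 1) * Zn k = d1 - d2 - 2 by move: h1 h2 kp; clear; lia.
have h4 := @small_multiple (q2 - q1 - 1).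
by exists (- q1); move: h1 h3 h4 b1 b2; clear; lia.
Qed.

Lemma omega_cycle t : omega (c t) (c t.+1) = 1.
Proof.
have [_ cS per adj _] := hl.
have [b [q h]] := omegaP (cS t) (cS t.+1) (adj t).
have [q1 h1] := pos_cycle t; have [q2 h2] := pos_cycle t.+1.
have h3 : (q + q2 - q1) * Zn k = omega (c t) (c t.+1) - 1 by move: h h1 h2; clear; lia.
have h4 := @small_multiple (q + q2 - q1).
by move: h3 h4 b; clear; lia.
Qed.
End Position.

Local Open Scope Z_scope.

(** The shortest hole is forgotten; what is kept transfers to all other holes: a closed edge
    function and a walk along which it is constantly 1. *)
Lemma winding_exists k c : hole e S k c -> {in S &, forall u v, connect (er S) u v} ->
  exists om, [/\ skew e S om, closed4 e S om &
    exists w : nat -> T, [/\ forall t, w t \in S, forall t, e (w t) (w t.+1) & forall t, om (w t) (w t.+1) = 1]].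
Proof.
move=> hl con; have [k' [c' ti]] := tight_exists hl; have [hl' _ _] := ti.
exists (omega k' c'); split; [exact: omega_skew | exact: omega_closed4 |].
exists c'; have [_ cS _ adj _] := hl'; split=> // t; exact: omega_cycle.
Qed.

(* Push the reference walk w along the hole: a potential on the hole would make
   the height of the pushed walk grow without bound. *)
Lemma hole_winds k c om (G : T -> Z) (w : nat -> T) :
  {in S &, forall u v, connect (er S) u v} -> hole e S k c -> skew e S om -> closed4 e S om ->
  (forall t, w t \in S) -> (forall t, e (w t) (w t.+1)) -> (forall t, om (w t) (w t.+1) = 1) ->
  (forall t, G (c t.+1) = G (c t) + om (c t) (c t.+1)) -> False.
Proof.
move=> con hl sk cl wS wadj om1 Gc.
have [_ cS per adj _] := hl; have k10 := hole_ge10 esym sf hl.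
have [i0 ei0] := dominating esym sf hl con (wS 0%N).
(* The shadow of the walk on the hole: a hole neighbour [c i] of [w t] from which [w t] is seen
   exactly [t] above the start. *)
have push t : exists i, e (w t) (c i) /\
    G (c i) + om (c i) (w t) = G (c i0) + om (c i0) (w 0%N) + Z.of_nat t.
  elim: t => [|t [i [ei IH]]]; first by exists i0; split=> //; clear; lia.
  have [j jE] : exists j, (i + k = j + 3)%N by exists (i + k - 3)%N; move: k10; clear; lia.
  rewrite -per jE in ei IH.
  have quad a b : e (w t) (c a) -> e (w t.+1) (c b) -> (a.+1 = b \/ b.+1 = a)%N ->
      G (c b) + om (c b) (w t.+1) = G (c a) + om (c a) (w t) + 1.
    move=> ea eb ab.
    have eab : e (c a) (c b) by case: ab => <-; [exact: adj | rewrite esym; exact: adj].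
    have Gb : G (c b) = G (c a) + om (c a) (c b).
      case: ab => h; first by rewrite -h Gc.
      by have := Gc b; rewrite h; have := sk _ _ (cS a) (cS b) eab; clear; lia.
    have c4 := cl _ _ _ _ (cS a) (cS b) (wS t.+1) (wS t) eab.
    have eb' : e (c b) (w t.+1) by rewrite esym.
    have ew : e (w t.+1) (w t) by rewrite esym.
    have {}c4 := c4 eb' ew ea.
    have s1 := sk _ _ (wS t) (wS t.+1) (wadj t); have s2 := sk _ _ (wS t) (cS a) ea.
    by move: Gb c4 s1 s2 (om1 t); clear; lia.
  have two a b : (b = a.+2)%N -> e (w t) (c a) -> e (w t) (c b) ->
      G (c b) + om (c b) (w t) = G (c a) + om (c a) (w t).
    move=> -> ea eb; have s2 := sk _ _ (wS t) (cS a) ea.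
    have eb' : e (c a.+2) (w t) by rewrite esym.
    have c4 := cl _ _ _ _ (cS a) (cS a.+1) (cS a.+2) (wS t) (adj a) (adj a.+1) eb' ea.
    by move: (Gc a) (Gc a.+1) s2 c4; clear; lia.
  case: (slide esym sf hl (wS t) (wS t.+1) ei (wadj t)) => [h|h|[h1 h2]|[h1 h2]].
  - exists (j + 2)%N; split=> //; rewrite (quad (j + 3)%N) ?IH //; clear; lia.
  - exists (j + 4)%N; split=> //; rewrite (quad (j + 3)%N) ?IH //; clear; lia.
  - exists (j + 6)%N; split=> //; rewrite (quad (j + 5)%N) //; last by clear; lia.
    rewrite (two (j + 3)%N) // ?IH; clear; lia.
  - exists j; split=> //; rewrite (quad (j + 1)%N) //; last by clear; lia.
    rewrite -(two (j + 1)%N (j + 3)%N) // ?IH; clear; lia.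
(* Two heights differ by at most [2 B], so time [2 B + 1] is out of reach. *)
pose B := \sum_u \sum_v (Z.to_nat (Z.abs (G u)) + Z.to_nat (Z.abs (om u v)))%N.
have bnd u v : Z.abs (G u + om u v) <= Z.of_nat B.
  have : (Z.to_nat (Z.abs (G u)) + Z.to_nat (Z.abs (om u v)) <= B)%N.
    by rewrite /B (bigD1 u) //= (bigD1 v) //= -addnA leq_addr.
  by clear; lia.
have [i [_ h]] := push (B + B).+1.
by have := bnd (c i) (w (B + B).+1); have := bnd (c i0) (w 0%N); move: h; clear; lia.
Qed.
End Winding.

(** * Minimal deletion sets of a component *)

Section Ring.
Variables (n : nat) (e : rel 'I_n).
Hypotheses (esym : symmetric e) (eirr : irreflexive e).
Local Notation T := 'I_n.
Local Notation er := (er e).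
Local Notation nonnb := (nonnb e).
Local Notation component := (component e).

Definition cand (S : {set T}) c u v w x :=
  [set q in S | [&& q != c, ~~ e c q & (e u q && e v q) || (e w q && e x q)]].

Lemma nhPn (S : {set T}) : ~~ nh e S -> exists a b c d, hole4 e S a b c d.
Proof.
case/forallPn=> a /forallPn[b] /forallPn[c] /forallPn[d]; rewrite negbK => h.
by exists a, b, c, d.
Qed.

Lemma hole_neq0 (S : {set T}) k c t : hole e S k c -> 0 < t < k -> c t != c 0.
Proof.
case=> k4 cS per adj nadj /andP[t0 tk]; apply/negP=> /eqP ct.
have [t1|t1] := eqVneq t 1; first by have := adj 0; rewrite -t1 ct eirr.
have ck : c k = c 0 by have := per 0.
have [tk1|tk1] := eqVneq t.+1 k; first by have := adj t; rewrite tk1 ck ct eirr.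
have [tk2|tk2] := eqVneq t.+2 k; last first.
  have : ~~ e (c 0) (c t.+1) by apply: nadj; move: t0 tk t1 tk1 tk2; clear; lia.
  by rewrite -ct adj.
have : ~~ e (c 0) (c t.-1) by apply: nadj; move: t0 t1 tk2 k4; clear; lia.
by have := adj t.-1; rewrite prednK // ct esym => ->.
Qed.

Lemma skewS (X S : {set T}) om : X \subset S -> skew e S om -> skew e X om.
Proof. by move=> /subsetP sub sk u v uX vX; apply: sk; apply: sub. Qed.

Lemma closed4S (X S : {set T}) om : X \subset S -> closed4 e S om -> closed4 e X om.
Proof. by move=> /subsetP sub cl u v w z uX vX wX zX; apply: cl; apply: sub. Qed.

(** * Common neighbours across an independent set *)

Section Nested.
Variables (K : {set T}) (p1 p2 : T -> nat).
Hypotheses (i1 : {in K &, injective p1}) (i2 : {in K &, injective p2}).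
Hypothesis H : forall x y, x \in K -> y \in K -> x != y ->
      (e x y <-> (p1 x < p1 y) != (p2 x < p2 y)).
Variables A B W : {set T}.
Hypotheses (AK : A \subset K) (BK : B \subset K) (WK : W \subset K).
Hypothesis AB : {in A & B, forall a b, lt p1 p2 a b}.
Hypothesis indep : {in W &, forall y z, ~~ e y z}.
Hypothesis touch : {in W, forall y, (exists2 a, a \in A & e a y) /\ (exists2 b, b \in B & e b y)}.

(** An independent [W] is linearly ordered by [lt]. A neighbour in [A] of its rightmost vertex and a
    neighbour in [B] of its leftmost vertex reach across all of [W]. *)
Lemma nested_common y0 : y0 \in W -> exists a b, [/\ a \in A, b \in B & {in W, forall y, e a y && e b y}].
Proof.
move=> y0W; have tot := lt_total i1 i2 H; have nadj := lt_nadj H.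
have inK (X : {set T}) x : X \subset K -> x \in X -> x \in K by move/subsetP; apply.
case: (arg_maxnP p1 y0W) => ym ymW' ymax; have ymW : ym \in W := ymW'.
case: (arg_minnP p1 y0W) => yn ynW' ymin; have ynW : yn \in W := ynW'.
have [[a aA ea] _] := touch ymW; have [_ [b bB eb]] := touch ynW.
have aK := inK _ _ AK aA; have bK := inK _ _ BK bB.
have ymK := inK _ _ WK ymW; have ynK := inK _ _ WK ynW.
exists a, b; split=> // y yW; have yK := inK _ _ WK yW.
have [[a' a'A ea'] [b' b'B eb']] := touch yW.
have a'K := inK _ _ AK a'A; have b'K := inK _ _ BK b'B.
apply/andP; split.
  have [->//|yym] := eqVneq y ym.
  have l1 : lt p1 p2 y ym.
    case/orP: (tot _ _ yK ymK yym (indep yW ymW)) => // /andP[+ _].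
    by have := ymax y yW; rewrite /geq /=; clear; lia.
  apply: contraT => na; have ay : a != y by apply: contraNneq (indep yW ymW) => <-.
  case/orP: (tot _ _ aK yK ay na) => l2.
    by have := nadj _ _ aK ymK (lt_trans l2 l1); rewrite ea.
  by have := nadj _ _ yK b'K (lt_trans l2 (AB aA b'B)); rewrite esym eb'.
have [->//|yyn] := eqVneq y yn.
have l1 : lt p1 p2 yn y.
  case/orP: (tot _ _ yK ynK yyn (indep yW ynW)) => // /andP[+ _].
  by have := ymin y yW; clear; lia.
apply: contraT => nb; have by' : b != y by apply: contraNneq (indep yW ynW) => <-.
case/orP: (tot _ _ bK yK by' nb) => l2.
  by have := nadj _ _ a'K yK (lt_trans (AB a'A bB) l2); rewrite ea'.
by have := nadj _ _ ynK bK (lt_trans l1 l2); rewrite esym eb.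
Qed.
End Nested.

(** * Shape of an inclusion-minimal deletion set *)

Section Minimal.
Variables (S Y : {set T}).
Hypotheses (sf : small_free e S) (con : {in S &, forall u v, connect (er S) u v}).
Hypotheses (YS : Y \subset S) (bipR : bip_perm_on e (S :\: Y)).
Hypothesis minY : {in Y, forall y, ~ bip_perm_on e (S :\: (Y :\ y))}.
Let R := S :\: Y.
Let RS : R \subset S. Proof. exact: subsetDl. Qed.

(** A witness that [y] cannot be restored: a hole on which [y] is the only vertex of [Y]. *)
Definition hole_at k c y := [/\ hole e S k c, c 0 = y & forall i, 0 < i < k -> c i \in R].

Lemma hole_at_exists y : y \in Y -> exists k c, hole_at k c y.
Proof.
move=> yY; have sub : S :\: (Y :\ y) \subset S by apply: subsetDl.
have : ~~ nh e (S :\: (Y :\ y)).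
  by apply/negP=> h; apply: (minY yY); apply: hole_free_bip_perm => //; apply: small_freeS sf.
case/nhPn=> a [b [c' [d]]] /(hole4_hole esym)[k [c hl]].
have [k4 cX per adj nadj] := hl.
have cRy i : (c i \in R) || (c i == y).
  by have := cX i; rewrite !inE negb_and negbK => /andP[/orP[->|->] ->]; rewrite ?orbT.
case: (pickP (fun i : 'I_k => c i == y)) => [i /eqP ciy|none]; last first.
  exfalso; apply: (@hole_not_bip _ _ esym R k c) => //; apply: (holeS hl) => i.
  have kp : 0 < k by move: k4; clear; lia.
  have := cRy i; have -> : c i = c (i %% k) by apply: (hole_mod hl); rewrite modn_mod.
  by have := none (Ordinal (ltn_pmod i kp)) => /= ->; rewrite orbF.
have hlS : hole e S k c by apply: (holeS hl) => j; apply: (subsetP sub).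
exists k, (fun t => c (i + t)); split; [exact: hole_shift | by rewrite addn0 |].
move=> t tk; have := cRy (i + t); rewrite -ciy.
by have := hole_neq0 (hole_shift i hlS) tk; rewrite /= addn0 => /negbTE ->; rewrite orbF.
Qed.

Lemma hole_at_seg k c y i j : hole_at k c y -> 0 < i < k -> 0 < j < k ->
  connect (er R) (c i) (c j).
Proof.
case=> [[_ _ _ adj _] _ cR].
have H a b : 0 < a -> a + b < k -> connect (er R) (c a) (c (a + b)).
  move=> a0; elim: b => [|b IH] h; first by rewrite addn0.
  apply: connect_trans (IH _) _; first by move: h; clear; lia.
  by rewrite addnS; apply: er_edge (adj _); apply: cR; move: a0 h; clear; lia.
move=> /andP[i0 ik] /andP[j0 jk]; case: (leqP i j) => h.
  by rewrite -(subnKC h); apply: H; rewrite // subnKC.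
rewrite er_csym // -(subnKC (ltnW h)); apply: H; rewrite // subnKC //.
exact: ltnW.
Qed.

(** * Heights of the deleted vertices over the remaining ring *)

Section Base.
Variables (y0 : T) (k : nat) (c : nat -> T) (om : T -> T -> Z) (w : nat -> T) (h : T -> Z).
Hypotheses (y0Y : y0 \in Y) (hc : hole_at k c y0).
Hypotheses (sk : skew e S om) (cl : closed4 e S om).
Hypotheses (wS : forall t, w t \in S) (wadj : forall t, e (w t) (w t.+1)).
Hypothesis om1 : forall t, om (w t) (w t.+1) = 1%Z.
Let R0 := component R (c 5).
Hypothesis hP : {in R0 &, forall u v, e u v -> h v = (h u + om u v)%Z}.

Let hl : hole e S k c. Proof. by case: hc. Qed.
Let c0 : c 0 = y0. Proof. by case: hc. Qed.
Let cR i : 0 < i < k -> c i \in R. Proof. by case: hc => _ _; apply. Qed.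
Let k10 : 9 < k. Proof. exact: (hole_ge10 esym sf hl). Qed.
Let cS i : c i \in S. Proof. by case: hl. Qed.
Let cadj i j : i.+1 = j -> e (c i) (c j). Proof. by move=> <-; case: hl. Qed.
Let cnad a b : a.+2 <= b -> b.+2 <= a + k -> ~~ e (c a) (c b).
Proof. by case: hl => _ _ _ _; apply. Qed.
Let c5R : c 5 \in R. Proof. by apply: cR; move: k10; clear; lia. Qed.
Let R0R v : v \in R0 -> v \in R. Proof. by rewrite inE => /er_in; apply. Qed.
Let R0S v : v \in R0 -> v \in S. Proof. by move/R0R; apply: (subsetP RS). Qed.
Let yS y : y \in Y -> y \in S. Proof. exact: (subsetP YS). Qed.
Let R0e u v : u \in R0 -> v \in R -> e u v -> v \in R0.
Proof. by move=> uR0 vR euv; apply: component_closed (R0R uR0) vR euv. Qed.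

Lemma base_in i : 0 < i < k -> c i \in R0.
Proof. by move=> ik; rewrite inE; apply: hole_at_seg hc _ ik; move: k10; clear; lia. Qed.

(** The hole of [y] dominates [c 5] and [c 6], and [y] cannot be adjacent to both, so another of its
    vertices sees the arc of the base hole. Hence one potential [h] serves all vertices of [Y]. *)
Lemma hole_at_in k' c' y i : y \in Y -> hole_at k' c' y -> 0 < i < k' -> c' i \in R0.
Proof.
move=> yY hc' ik; have [hl' c'0 c'R] := hc'.
have k'10 := hole_ge10 esym sf hl'; have kp : 0 < k' by move: k'10; clear; lia.
have nbr a : 0 < a < k -> e (c a) y \/ exists2 j, 0 < j < k' & e (c a) (c' j).
  move=> ak; have [j ej] := dominating esym sf hl' con (cS a).
  have ej' : e (c a) (c' (j %% k')).
    by rewrite (hole_mod hl' (modn_mod j k')).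
  have [j0|j0] := posnP (j %% k'); first by left; rewrite -c'0 -j0.
  by right; exists (j %% k'); rewrite // j0 ltn_pmod.
have c5k : 0 < 5 < k by move: k10; clear; lia.
have c6k : 0 < 6 < k by move: k10; clear; lia.
have [j jk cj] : exists2 j, 0 < j < k' & c' j \in R0.
  case: (nbr 5 c5k) => [e5|[j jk ej]]; last first.
    by exists j => //; apply: R0e (c'R j jk) ej; apply: base_in.
  case: (nbr 6 c6k) => [e6|[j jk ej]]; last first.
    by exists j => //; apply: R0e (c'R j jk) ej; apply: base_in.
  have := triangle_free sf (cS 5) (cS 6) (yS yY) (cadj erefl) e6.
  by rewrite e5.
move: cj; rewrite !inE => cj; apply: connect_trans cj _.
exact: hole_at_seg hc' jk ik.
Qed.

(** The height of [y] extrapolated from its neighbour [b]; as [y] lies outside [R0], different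
    neighbours may disagree. *)
Definition eta y b := (h b + om b y)%Z.

(** If the two ends agreed, their common value at [y] would extend [h] to a potential on the whole
    hole, against [hole_winds]. *)
Lemma eta_ends k' c' y : y \in Y -> hole_at k' c' y -> eta y (c' 1) <> eta y (c' k'.-1).
Proof.
move=> yY hc' eq; have [hl' c'0 c'R] := hc'.
have k'10 := hole_ge10 esym sf hl'; have kp : 0 < k' by move: k'10; clear; lia.
have [_ c'S per adj _] := hl'.
have inR0 i : 0 < i < k' -> c' i \in R0 by apply: hole_at_in hc'.
have ny v : v \in R0 -> (v == y) = false.
  by move/R0R; rewrite inE => /andP[vY _]; apply: contraNF vY => /eqP->.
apply: (@hole_winds _ _ esym S sf k' c' om (fun v => if v == y then eta y (c' 1) else h v) w) => // t.
have red i : c' i = c' (i %% k') by apply: (hole_mod hl'); rewrite modn_mod.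
have redS : c' t.+1 = c' (t %% k').+1.
  by apply: (hole_mod hl'); rewrite -addn1 -[in RHS]addn1 modnDml.
have et := adj t; rewrite (red t) redS in et *.
move: (t %% k') (ltn_pmod t kp) et => s sk' es.
have k1 : 0 < 1 < k' by move: k'10; clear; lia.
have [s0|s0] := posnP s.
  rewrite s0 c'0 in es *; rewrite eqxx ny ?inR0 //.
  by have := sk (yS yY) (c'S 1) es; rewrite /eta; clear; lia.
have [sk1|sk1] := eqVneq s.+1 k'.
  have ck : c' s.+1 = y by rewrite sk1 -[k']add0n per.
  rewrite ck eqxx ny ?inR0 ?s0 // eq -sk1 //=.
have s1 : c' s \in R0 by apply: inR0; rewrite s0.
have s2 : c' s.+1 \in R0 by apply: inR0; move: sk1 sk'; clear; lia.
by rewrite !ny // (hP s1 s2).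
Qed.

Lemma eta_quad y b b' m : y \in Y -> b \in R0 -> b' \in R0 -> m \in R0 ->
  e y b -> e y b' -> e b m -> e m b' -> eta y b' = eta y b.
Proof.
move=> yY bR b'R mR eb eb' ebm emb.
have h1 := hP bR mR ebm; have h2 := hP mR b'R emb.
have e3 : e b' y by rewrite esym.
have c4 := cl (yS yY) (R0S bR) (R0S mR) (R0S b'R) eb ebm emb e3.
have s1 := sk (yS yY) (R0S bR) eb.
by rewrite /eta; move: h1 h2 c4 s1; clear; lia.
Qed.

(** By [slide] and [eta_quad], a neighbour of [y] in the middle of the arc forces the same height
    from all neighbours of [y] in [R0], against [eta_ends]. The bounds keep [c (j - 3)] to
    [c (j + 3)] between [c 1] and [c (k - 1)]. *)
Lemma localized y j : y \in Y -> 3 < j -> j + 4 <= k -> ~~ e y (c j).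
Proof.
move=> yY j3 jk; apply/negP=> eyj.
have cin i : 0 < i < k -> c i \in R0 := @base_in i.
have [i jE] : exists i, j = i + 3 by exists (j - 3); move: j3; clear; lia.
rewrite jE in j3 jk eyj.
have i0 : 0 < i by move: j3; clear; lia.
have ct t : t <= 6 -> c (i + t) \in R0 by move=> t6; apply: cin; move: i0 jk t6; clear; lia.
have all b : b \in R0 -> e y b -> eta y b = eta y (c (i + 3)).
  move=> bR0 eyb.
  case: (slide esym sf hl (yS yY) (R0S bR0) eyj eyb) => [g|g|[g1 g2]|[g1 g2]].
  - apply: (@eta_quad y (c (i + 3)) b (c (i + 2))) => //; try exact: ct.
      by rewrite esym; apply: cadj; clear; lia.
    by rewrite esym.
  - apply: (@eta_quad y (c (i + 3)) b (c (i + 4))) => //; try exact: ct.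
      by apply: cadj; clear; lia.
    by rewrite esym.
  - rewrite (@eta_quad y (c (i + 5)) b (c (i + 6))) //; try exact: ct; last 2 first.
    + by apply: cadj; clear; lia.
    + by rewrite esym.
    apply: (@eta_quad y (c (i + 3)) (c (i + 5)) (c (i + 4))) => //; try exact: ct.
      by apply: cadj; clear; lia.
    by apply: cadj; clear; lia.
  - rewrite (@eta_quad y (c (i + 1)) b (c i)) //; try exact: ct; last 3 first.
    + by have := ct 0 isT; rewrite addn0.
    + by rewrite esym; apply: cadj; clear; lia.
    + by rewrite esym.
    apply: (@eta_quad y (c (i + 3)) (c (i + 1)) (c (i + 2))) => //; try exact: ct.
      by rewrite esym; apply: cadj; clear; lia.
    by rewrite esym; apply: cadj; clear; lia.
have [k' [c' hc']] := hole_at_exists yY; have [hl' c'0 _] := hc'.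
have k'10 := hole_ge10 esym sf hl'; have [_ _ per adj _] := hl'.
apply: (eta_ends yY hc'); rewrite all ?all //.
- by apply: hole_at_in hc' _ => //; move: k'10; clear; lia.
- rewrite esym; have := adj k'.-1; rewrite prednK; last by move: k'10; clear; lia.
  by have -> : c' k' = y by rewrite -c'0; have := per 0.
- by apply: hole_at_in hc' _ => //; move: k'10; clear; lia.
- by have := adj 0; rewrite c'0.
Qed.
(** The ring is opened at [c 5], which no vertex of [Y] touches. [RL] and [RR] are the two banks of
    the cut [Y] in the opened ring [K]. *)
Let K := nonnb S (c 5).
Let RK := nonnb R (c 5).
Let RL := component RK (c 2).
Let RR := component RK (c 7).

Let RKK : RK \subset K.
Proof. by apply/subsetP=> v; rewrite !inE => /andP[/andP[_ ->] ->]. Qed.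
Let RKR : RK \subset R.
Proof. by apply/subsetP=> v; rewrite inE => /andP[]. Qed.

(** Every hole of [S] has a vertex adjacent to [c 5], so no hole consists of nonneighbours of
    [c 5]. *)
Lemma gap_bip : bip_perm_on e K.
Proof.
have KS : K \subset S by apply/subsetP=> v; rewrite inE => /andP[].
apply: hole_free_bip_perm => //; first exact: small_freeS sf.
apply: contraT => /nhPn[a [b [c' [d /(hole4_hole esym)[k' [f hf]]]]]].
have hfS : hole e S k' f by apply: (holeS hf) => i; apply: (subsetP KS); case: hf.
have [i ei] := dominating esym sf hfS con (cS 5).
by have [_ fK _ _ _] := hf; have := fK i; rewrite inE ei !andbF.
Qed.

Lemma sep_gap y : y \in Y -> y \in K.
Proof.
move=> yY; rewrite inE yS //= esym localized //; last by move: k10; clear; lia.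
rewrite andbT; apply: contraTneq yY => ->.
by move: c5R; rewrite inE => /andP[].
Qed.

Lemma cycle_gap i : 0 < i < k -> (i <= 3) || (7 <= i) -> c i \in RK.
Proof.
move=> ik h37; rewrite inE cR //=; apply/andP; split; last first.
  case/orP: h37 => h37; last by apply: cnad; move: ik h37 k10; clear; lia.
  by rewrite esym; apply: cnad; move: ik h37 k10; clear; lia.
apply/negP=> /eqP ci; case/orP: h37 => h37.
  have : ~~ e (c i) (c 6) by apply: cnad; move: ik h37 k10; clear; lia.
  by rewrite ci cadj.
have : ~~ e (c 4) (c i) by apply: cnad; move: ik h37 k10; clear; lia.
by rewrite ci cadj.
Qed.

Lemma left_in i : 0 < i <= 3 -> c i \in RL.
Proof.
move=> i3; rewrite inE; have c12 a : 0 < a < 3 -> connect (er RK) (c a) (c a.+1).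
  by move=> a3; apply: er_edge; rewrite ?cadj // cycle_gap //; move: a3 k10; clear; lia.
have [->|i1] := eqVneq i 1; first by rewrite er_csym //; apply: c12.
have [->|i2] := eqVneq i 2; first exact: connect0.
have -> : i = 3 by move: i3 i1 i2; clear; lia.
exact: c12.
Qed.

Lemma right_in i : 7 <= i < k -> c i \in RR.
Proof.
move=> /andP[i7 ik]; rewrite inE -(subnKC i7).
have : 7 + (i - 7) < k by rewrite subnKC.
elim: (i - 7) => [|m IH] mk; first by rewrite addn0.
apply: connect_trans (IH _) _; first by move: mk; clear; lia.
by rewrite addnS; apply: er_edge; rewrite ?cadj // cycle_gap //; move: mk; clear; lia.
Qed.

Lemma side_R0 v : v \in RL :|: RR -> v \in R0.
Proof.
have H i : connect (er RK) (c i) v -> 0 < i < k -> v \in R0.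
  move=> cv ik; have := base_in ik; rewrite !inE => h5.
  by apply: connect_trans h5 _; apply: er_mono cv.
by case/setUP; rewrite inE => /H h'; apply: h'; move: k10; clear; lia.
Qed.

(** Since [K] has no hole, its component of [y] carries a potential [hK] defined at [y] too. Along a
    connection in [RK] it differs from [h] by a constant, so both ends give [y] the same height. *)
Lemma eta_side y b b' : y \in Y -> b \in R0 -> b \in RK -> e y b -> e y b' ->
  connect (er RK) b b' -> eta y b' = eta y b.
Proof.
move=> yY bR0 bRK eb eb' cb; have yK := sep_gap yY.
pose Ky := component K y.
have KyK : Ky \subset K := component_sub e yK.
have KS : K \subset S by apply/subsetP=> v; rewrite inE => /andP[].
have KyS := subset_trans KyK KS.
have [hK hKP] : exists hK : T -> Z, {in Ky &, forall u v, e u v -> hK v = (hK u + om u v)%Z}.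
  apply: (@potential _ _ esym eirr Ky om); [| |exact: component_connected | |].
  - exact: small_freeS KyS sf.
  - by apply: bip_nh => //; apply: bipS gap_bip.
  - exact: skewS sk.
  - exact: closed4S cl.
have yKy : y \in Ky by rewrite inE connect0.
have inKy v : v \in RK -> e y v -> v \in Ky.
  by move=> vRK ev; apply: component_closed yKy yK _ ev; apply: (subsetP RKK).
have [_ b'R0 hh] : [/\ b' \in Ky, b' \in R0 & (hK b' - h b' = hK b - h b)%Z].
  apply: (connect_inv (P := fun v => [/\ v \in Ky, v \in R0 & (hK v - h v = hK b - h b)%Z]) _ cb).
    move=> u v /and3P[uRK vRK euv] [uKy uR0 hu].
    have vKy : v \in Ky by apply: component_closed uKy _ _ euv; apply: (subsetP RKK).
    have vR0 : v \in R0 by apply: R0e uR0 _ euv; apply: (subsetP RKR).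
    by split=> //; rewrite (hKP _ _ uKy vKy euv) (hP uR0 vR0 euv); move: hu; clear; lia.
  by split=> //; apply: inKy.
have b'RK : b' \in RK by apply: er_in cb bRK.
have h1 := hKP _ _ yKy (inKy _ bRK eb) eb; have h2 := hKP _ _ yKy (inKy _ b'RK eb') eb'.
have s1 := sk (yS yY) (R0S bR0) eb; have s2 := sk (yS yY) (R0S b'R0) eb'.
by rewrite /eta; move: hh h1 h2 s1 s2; clear; lia.
Qed.

(** Otherwise [eta_side] would equate the heights of [y0] seen from [c 1] and from [c (k - 1)]. *)
Lemma sides_apart : ~ connect (er RK) (c 2) (c 7).
Proof.
move=> c27; apply: (eta_ends y0Y hc).
have i1 : 0 < 1 < k by move: k10; clear; lia.
have ik : 7 <= k.-1 < k by move: k10; clear; lia.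
have e1 : e y0 (c 1) by rewrite -c0 cadj.
have ek : e y0 (c k.-1).
  have [_ _ per _ _] := hl; have ck : c k = y0 by rewrite -c0; have := per 0.
  by rewrite esym -ck; apply: cadj; move: k10; clear; lia.
symmetry; apply: (eta_side y0Y _ _ e1 ek); [exact: base_in | exact: cycle_gap |].
have := left_in (i := 1) isT; have := right_in ik; rewrite !inE => h7 h1.
apply: connect_trans (connect_trans c27 h7); by rewrite er_csym.
Qed.

Lemma near_side b t : b \in R0 -> ~~ e b (c 5) -> e b (c t) -> 0 < t < k ->
  (t <= 3) || (7 <= t) -> b \in RL :|: RR.
Proof.
move=> bR0 nb5 ebt tk t37; have ct := cycle_gap tk t37.
have bRK : b \in RK.
  rewrite inE R0R //= esym nb5 andbT; apply/negP=> /eqP bc.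
  by move: ct; rewrite inE -bc ebt !andbF.
have ctb : e (c t) b by rewrite esym.
rewrite inE; case/orP: t37 => t37; apply/orP; [left|right].
  by apply: component_closed ct bRK ctb; apply: left_in; move: tk t37; clear; lia.
by apply: component_closed ct bRK ctb; apply: right_in; move: tk t37; clear; lia.
Qed.

(** This covers a vertex whose known hole neighbour is [c 0], that is [y0], which does not belong to
    [R]. A second vertex [b2] of [R] next to [b] leads by [slide] to the arc. *)
Lemma root_side b : b \in R0 -> e b (c k) -> b \in RL :|: RR.
Proof.
move=> bR0 ebk; have bS := R0S bR0; have [_ _ per _ _] := hl.
have eb0 : e b (c 0) by have := per 0; rewrite add0n => <-.
have nb5 : ~~ e b (c 5) by apply: (cyc_far esym sf hl bS eb0); move: k10; clear; lia.
have nb m : (m == 2) || (m == 8) -> e b (c m) -> b \in RL :|: RR.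
  by case/orP=> /eqP-> em; apply: (near_side bR0 nb5 em); move: k10; clear; lia.
have nk2 : e b (c (k - 2)) -> b \in RL :|: RR.
  by move=> em; apply: (near_side bR0 nb5 em); move: k10; clear; lia.
have nb4 : e b (c 4) -> b \in RL :|: RR.
  by move=> e4; apply: (nb 2) => //; apply: (cyc_4 esym sf hl bS eb0).
(* For [k] equal to 10, [c 6] is four steps before [c 10], too close for [cyc_far]; then [c 8] is a
   neighbour as well. *)
have nb6 : e b (c 6) -> b \in RL :|: RR.
  move=> e6; have [kE|kE] := eqVneq k 10.
    have e10 : e b (c (6 + 4)) by move: ebk; rewrite kE.
    by apply: (nb 8) => //; apply: (cyc_4 esym sf hl bS e6 e10).
  have : ~~ e b (c 6) by apply: (cyc_far esym sf hl bS eb0); move: k10 kE; clear; lia.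
  by rewrite e6.
have b5 : b != c 5 by apply: contraNneq (cnad (a := 0) (b := 5) isT _) => [<-|]; [rewrite esym | move: k10; clear; lia].
have [b2 /and3P[bR b2R eb2]] : exists b2, er R b b2.
  by apply: connect_first b5; rewrite er_csym //; move: bR0; rewrite inE.
have b2R0 : b2 \in R0 by apply: R0e eb2.
have ebk' : e b (c (k - 3 + 3)) by rewrite subnK //; move: k10; clear; lia.
have side2 t : 0 < t < k -> (t <= 3) || (7 <= t) -> e b2 (c t) -> b \in RL :|: RR.
  move=> tk t37 e2; case: (boolP (e b2 (c 5))) => e25; last first.
    have b2LR := near_side b2R0 e25 e2 tk t37.
    have bRK : b \in RK by rewrite inE R0R //= esym nb5 andbT.
    have eb2' : e b2 b by rewrite esym.
    have b2RK : b2 \in RK.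
      have cRKt i : connect (er RK) (c i) b2 -> 0 < i < k -> (i <= 3) || (7 <= i) -> b2 \in RK.
        by move=> /er_in cb ik i37; apply: cb; apply: cycle_gap.
      by case/setUP: b2LR; rewrite inE => /cRKt h'; apply: h' => //; move: k10; clear; lia.
    by move: b2LR; rewrite !in_setU => /orP[] h2; apply/orP; [left|right]; apply: component_closed h2 b2RK bRK eb2'.
  have e25' : e b2 (c (2 + 3)) by [].
  have eb2' : e b2 b by rewrite esym.
  case: (slide esym sf hl (R0S b2R0) bS e25' eb2') => [|| [_]|[_]]; [exact: nb4|exact: nb6| |].
    exact: nb.
  exact: nb.
case: (slide esym sf hl bS (R0S b2R0) ebk' eb2) => [g|g|[g _]|[g _]].
- by apply: side2 g; move: k10; clear; lia.
- have kE : k - 3 + 4 = 1 + k by move: k10; clear; lia.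
  by rewrite kE per in g; apply: side2 g; move: k10; clear; lia.
- have kE : k - 3 + 5 = 2 + k by move: k10; clear; lia.
  by rewrite kE per in g; apply: (nb 2).
- have kE : k - 3 + 1 = k - 2 by move: k10; clear; lia.
  by rewrite kE in g; apply: nk2.
Qed.

(** A neighbour of [y] that hangs on [c 4], [c 5] or [c 6] may lie outside both banks. As [y] misses
    these three vertices, [slide] then gives [y] a neighbour on the arc in a bank, and [eta_quad]
    keeps the height. *)
Lemma to_side y b : y \in Y -> b \in R0 -> e y b ->
  exists2 b', b' \in RL :|: RR & e y b' /\ eta y b' = eta y b.
Proof.
move=> yY bR0 eyb; have bS := R0S bR0; have [_ _ per _ _] := hl.
have eby : e b y by rewrite esym.
have n4 : ~~ e y (c 4) by apply: localized => //; move: k10; clear; lia.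
have n5 : ~~ e y (c 5) by apply: localized => //; move: k10; clear; lia.
have n6 : ~~ e y (c 6) by apply: localized => //; move: k10; clear; lia.
have onL i : 0 < i <= 3 -> c i \in RL :|: RR by move=> /left_in ci; rewrite inE ci.
have onR i : 7 <= i < k -> c i \in RL :|: RR by move=> /right_in ci; rewrite inE ci orbT.
have via i j : 0 < i < k -> 0 < j < k -> c j \in RL :|: RR -> (i.+1 = j \/ j.+1 = i) ->
    e b (c i) -> e y (c j) ->
    exists2 b', b' \in RL :|: RR & e y b' /\ eta y b' = eta y b.
  move=> ik jk cj ij ebi eyj; exists (c j) => //; split=> //.
  apply: (eta_quad yY bR0 (base_in jk) (base_in ik) eyb eyj ebi).
  by case: ij => ij; [|rewrite esym]; apply: cadj.
have at5 : e b (c 5) -> exists2 b', b' \in RL :|: RR & e y b' /\ eta y b' = eta y b.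
  move=> eb5; have eb5' : e b (c (2 + 3)) by [].
  case: (slide esym sf hl bS (yS yY) eb5' eby) => [|| [g1 g2]|[g1 g2]]; rewrite /= ?(negbTE n4) ?(negbTE n6) //.
    by apply: (via 7 8) => //; rewrite ?onR //; move: k10; clear; lia.
  by apply: (via 3 2) => //; rewrite ?onL //; move: k10; clear; lia.
case: (boolP (e b (c 5))) => [/at5//|nb5].
have [i ebi] := dominating esym sf hl con bS.
have kp : 0 < k by move: k10; clear; lia.
have {}ebi : e b (c (i %% k)) by rewrite (hole_mod hl (modn_mod i k)).
move: (i %% k) (ltn_pmod i kp) ebi => {}i ik ebi.
have same : b \in RL :|: RR -> exists2 b', b' \in RL :|: RR & e y b' /\ eta y b' = eta y b by exists b.
have [i0|i0] := posnP i.
  by apply: same; apply: root_side => //; rewrite -[k]add0n per -i0.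
have ik' : 0 < i < k by rewrite i0.
have [i37|] := boolP ((i <= 3) || (7 <= i)); first by apply: same; apply: near_side nb5 ebi ik' i37.
rewrite negb_or -!ltnNge ltnS => /andP[i4 i6].
have [iE|i4'] := eqVneq i 4.
  have eb4 : e b (c (1 + 3)) by rewrite -[1 + 3]/4 -iE.
  case: (slide esym sf hl bS (yS yY) eb4 eby) => [g|g|[g1 g2]|[g1 g2]].
  - by apply: (via 4 3) => //; rewrite ?onL //; try (right; done); move: k10; clear; lia.
  - by rewrite (negbTE n5 : e y (c (1 + 4)) = false) in g.
  - by apply: (via 6 7) => //; rewrite ?onR //; try (left; done); move: k10; clear; lia.
  - by apply: (via 2 1) => //; rewrite ?onL //; try (right; done); move: k10; clear; lia.
have [iE|i5'] := eqVneq i 5; first by rewrite iE (negbTE nb5) in ebi.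
have iE : i = 6 by move: i4 i6 i4' i5'; clear; lia.
have eb6 : e b (c (3 + 3)) by rewrite -[3 + 3]/6 -iE.
case: (slide esym sf hl bS (yS yY) eb6 eby) => [g|g|[g1 g2]|[g1 g2]].
- by rewrite (negbTE n5 : e y (c (3 + 2)) = false) in g.
- by apply: (via 6 7) => //; rewrite ?onR //; try (left; done); move: k10; clear; lia.
- by apply: (via 8 9) => //; rewrite ?onR //; try (left; done); move: k10; clear; lia.
- by apply: (via 4 3) => //; rewrite ?onL //; try (right; done); move: k10; clear; lia.
Qed.

Lemma side_gap v : v \in RL :|: RR -> v \in RK.
Proof.
have H i : connect (er RK) (c i) v -> 0 < i < k -> (i <= 3) || (7 <= i) -> v \in RK.
  by move=> /er_in cb ik i37; apply: cb; apply: cycle_gap.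
by case/setUP; rewrite inE => /H h'; apply: h' => //; move: k10; clear; lia.
Qed.

(** The two ends of the hole of [y] give different heights; once moved to the banks, they cannot be
    on the same one by [eta_side]. *)
Lemma both_sides y : y \in Y -> (exists2 b, b \in RL & e b y) /\ (exists2 b, b \in RR & e b y).
Proof.
move=> yY; have [k' [c' hc']] := hole_at_exists yY; have [hl' c'0 _] := hc'.
have k'10 := hole_ge10 esym sf hl'; have [_ _ per adj _] := hl'.
have e1 : e y (c' 1) by rewrite -c'0 adj.
have ek : e y (c' k'.-1).
  have ck : c' k' = y by rewrite -c'0; have := per 0.
  by rewrite esym -ck -[k' in e _ (c' k')](@prednK k') ?adj //; move: k'10; clear; lia.
have r1 : c' 1 \in R0 by apply: hole_at_in hc' _ => //; move: k'10; clear; lia.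
have rk : c' k'.-1 \in R0 by apply: hole_at_in hc' _ => //; move: k'10; clear; lia.
have [b1 b1s [eb1 h1]] := to_side yY r1 e1; have [b2 b2s [eb2 h2]] := to_side yY rk ek.
have neq : eta y b1 <> eta y b2 by rewrite h1 h2; apply: eta_ends hc'.
have diff a b v : connect (er RK) v a -> connect (er RK) v b -> a \in RL :|: RR ->
    e y a -> e y b -> eta y b = eta y a.
  move=> va vb as' ea eb; apply: (eta_side yY (side_R0 as') (side_gap as') ea eb).
  by apply: connect_trans vb; rewrite er_csym.
have [e1' e2'] : e b1 y /\ e b2 y by rewrite !(esym _ y).
case/setUP: (b1s) => b1X; case/setUP: (b2s) => b2X.
- by case: neq; move: b1X b2X; rewrite !inE => x1 x2; apply: (diff b2 b1 (c 2)).
- by split; [exists b1 | exists b2].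
- by split; [exists b2 | exists b1].
- by case: neq; move: b1X b2X; rewrite !inE => x1 x2; apply: (diff b2 b1 (c 7)).
Qed.

(** In the model of [K] one bank lies entirely left of the other, so [nested_common] covers each
    colour class of [Y] by one pair. Conversely, a vertex of [K] outside [Y] adjacent to both
    members of a pair would join the two banks. *)
Lemma separator_cand : exists q u v z x, Y = cand S q u v z x.
Proof.
have [[col bp] [p1 [p2 [i1 [i2 H]]]]] := gap_bip.
have RLK : RL \subset K.
  by apply/subsetP=> v vL; apply: (subsetP RKK); apply: side_gap; rewrite inE vL.
have RRK : RR \subset K.
  by apply/subsetP=> v vR; apply: (subsetP RKK); apply: side_gap; rewrite inE vR orbT.
have c2L : c 2 \in RL by apply: left_in.
have c7R : c 7 \in RR by apply: right_in; move: k10; clear; lia.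
have apart a b : a \in RL -> b \in RR -> a != b /\ ~~ e a b.
  move=> aL bR; have aK : a \in RK by apply: side_gap; rewrite inE aL.
  have bK : b \in RK by apply: side_gap; rewrite inE bR orbT.
  move: aL bR; rewrite !inE => ca cb; split.
    by apply/negP=> /eqP ab; apply: sides_apart; apply: connect_trans ca _; rewrite ab er_csym.
  apply/negP=> ab; apply: sides_apart; apply: connect_trans ca _.
  by apply: connect_trans (er_edge aK bK ab) _; rewrite er_csym.
have nbL b : b \in RR -> RL \subset nonnb K b.
  move=> bR; apply/subsetP=> a aL; have [ab nab] := apart a b aL bR.
  by rewrite inE (subsetP RLK) // ab esym.
have nbR a : a \in RL -> RR \subset nonnb K a.
  move=> aL; apply/subsetP=> b bR; have [ab nab] := apart a b aL bR.
  by rewrite inE (subsetP RRK) // eq_sym ab.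
have [A [B [ABs AB touch]]] : exists A B, [/\ (A = RL /\ B = RR) \/ (A = RR /\ B = RL),
    {in A & B, forall a b, lt p1 p2 a b} &
    {in Y, forall y, (exists2 a, a \in A & e a y) /\ (exists2 b, b \in B & e b y)}].
  have [n27 ne27] := apart _ _ c2L c7R.
  have conL a : a \in RL -> connect (er RL) (c 2) a.
    by move=> aL; apply: component_connected.
  have conR b : b \in RR -> connect (er RR) (c 7) b.
    by move=> bR; apply: component_connected.
  have c2K := subsetP RLK _ c2L; have c7K := subsetP RRK _ c7R.
  have lc := lt_connect esym i1 i2 H.
  case/orP: (lt_total i1 i2 H c2K c7K n27 ne27) => l27.
    exists RL, RR; split; [by left | | by move=> y /both_sides].
    move=> a b aL bR; have [h1 _] := lc _ _ _ _ c7K (nbL _ c7R) (conL _ aL).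
    have [_ h2] := lc _ _ _ _ (subsetP RLK _ aL) (nbR _ aL) (conR _ bR).
    exact: h2 (h1 l27).
  exists RR, RL; split; [by right | | by move=> y /both_sides[]; split].
  move=> b a bR aL; have [_ h1] := lc _ _ _ _ c7K (nbL _ c7R) (conL _ aL).
  have [h2 _] := lc _ _ _ _ (subsetP RLK _ aL) (nbR _ aL) (conR _ bR).
  exact: h2 (h1 l27).
have [AK BK] : A \subset K /\ B \subset K by case: ABs => -[-> ->].
have pairs bb : exists u v, [/\ u \in A, v \in B & {in Y, forall y, col y = bb -> e u y && e v y}].
  pose W := [set y in Y | col y == bb].
  (* An empty colour class still needs a pair. Any pair with one vertex on each bank will do, since
     it captures only vertices of [Y]. *)
  have [W0|/set0Pn[y yW]] := eqVneq W set0.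
    have [[a aA _] [b bB _]] := touch _ y0Y; exists a, b; split=> // y yY cy.
    have yW : y \in W by rewrite inE yY cy eqxx.
    by rewrite W0 inE in yW.
  have WY : W \subset Y by apply/subsetP=> z; rewrite inE => /andP[].
  have WK : W \subset K by apply/subsetP=> z /(subsetP WY)/sep_gap.
  have indep : {in W &, forall y z, ~~ e y z}.
    move=> s t sW tW; apply/negP=> est; have := bp s t _ _ est.
    rewrite !(subsetP WK) // => /(_ isT isT); move: sW tW.
    by rewrite !inE => /andP[_ /eqP->] /andP[_ /eqP->]; rewrite eqxx.
  have touchW : {in W, forall y, (exists2 a, a \in A & e a y) /\ (exists2 b, b \in B & e b y)}.
    by move=> s /(subsetP WY); apply: touch.
  have [a [b [aA bB h']]] := nested_common i1 i2 H AK BK WK AB indep touchW yW.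
  by exists a, b; split=> // s sY cs; apply: h'; rewrite inE sY cs eqxx.
have [u [v [uA vB huv]]] := pairs true; have [z [x [zA xB hzx]]] := pairs false.
exists (c 5), u, v, z, x; apply/setP=> q; rewrite inE; apply/idP/idP=> [qY|].
  have := sep_gap qY; rewrite inE => /and3P[-> -> ->] /=.
  case cq: (col q); first by rewrite huv.
  by rewrite hzx ?orbT.
case/and4P=> qS q5 nq5 adjq; apply: contraT => nqY.
have qRK : q \in RK by rewrite !inE nqY qS q5.
have join a b : a \in A -> b \in B -> e a q -> e b q -> False.
  have joinLR a' b' : a' \in RL -> b' \in RR -> e a' q -> e b' q -> False.
    move=> a'L b'R ea eb; have a'K : a' \in RK by apply: side_gap; rewrite inE a'L.
    have b'K : b' \in RK by apply: side_gap; rewrite inE b'R orbT.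
    move: a'L b'R; rewrite !inE => ca cb; apply: sides_apart; apply: connect_trans ca _.
    apply: connect_trans (er_edge a'K qRK ea) _; rewrite er_csym //; apply: connect_trans cb _.
    exact: er_edge.
  by case: ABs => -[-> ->] aA bB ea eb; [apply: (joinLR a b) | apply: (joinLR b a)].
by case/orP: adjq => /andP[e1 e2]; case: (join _ _ _ _ e1 e2).
Qed.
End Base.

Lemma minimal_separator_cand : Y != set0 -> exists q u v z x, Y = cand S q u v z x.
Proof.
case/set0Pn=> y0 y0Y; have [k [c hc]] := hole_at_exists y0Y; have [hl c0 cR] := hc.
have [om [sk cl [w [wS wadj om1]]]] := winding_exists esym sf hl con.
have k10 := hole_ge10 esym sf hl.
have c5R : c 5 \in R by apply: cR; move: k10; clear; lia.
have sub : component R (c 5) \subset R := component_sub e c5R.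
have subS := subset_trans sub RS.
have [h hP] : exists h : T -> Z, {in component R (c 5) &, forall u v, e u v -> h v = (h u + om u v)%Z}.
  apply: (@potential _ _ esym eirr _ om); [| |exact: component_connected | |].
  - exact: small_freeS subS sf.
  - by apply: bip_nh => //; apply: bipS bipR.
  - exact: skewS sk.
  - exact: closed4S cl.
exact: (separator_cand y0Y hc sk cl wS wadj om1 hP).
Qed.
End Minimal.

(** Shrink [Y] to a minimal deletion set. The empty one is a candidate too: with all parameters
    equal to [r], the neighbours of [r] are both selected and excluded. *)
Theorem cand_exists (S Y : {set T}) : small_free e S -> {in S &, forall u v, connect (er S) u v} ->
  S != set0 -> Y \subset S -> bip_perm_on e (S :\: Y) ->
  exists q u v z x, cand S q u v z x \subset Y /\ bip_perm_on e (S :\: cand S q u v z x).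
Proof.
move=> sf con /set0Pn[r rS].
elim: {Y}#|Y| {-2}Y (leqnn #|Y|) => [|m IH] Y cY YS bp.
  have Y0 : Y = set0 by apply/eqP; rewrite -cards_eq0 -leqn0.
  have c0 : cand S r r r r r = set0.
    by apply/setP=> q; rewrite !inE; case: (e r q); rewrite /= ?andbF.
  by exists r, r, r, r, r; rewrite c0 Y0 subxx -Y0.
have [Y0|Y0] := eqVneq Y set0; first by apply: IH; rewrite // Y0 cards0.
case: (pickP (fun y => (y \in Y) && nh e (S :\: (Y :\ y)))) => [y /andP[yY nhy]|none].
  have [|||q [u [v [z [x [sub bc]]]]]] := IH (Y :\ y).
  - by move: cY; rewrite (cardsD1 y) yY.
  - by apply: subset_trans YS; apply: subD1set.
  - apply: hole_free_bip_perm => //; apply: small_freeS sf; exact: subsetDl.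
  by exists q, u, v, z, x; split=> //; apply: subset_trans sub (subD1set _ _).
have minY : {in Y, forall y, ~ bip_perm_on e (S :\: (Y :\ y))}.
  by move=> y yY /(bip_nh esym) h; have := none y; rewrite yY h.
have [q [u [v [z [x YE]]]]] := minimal_separator_cand sf con YS bp minY Y0.
by exists q, u, v, z, x; rewrite -YE.
Qed.
End Ring.

(** * Structured programs for the RAM *)

Inductive il : Type :=
| ISkip
| IInc of nat
| IDec of nat
| ILd of nat & nat
| ISt of nat & nat
| ISeq of il & il
| IIf of nat & il & il
| IWhile of nat & il.

Fixpoint isize c := match c with
  | ISkip => 0
  | IInc _ | IDec _ | ILd _ _ | ISt _ _ => 1
  | ISeq c1 c2 => isize c1 + isize c2
  | IIf _ c1 c2 => isize c1 + isize c2 + 2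
  | IWhile _ c => isize c + 2 end.

(* Cell 1 is kept at 0, so [Jz 1] is an unconditional jump. *)
Fixpoint code off c : seq instr := match c with
  | ISkip => [::]
  | IInc r => [:: Inc r]
  | IDec r => [:: Dec r]
  | ILd r s => [:: Ld r s]
  | ISt r s => [:: St r s]
  | ISeq c1 c2 => code off c1 ++ code (off + isize c1) c2
  | IIf r c1 c2 => Jz r (off.+1 + isize c1).+1 :: code off.+1 c1 ++
      Jz 1 (off.+1 + isize c1 + isize c2).+1 :: code (off.+1 + isize c1).+1 c2
  | IWhile r c => Jz r (off.+1 + isize c).+1 :: code off.+1 c ++ [:: Jz 1 off] end.

Lemma size_code off c : size (code off c) = isize c.
Proof.
elim: c off => //= [c1 IH1 c2 IH2|r c1 IH1 c2 IH2|r c IH] off.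
- by rewrite size_cat IH1 IH2.
- by rewrite size_cat /= IH1 IH2; lia.
- by rewrite size_cat IH /=; lia.
Qed.

Definition at_ (P : program) off (L : seq instr) := exists pre post, P = pre ++ L ++ post /\ size pre = off.

Lemma at_cat P off L1 L2 : at_ P off (L1 ++ L2) -> at_ P off L1 /\ at_ P (off + size L1) L2.
Proof.
case=> pre [post [-> <-]]; split; first by exists pre, (L2 ++ post); rewrite !catA.
by exists (pre ++ L1), post; rewrite size_cat !catA.
Qed.

Lemma at_cons P off x L : at_ P off (x :: L) -> nth Halt P off = x /\ at_ P off.+1 L.
Proof.
case=> pre [post [-> <-]]; split; first by rewrite nth_cat ltnn subnn.
by exists (rcons pre x), post; rewrite size_rcons cat_rcons.
Qed.

(** Quantifying over every program that contains the code at [off] makes the statement independent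
    of position, hence composable. *)
Definition runs c T (m m' : memory) := forall P off, at_ P off (code off c) ->
  exists2 t, t <= T & run P t (off, m) = (off + isize c, m').

Lemma run_add P a b x : run P (a + b) x = run P b (run P a x).
Proof. by rewrite /run addnC iterD. Qed.

Lemma runs_le c T T' m m' : T <= T' -> runs c T m m' -> runs c T' m m'.
Proof. by move=> TT h P off /h[t tT et]; exists t => //; apply: leq_trans TT. Qed.

Lemma runs_skip m : runs ISkip 0 m m.
Proof. by move=> P off _; exists 0; rewrite // addn0. Qed.

Lemma runs_inc r m : runs (IInc r) 1 m (upd m r (m r).+1).
Proof. by move=> P off /at_cons[h _]; exists 1; rewrite //= h addn1. Qed.

Lemma runs_dec r m : runs (IDec r) 1 m (upd m r (m r).-1).
Proof. by move=> P off /at_cons[h _]; exists 1; rewrite //= h addn1. Qed.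

Lemma runs_ld r s m : runs (ILd r s) 1 m (upd m r (m (m s))).
Proof. by move=> P off /at_cons[h _]; exists 1; rewrite //= h addn1. Qed.

Lemma runs_st r s m : runs (ISt r s) 1 m (upd m (m r) (m s)).
Proof. by move=> P off /at_cons[h _]; exists 1; rewrite //= h addn1. Qed.

Arguments runs_inc : clear implicits.
Arguments runs_dec : clear implicits.
Arguments runs_ld : clear implicits.
Arguments runs_st : clear implicits.

Lemma runs_seq c1 c2 T1 T2 m m1 m2 : runs c1 T1 m m1 -> runs c2 T2 m1 m2 ->
  runs (ISeq c1 c2) (T1 + T2) m m2.
Proof.
move=> h1 h2 P off /= /at_cat[a1 a2]; rewrite size_code in a2.
have [t1 t1T e1] := h1 _ _ a1; have [t2 t2T e2] := h2 _ _ a2.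
by exists (t1 + t2); rewrite ?leq_add // run_add e1 e2 addnA.
Qed.

(** Cell 1 has to be zero after [c1], when the jump over [c2] tests it. *)
Lemma runs_if r c1 c2 T m m' : m r != 0 -> m' 1 = 0 -> runs c1 T m m' ->
  runs (IIf r c1 c2) (T + 2) m m'.
Proof.
move=> mr m1 h P off /= /at_cons[a0 /at_cat[a1 /at_cons[a2 _]]].
rewrite size_code in a2; have [t tT et] := h _ _ a1.
exists (1 + (t + 1)); first by rewrite addnCA addnA addn1 addn1 addn2 !ltnS.
rewrite run_add /= a0 (negbTE mr) run_add et /= a2 m1 /=.
by congr (_, _); lia.
Qed.

Lemma runs_if0 r c1 c2 T m m' : m r = 0 -> runs c2 T m m' -> runs (IIf r c1 c2) (T + 2) m m'.
Proof.
move=> mr h P off /= /at_cons[a0 /at_cat[_ /at_cons[_ a2]]].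
rewrite size_code in a2; have [t tT et] := h _ _ a2.
exists (1 + t); first by lia.
by rewrite run_add /= a0 mr /= et; congr (_, _); lia.
Qed.

Lemma runs_while0 r c m : m r = 0 -> runs (IWhile r c) 1 m m.
Proof.
move=> mr P off /= /at_cons[a0 _]; exists 1; rewrite //= a0 mr /=.
by congr (_, _); lia.
Qed.

Lemma runs_while r c T1 T2 m m1 m2 : m r != 0 -> m1 1 = 0 -> runs c T1 m m1 ->
  runs (IWhile r c) T2 m1 m2 -> runs (IWhile r c) (T1 + T2 + 2) m m2.
Proof.
move=> mr m11 h1 h2 P off a; have [t2 t2T e2] := h2 _ _ a.
move: a => /= /at_cons[a0 /at_cat[a1 /at_cons[a2 _]]]; rewrite size_code in a2.
have [t1 t1T e1] := h1 _ _ a1.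
exists (1 + (t1 + (1 + t2))); first by lia.
by rewrite run_add /= a0 (negbTE mr) run_add e1 run_add /= a2 m11.
Qed.

(** The invariant is indexed by the number of remaining rounds, which yields termination and the
    time bound together. *)
Lemma runs_loop r c T (I : nat -> memory -> Prop) :
  (forall j m, I j.+1 m -> m r != 0 /\ exists m', [/\ runs c T m m', I j m' & m' 1 = 0]) ->
  (forall m, I 0 m -> m r = 0) ->
  forall v m, I v m -> exists2 m', runs (IWhile r c) (v * (T + 2) + 1) m m' & I 0 m'.
Proof.
move=> step stop; elim=> [|v IH] m Im.
  by exists m => //; apply: runs_while0; apply: stop.
have [mr [m1 [h1 Im1 m11]]] := step _ _ Im; have [m2 h2 Im2] := IH _ Im1.
exists m2 => //; apply: runs_le (runs_while mr m11 h1 h2).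
by rewrite mulSn; lia.
Qed.

Lemma upd_same m a v : upd m a v a = v. Proof. by rewrite /upd eqxx. Qed.
Lemma upd_other m a v b : b != a -> upd m a v b = m b. Proof. by rewrite /upd => /negbTE->. Qed.

Ltac memeq := apply: functional_extensionality => ?; rewrite /upd;
  repeat (case: eqP => ?); solve [congruence | lia | subst; lia].

Definition MZero r := IWhile r (IDec r).

Lemma runs_zero r m : r != 1 -> m 1 = 0 -> runs (MZero r) (3 * m r + 1) m (upd m r 0).
Proof.
move=> r1 m1; pose I j m' := m' = upd m r j.
have step j m' : I j.+1 m' -> m' r != 0 /\ exists m'', [/\ runs (IDec r) 1 m' m'', I j m'' & m'' 1 = 0].
  move=> ->; rewrite upd_same; split=> //; exists (upd m r j); split=> //.
    have -> : upd m r j = upd (upd m r j.+1) r (upd m r j.+1 r).-1 by rewrite upd_same; memeq.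
    exact: runs_dec.
  by rewrite /upd eq_sym (negbTE r1).
have stop m' : I 0 m' -> m' r = 0 by move=> ->; rewrite /upd eqxx.
have start : I (m r) m by rewrite /I; memeq.
have [m' h mE] := runs_loop step stop start; rewrite -mE.
by apply: runs_le h; lia.
Qed.

Fixpoint incs r v := if v is v'.+1 then ISeq (IInc r) (incs r v') else ISkip.

Lemma runs_incs r v m : runs (incs r v) v m (upd m r (m r + v)).
Proof.
elim: v m => [|v IH] m /=.
  have -> : upd m r (m r + 0) = m by memeq.
  exact: runs_skip.
have -> : upd m r (m r + v.+1) = upd (upd m r (m r).+1) r (upd m r (m r).+1 r + v).
  by rewrite upd_same; memeq.
exact: runs_seq (runs_inc r m) (IH _).
Qed.

Arguments runs_incs : clear implicits.

Fixpoint decs r v := if v is v'.+1 then ISeq (IDec r) (decs r v') else ISkip.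

Lemma runs_decs r v m : runs (decs r v) v m (upd m r (m r - v)).
Proof.
elim: v m => [|v IH] m /=.
  have -> : upd m r (m r - 0) = m by memeq.
  exact: runs_skip.
have -> : upd m r (m r - v.+1) = upd (upd m r (m r).-1) r (upd m r (m r).-1 r - v).
  by rewrite upd_same; memeq.
exact: runs_seq (runs_dec r m) (IH _).
Qed.

Arguments runs_decs : clear implicits.

Definition MConst r v := ISeq (MZero r) (incs r v).

Lemma runs_const r v m : r != 1 -> m 1 = 0 -> runs (MConst r v) (3 * m r + 1 + v) m (upd m r v).
Proof.
move=> r1 m1; have -> : upd m r v = upd (upd m r 0) r (upd m r 0 r + v).
  by rewrite upd_same; memeq.
exact: runs_seq (runs_zero r1 m1) (runs_incs _ _ _).
Qed.

(** The machine has no direct move: the address [src] is built in [dst] and dereferenced in place,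
    so [src] itself enters the cost. *)
Definition MCopy dst src := ISeq (MConst dst src) (ILd dst dst).

Lemma runs_copy dst src m : dst != 1 -> src != dst -> m 1 = 0 ->
  runs (MCopy dst src) (3 * m dst + src + 2) m (upd m dst (m src)).
Proof.
move=> d1 sd m1; have -> : upd m dst (m src) = upd (upd m dst src) dst (upd m dst src (upd m dst src dst)).
  by rewrite upd_same upd_other //; memeq.
by apply: runs_le (runs_seq (@runs_const dst src m d1 m1) (runs_ld dst dst _)); lia.
Qed.

Definition MAdd dst src cnt := ISeq (MCopy cnt src) (IWhile cnt (ISeq (IInc dst) (IDec cnt))).

Lemma runs_addto dst src cnt m : cnt != 1 -> dst != 1 -> src != cnt -> dst != cnt -> m 1 = 0 ->
  runs (MAdd dst src cnt) (3 * m cnt + src + 3 + 4 * m src) m (upd (upd m cnt 0) dst (m dst + m src)).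
Proof.
move=> c1 d1 sc dc m1.
have h1 := runs_copy c1 sc m1.
pose I j m' := j <= m src /\ m' = upd (upd m cnt j) dst (m dst + (m src - j)).
have step j m' : I j.+1 m' -> m' cnt != 0 /\
    exists m'', [/\ runs (ISeq (IInc dst) (IDec cnt)) 2 m' m'', I j m'' & m'' 1 = 0].
  case=> jm ->.
  have cE : upd (upd m cnt j.+1) dst (m dst + (m src - j.+1)) cnt = j.+1.
    by rewrite /upd eqxx eq_sym (negbTE dc).
  rewrite cE; split=> //.
  exists (upd (upd m cnt j) dst (m dst + (m src - j))); split.
  - set m2 := upd _ _ _ in cE *.
    have -> : upd (upd m cnt j) dst (m dst + (m src - j)) =
       upd (upd m2 dst (m2 dst).+1) cnt (upd m2 dst (m2 dst).+1 cnt).-1.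
      have dE : m2 dst = m dst + (m src - j.+1) by rewrite /m2 /upd eqxx.
      have -> : upd m2 dst (m2 dst).+1 cnt = j.+1 by rewrite /upd eq_sym (negbTE dc).
      by rewrite dE /m2; move: dc => /eqP dc; memeq.
    exact: (runs_seq (T1 := 1) (T2 := 1) (runs_inc _ _) (runs_dec _ _)).
  - by split; [lia|].
  - by rewrite /upd !(eq_sym 1) (negbTE d1) (negbTE c1).
have stop m' : I 0 m' -> m' cnt = 0 by case=> _ ->; rewrite /upd eqxx eq_sym (negbTE dc).
have start : I (m src) (upd m cnt (m src)).
  by split=> //; move: dc => /eqP dc; memeq.
have [m' h [_ mE]] := runs_loop step stop start.
rewrite subn0 in mE; rewrite -mE.
by apply: runs_le (runs_seq h1 h); lia.
Qed.

(** * A loop language and its compilation *)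

(* Loop programs over binary boolean arrays indexed by vertices. A [For] nested
   under d others binds the variable d.+1; variable 0 is the constant 0. *)
Inductive cmd : Type :=
| Skip
| Seq of cmd & cmd
| For of cmd
| IfA of nat & nat & nat & cmd & cmd
| SetA of nat & nat & nat & bool.

Definition arrays := nat -> nat -> nat -> bool.

Definition set_arr (A : arrays) r x y b : arrays :=
  fun r' x' y' => if [&& r' == r, x' == x & y' == y] then b else A r' x' y'.

Fixpoint sem n d c (env : nat -> nat) (A : arrays) : arrays := match c with
  | Skip => A
  | Seq c1 c2 => sem n d c2 env (sem n d c1 env A)
  | For c => foldl (fun A i => sem n d.+1 c (upd env d.+1 i) A) A (iota 0 n)
  | IfA r x y c1 c2 => if A r (env x) (env y) then sem n d c1 env A else sem n d c2 env A
  | SetA r x y b => set_arr A r (env x) (env y) b end.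

Section Compile.
Variables D Rn : nat.

Fixpoint wf d c : bool := match c with
  | Skip => true
  | Seq c1 c2 => wf d c1 && wf d c2
  | For c => (d < D) && wf d.+1 c
  | IfA r x y c1 c2 => [&& r < Rn, x <= d, y <= d, wf d c1 & wf d c2]
  | SetA r x y b => [&& r < Rn, x <= d & y <= d] end.

(* Registers: 0 holds n, 1 is always 0, 2 the first array cell, 3 n * n, 4 an
   address, 5-7 scratch; 8 + 2 d and 9 + 2 d hold the variable and the countdown
   of the loop at depth d. *)
Definition nregs := 8 + 2 * D.
Definition vreg v := if v is d.+1 then 8 + 2 * d else 1.
Definition cells_start n := nregs.+1 + n * n.
Definition cell n r x y := cells_start n + (r * n + x) * n + y.
Definition addr_bound n := cells_start n + Rn * n * n + n + nregs.

Fixpoint addN2 r := if r is r'.+1 then ISeq (MAdd 4 3 5) (addN2 r') else ISkip.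
Definition Maddr r x y := ISeq (MCopy 4 2) (ISeq (addN2 r) (ISeq (MCopy 6 (vreg x))
  (ISeq (IWhile 6 (ISeq (MAdd 4 0 5) (IDec 6))) (MAdd 4 (vreg y) 5)))).

Fixpoint compile d c : il := match c with
  | Skip => ISkip
  | Seq c1 c2 => ISeq (compile d c1) (compile d c2)
  | For c => ISeq (MZero (8 + 2 * d)) (ISeq (MCopy (9 + 2 * d) 0)
      (IWhile (9 + 2 * d) (ISeq (compile d.+1 c) (ISeq (IInc (8 + 2 * d)) (IDec (9 + 2 * d))))))
  | IfA r x y c1 c2 => ISeq (Maddr r x y) (ISeq (ILd 7 4) (IIf 7 (compile d c1) (compile d c2)))
  | SetA r x y b => ISeq (Maddr r x y) (ISeq (MConst 7 b) (ISt 4 7)) end.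

Definition addr_cost n := (Rn + n + 4) * (7 * addr_bound n + nregs + 13).

Fixpoint cost n c := match c with
  | Skip => 0
  | Seq c1 c2 => cost n c1 + cost n c2
  | For c => 6 * addr_bound n + 4 + n * (cost n c + 4)
  | IfA r x y c1 c2 => addr_cost n + 3 + (cost n c1 + cost n c2)
  | SetA r x y b => addr_cost n + 3 * addr_bound n + 3 end.

(** The bound [repB] is there for the running time: clearing a register takes as many rounds as its
    content. *)
Record rep n d (env : nat -> nat) (A : arrays) (m : memory) : Prop := Rep {
  rep0 : m 0 = n; rep1 : m 1 = 0; rep2 : m 2 = cells_start n; rep3 : m 3 = n * n;
  repV : forall j, j < d -> m (8 + 2 * j) = env j.+1 /\ env j.+1 < n;
  repB : forall i, i <= nregs -> m i <= addr_bound n;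
  repA : forall r x y, r < Rn -> x < n -> y < n -> m (cell n r x y) = A r x y }.

Lemma cell_inj n r x y r' x' y' : x < n -> y < n -> x' < n -> y' < n ->
  cell n r x y = cell n r' x' y' -> [&& r == r', x == x' & y == y'].
Proof.
move=> xn yn xn' yn' /eqP; rewrite /cell -!(addnA (cells_start n)) eqn_add2l => /eqP h.
have n0 : 0 < n by lia.
have := congr1 (divn^~ n) h; rewrite /= !divnMDl // !(divn_small (m := y)) // !(divn_small (m := y')) // !addn0 => h1.
have := congr1 (modn^~ n) h; rewrite /= !modnMDl !modn_small // => ->.
have := congr1 (divn^~ n) h1; rewrite /= !divnMDl // !divn_small // !addn0 => ->.
by have := congr1 (modn^~ n) h1; rewrite /= !modnMDl !modn_small // => ->; rewrite !eqxx.
Qed.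

Lemma cell_gt n r x y i : i <= nregs -> (cell n r x y == i) = false.
Proof. by rewrite /cell /cells_start; lia. Qed.

(** The final content of the scratch cell 5 is existential because it stays untouched when [r] is
    0. *)
Lemma runs_addN2 r m B : m 1 = 0 -> m 3 <= B -> m 5 <= B ->
  exists2 v, v <= B & runs (addN2 r) (r * (7 * B + 6)) m (upd (upd m 5 v) 4 (m 4 + r * m 3)).
Proof.
move=> m1 m3 m5.
elim: r m m1 m3 m5 => [|r IH] m m1 m3 m5 /=.
  exists (m 5) => //; have -> : upd (upd m 5 (m 5)) 4 (m 4 + 0 * m 3) = m by memeq.
  exact: runs_skip.
have h1 := @runs_addto 4 3 5 m isT isT isT isT m1.
have [|||v vB h2] := IH (upd (upd m 5 0) 4 (m 4 + m 3)); [by []|by []|by []|].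
exists v => //.
have -> : upd (upd m 5 v) 4 (m 4 + r.+1 * m 3) =
   upd (upd (upd (upd m 5 0) 4 (m 4 + m 3)) 5 v) 4 (m 4 + m 3 + r * m 3).
  by rewrite mulSn addnA; memeq.
by apply: runs_le (runs_seq h1 h2); rewrite mulSn; lia.
Qed.

Lemma runs_mul dst m n X B : dst != 0 -> dst != 1 -> dst != 5 -> dst != 6 ->
  m 1 = 0 -> m 0 = n -> m 6 = X -> m 5 <= B -> n <= B ->
  exists2 v, v <= B & runs (IWhile 6 (ISeq (MAdd dst 0 5) (IDec 6))) (X * (7 * B + 6) + 1) m
    (upd (upd (upd m 5 v) 6 0) dst (m dst + X * n)).
Proof.
move=> d0 d1 d5 d6 m1 m0 m6 m5 nB.
pose I j m' := j <= X /\ exists2 v, v <= B & m' = upd (upd (upd m 5 v) 6 j) dst (m dst + (X - j) * n).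
have step j m' : I j.+1 m' -> m' 6 != 0 /\
    exists m'', [/\ runs (ISeq (MAdd dst 0 5) (IDec 6)) (7 * B + 4) m' m'', I j m'' & m'' 1 = 0].
  case=> jX [v vB mE]; have m'6 : m' 6 = j.+1 by rewrite mE upd_other 1?eq_sym.
  have m'0 : m' 0 = n by rewrite mE upd_other 1?eq_sym.
  have m'5 : m' 5 = v by rewrite mE upd_other 1?eq_sym.
  have m'1 : m' 1 = 0 by rewrite mE upd_other 1?eq_sym.
  have m'd : m' dst = m dst + (X - j.+1) * n by rewrite mE upd_same.
  rewrite m'6; split=> //.
  have g1 := @runs_addto dst 0 5 m' isT d1 isT d5 m'1.
  rewrite m'0 m'5 m'd in g1; set m'' := upd (upd _ _ _) _ _ in g1.
  have m''6 : m'' 6 = j.+1 by rewrite /m'' upd_other 1?eq_sym.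
  have g2 := runs_dec 6 m''; rewrite m''6 in g2.
  exists (upd m'' 6 j); split.
  - by apply: runs_le (runs_seq g1 g2); lia.
  - split; first by lia.
    exists 0 => //; rewrite /m'' mE.
    have -> : (X - j) * n = (X - j.+1) * n + n by rewrite -mulSnr; congr (_ * _); lia.
    by rewrite addnA; move: d6 => /eqP d6; memeq.
  - by rewrite upd_other // /m'' !upd_other // eq_sym.
have stop m' : I 0 m' -> m' 6 = 0 by case=> _ [v _ ->]; rewrite upd_other 1?eq_sym.
have start : I X m.
  split=> //; exists (m 5) => //; rewrite subnn mul0n addn0; memeq.
have [m' h [_ [v vB mE]]] := runs_loop step stop start.
rewrite subn0 in mE; exists v => //; rewrite -mE.
by apply: runs_le h; lia.
Qed.

Lemma runs_addr r x y m B n : m 1 = 0 -> m 0 = n -> r < Rn -> vreg x <= nregs -> vreg y <= nregs ->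
  m (vreg x) <= n -> (forall i, i <= nregs -> m i <= B) ->
  runs (Maddr r x y) ((Rn + n + 4) * (7 * B + nregs + 13)) m
   (upd (upd (upd m 5 0) 6 0) 4 (m 2 + r * m 3 + m (vreg x) * n + m (vreg y))).
Proof.
move=> m1 m0 rR xK yK xn mB.
have vx v : [/\ vreg v != 4, vreg v != 5, vreg v != 6 & vreg v != 7] by case: v => [|v] /=; split; lia.
have [x4 x5 x6 _] := vx x; have [y4 y5 y6 _] := vx y.
have K8 : 8 <= nregs by rewrite /nregs; lia.
have b0 : m 0 <= B by apply: mB.
have b3 : m 3 <= B by apply: mB; lia.
have b4 : m 4 <= B by apply: mB; lia.
have b5 : m 5 <= B by apply: mB; lia.
have b6 : m 6 <= B by apply: mB; lia.
have by' := mB _ yK; have bx := mB _ xK.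
have h1 := @runs_copy 4 2 m isT isT m1.
have [|||v vB h2] := @runs_addN2 r (upd m 4 (m 2)) B; [by []|by []|by []|].
set m2 := upd (upd _ _ _) _ _ in h2; rewrite [upd m 4 _ 4]upd_same [upd m 4 _ 3]upd_other // in m2 h2.
have m2x : m2 (vreg x) = m (vreg x) by rewrite /m2 !upd_other.
have h3 := @runs_copy 6 (vreg x) m2 isT x6 m1.
rewrite m2x in h3; set m3 := upd m2 _ _ in h3.
pose X := m (vreg x); pose a0 := m 2 + r * m 3.
have nB : n <= B by rewrite -m0.
have [v' v'B] := @runs_mul 4 m3 n X B isT isT isT isT m1 m0 erefl vB nB.
have -> : m3 4 = a0 by [].
set m4 := upd (upd (upd _ _ _) _ _) _ _ => h4.
have mE : m4 = upd (upd (upd m 5 v') 6 0) 4 (a0 + X * n) by rewrite /m4 /m3 /m2; memeq.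
have m41 : m4 1 = 0 by rewrite mE.
have m4y : m4 (vreg y) = m (vreg y) by rewrite mE !upd_other.
have m44 : m4 4 = a0 + X * n by rewrite mE.
have m45 : m4 5 = v' by rewrite mE.
have h5 := @runs_addto 4 (vreg y) 5 m4 isT isT y5 isT m41.
rewrite m4y m44 m45 in h5.
have -> : upd (upd (upd m 5 0) 6 0) 4 (a0 + m (vreg x) * n + m (vreg y)) =
   upd (upd m4 5 0) 4 (a0 + X * n + m (vreg y)) by rewrite mE; memeq.
have m26 : m2 6 = m 6 by rewrite /m2.
apply: runs_le (runs_seq h1 (runs_seq h2 (runs_seq h3 (runs_seq h4 h5)))).
rewrite m26 -/X; set U := 7 * B + nregs + 13.
have u1 : r * (7 * B + 6) <= Rn * U by apply: leq_mul; rewrite /U; lia.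
have u2 : X * (7 * B + 6) <= n * U by apply: leq_mul; rewrite /U /X; lia.
have -> : (Rn + n + 4) * U = Rn * U + n * U + 4 * U by rewrite !mulnDl.
rewrite -/X in bx.
have u3 : 3 * m 4 + 2 + 2 <= U by rewrite /U; lia.
have u4 : 3 * m 6 + vreg x + 2 <= U by rewrite /U; lia.
have u5 : 1 + (3 * v' + vreg y + 3 + 4 * m (vreg y)) <= U by rewrite /U; lia.
by move: u1 u2 u3 u4 u5; clear; lia.
Qed.

Lemma rep_regs n d env A m m' : rep n d env A m -> d <= D ->
  (forall i, i < 4 \/ 7 < i -> m' i = m i) -> (forall i, i <= 7 -> m' i <= addr_bound n) ->
  rep n d env A m'.
Proof.
case=> r0 r1 r2 r3 rV rB rA dD same bnd; split; rewrite ?same //; try lia.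
- by move=> j jd; rewrite same; [apply: rV | lia].
- by move=> i iK; have [i7|i7] := leqP i 7; [apply: bnd | rewrite same; [apply: rB | right]].
- by move=> r x y rR xn yn; rewrite same ?rA //; right; rewrite /cell /cells_start /nregs; lia.
Qed.

Lemma rep_var n d env A m v : 0 < n -> env 0 = 0 -> rep n d env A m -> v <= d -> d <= D ->
  [/\ m (vreg v) = env v, env v < n & vreg v <= nregs].
Proof.
move=> n0 e0 rp; case: v => [|j] vd dD; first by rewrite e0 /= (rep1 rp).
by have [] := repV rp vd; split=> //=; rewrite /nregs; lia.
Qed.

Lemma rep_addr n d env A m r x y : 0 < n -> env 0 = 0 -> rep n d env A m ->
  r < Rn -> x <= d -> y <= d -> d <= D ->
  exists m', [/\ runs (Maddr r x y) (addr_cost n) m m', rep n d env A m',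
    m' 4 = cell n r (env x) (env y) & forall i, 7 < i -> m' i = m i].
Proof.
move=> n0 e0 rp rR xd yd dD.
have [mx xn xK] := rep_var n0 e0 rp xd dD; have [my yn yK] := rep_var n0 e0 rp yd dD.
have mxn : m (vreg x) <= n by rewrite mx ltnW.
have h := runs_addr (rep1 rp) (rep0 rp) rR xK yK mxn (repB rp).
rewrite mx my (rep2 rp) (rep3 rp) in h; set m' := upd _ _ _ in h.
have m'4 : m' 4 = cell n r (env x) (env y).
  by rewrite /m' upd_same /cell mulnDl !addnA mulnA.
exists m'; split=> //.
- apply: (rep_regs rp dD) => i hi.
    by rewrite /m' !upd_other //; lia.
  have [->|i4] := eqVneq i 4.
    rewrite m'4 /cell /addr_bound; have : (r * n + env x) * n + env y <= Rn * n * n.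
      have -> : Rn * n * n = (Rn * n).-1 * n + n by rewrite -mulSnr prednK // muln_gt0 (leq_ltn_trans _ rR).
      apply: leq_add; last exact: ltnW.
      rewrite leq_mul2r; apply/orP; right.
      have : r * n + env x < Rn * n.
        by apply: leq_trans (_ : r.+1 * n <= _); [rewrite mulSnr ltn_add2l | rewrite leq_mul2r rR orbT].
      by lia.
    by lia.
  rewrite /m' upd_other // /upd; case: eqP => // _; case: eqP => // _.
  by apply: (repB rp); rewrite /nregs; lia.
- by move=> i i7; rewrite /m' !upd_other //; lia.
Qed.

(** The last clause protects the countdowns of the enclosing loops, which [rep] does not
    describe. *)
Theorem compile_correct n c d env A m : 0 < n -> env 0 = 0 -> wf d c -> d <= D ->
  rep n d env A m ->
  exists m', [/\ runs (compile d c) (cost n c) m m', rep n d env (sem n d c env A) m' &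
    forall j, j < d -> m' (9 + 2 * j) = m (9 + 2 * j)].
Proof.
move=> n0.
elim: c d env A m => [|c1 IH1 c2 IH2|c IH|r x y c1 IH1 c2 IH2|r x y b] d env A m e0 /= w dD rp.
- by exists m; split=> //; apply: runs_skip.
- case/andP: w => w1 w2.
  have [m1 [h1 rp1 s1]] := IH1 _ _ _ _ e0 w1 dD rp.
  have [m2 [h2 rp2 s2]] := IH2 _ _ _ _ e0 w2 dD rp1.
  exists m2; split=> //; first exact: runs_seq h1 h2.
  by move=> j jd; rewrite s2 // s1.
- case/andP: w => dD' w.
  have K8 : 9 + 2 * d <= nregs by rewrite /nregs; lia.
  have v1 : 8 + 2 * d != 1 by lia.
  have c1 : 9 + 2 * d != 1 by lia.
  have c0 : 0 != 9 + 2 * d by lia.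
  have h1 := runs_zero v1 (rep1 rp); set m1 := upd _ _ _ in h1.
  have m11 : m1 1 = 0 by rewrite /m1 upd_other ?(rep1 rp) //; lia.
  have h2 := runs_copy c1 c0 m11; set m2 := upd m1 _ _ in h2.
  have bB := repB rp.
  pose I j m' := [/\ j <= n, m' (9 + 2 * d) = j, m' (8 + 2 * d) = n - j,
    rep n d env (foldl (fun A i => sem n d.+1 c (upd env d.+1 i) A) A (iota 0 (n - j))) m' &
    forall i, i < d -> m' (9 + 2 * i) = m (9 + 2 * i)].
  have nB : n <= addr_bound n by rewrite /addr_bound; lia.
  have step j m' : I j.+1 m' -> m' (9 + 2 * d) != 0 /\ exists m'',
     [/\ runs (ISeq (compile d.+1 c) (ISeq (IInc (8 + 2 * d)) (IDec (9 + 2 * d)))) (cost n c + 2) m' m'',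
      I j m'' & m'' 1 = 0].
    case=> jn mc mv rp' s'; rewrite mc; split=> //.
    set A' := foldl _ _ _ in rp'.
    pose env' := upd env d.+1 (n - j.+1).
    have e0' : env' 0 = 0 by rewrite /env' upd_other.
    have rp1 : rep n d.+1 env' A' m'.
      case: rp' => r0 r1 r2 r3 rV rB rA; split=> // i; rewrite ltnS leq_eqVlt => /orP[/eqP->|id].
        by rewrite mv /env' upd_same; split=> //; lia.
      by rewrite /env' upd_other; [apply: rV | lia].
    have [m3 [h3 rp3 s3]] := IH _ _ _ _ e0' w dD' rp1.
    have m3c : m3 (9 + 2 * d) = j.+1 by rewrite s3 ?mc.
    have m3v : m3 (8 + 2 * d) = n - j.+1 by have [-> _] := repV rp3 (ltnSn d); rewrite /env' upd_same.
    have h4 := runs_seq (runs_inc (8 + 2 * d) m3) (runs_dec (9 + 2 * d) _).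
    set m4 := upd (upd m3 _ _) _ _ in h4.
    have m4E i : i != 8 + 2 * d -> i != 9 + 2 * d -> m4 i = m3 i.
      by move=> i1 i2; rewrite /m4 !upd_other.
    have m4c : m4 (9 + 2 * d) = j by rewrite /m4 upd_same upd_other ?m3c //; lia.
    have m4v : m4 (8 + 2 * d) = n - j.
      by rewrite /m4 upd_other ?upd_same ?m3v; lia.
    exists m4; split.
    + by apply: runs_le (runs_seq h3 h4); lia.
    + split=> //; first by lia.
        have -> : iota 0 (n - j) = rcons (iota 0 (n - j.+1)) (n - j.+1).
          have -> : n - j = (n - j.+1).+1 by lia.
          by rewrite -addn1 iotaD /= add0n cats1.
        rewrite foldl_rcons -/A' -/env'.
        case: rp3 => r0 r1 r2 r3 rV rB rA; split; rewrite ?m4E //; try lia.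
        * move=> i id; rewrite m4E; try lia.
          have [|-> lt] := rV i; first by lia.
          by move: lt; rewrite /env' upd_other; last by lia.
        * move=> i iK; have [->|i1] := eqVneq i (8 + 2 * d); first by rewrite m4v; lia.
          have [->|i2] := eqVneq i (9 + 2 * d); first by rewrite m4c; lia.
          by rewrite m4E // rB.
        * move=> r' x' y' rR xn yn; rewrite m4E ?rA //; rewrite cell_gt //; lia.
      by move=> i id; rewrite m4E ?s3 ?s' //; lia.
    + by rewrite m4E ?(rep1 rp3) //; lia.
  have stop m' : I 0 m' -> m' (9 + 2 * d) = 0 by case.
  have m2E i : i != 8 + 2 * d -> i != 9 + 2 * d -> m2 i = m i.
    by move=> i1 i2; rewrite /m2 /m1 !upd_other.
  have start : I n m2.
    rewrite /I subnn /=; split=> //.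
    + by rewrite /m2 upd_same /m1 upd_other ?(rep0 rp) //; lia.
    + by rewrite /m2 upd_other ?/m1 ?upd_same //; lia.
    + case: (rp) => r0 r1 r2 r3 rV rB rA; split; rewrite ?m2E //; try lia.
      * by move=> i id; rewrite m2E; [apply: rV | lia | lia].
      * move=> i iK; have [->|i1] := eqVneq i (8 + 2 * d).
          by rewrite /m2 upd_other ?/m1 ?upd_same //; lia.
        have [->|i2] := eqVneq i (9 + 2 * d); last by rewrite m2E // rB.
        by rewrite /m2 upd_same /m1 upd_other ?r0 //; lia.
      * by move=> r' x' y' rR xn yn; rewrite m2E ?rA //; rewrite cell_gt //; lia.
    + by move=> i id; rewrite m2E //; lia.
  have [m3 h3 [_ _ _ rp3 s3]] := runs_loop step stop start.
  rewrite subn0 in rp3; exists m3; split=> //.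
  apply: runs_le (runs_seq h1 (runs_seq h2 h3)).
  have b1 := bB (8 + 2 * d); have b2 := bB (9 + 2 * d).
  have -> : m1 (9 + 2 * d) = m (9 + 2 * d) by rewrite /m1 upd_other //; lia.
  have -> : cost n c + 2 + 2 = cost n c + 4 by lia.
  by move: (n * (cost n c + 4)) b1 b2 K8 => q; clear; lia.
- case/and5P: w => rR xd yd w1 w2.
  have [m1 [h1 rp1 m14 s1]] := rep_addr n0 e0 rp rR xd yd dD.
  have [_ xn _] := rep_var n0 e0 rp xd dD; have [_ yn _] := rep_var n0 e0 rp yd dD.
  have h2 := runs_ld 7 4 m1; rewrite m14 (repA rp1) // in h2; set m2 := upd _ _ _ in h2.
  have rp2 : rep n d env A m2.
    apply: (rep_regs rp1 dD) => i hi; first by rewrite /m2 upd_other //; lia.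
    rewrite /m2 /upd; case: eqP => _; last by apply: (repB rp1); rewrite /nregs; lia.
    by rewrite /addr_bound; case: (A _ _ _); lia.
  have m27 : m2 7 = A r (env x) (env y) by rewrite /m2 upd_same.
  case hA: (A r (env x) (env y)) in m27 *.
    have [m3 [h3 rp3 s3]] := IH1 _ _ _ _ e0 w1 dD rp2.
    exists m3; split=> //; last first.
      by move=> j jd; rewrite s3 // /m2 upd_other ?s1 //; lia.
    have m27' : m2 7 != 0 by rewrite m27.
    have h4 := @runs_if 7 (compile d c1) (compile d c2) _ _ _ m27' (rep1 rp3) h3.
    by apply: runs_le (runs_seq h1 (runs_seq h2 h4)); lia.
  have [m3 [h3 rp3 s3]] := IH2 _ _ _ _ e0 w2 dD rp2.
  exists m3; split=> //; last first.
    by move=> j jd; rewrite s3 // /m2 upd_other ?s1 //; lia.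
  have h4 := @runs_if0 7 (compile d c1) (compile d c2) _ _ _ m27 h3.
  by apply: runs_le (runs_seq h1 (runs_seq h2 h4)); lia.
- case/and3P: w => rR xd yd.
  have [m1 [h1 rp1 m14 s1]] := rep_addr n0 e0 rp rR xd yd dD.
  have [_ xn _] := rep_var n0 e0 rp xd dD; have [_ yn _] := rep_var n0 e0 rp yd dD.
  have h2 := @runs_const 7 b m1 isT (rep1 rp1); set m2 := upd _ _ _ in h2.
  have h3 := runs_st 4 7 m2.
  have m24 : m2 4 = cell n r (env x) (env y) by rewrite /m2 upd_other.
  rewrite m24 [m2 7]upd_same in h3; set m3 := upd _ _ _ in h3.
  have rp2 : rep n d env A m2.
    apply: (rep_regs rp1 dD) => i hi; first by rewrite /m2 upd_other //; lia.
    rewrite /m2 /upd; case: eqP => _; last by apply: (repB rp1); rewrite /nregs; lia.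
    by rewrite /addr_bound; case: b {h2 m2 h3 m24 m3}; lia.
  have m3E i : i <= nregs -> m3 i = m2 i.
    by move=> iK; rewrite /m3 upd_other // eq_sym cell_gt.
  exists m3; split.
  + apply: runs_le (runs_seq h1 (runs_seq h2 h3)).
    have : m1 7 <= addr_bound n by apply: (repB rp1); rewrite /nregs; lia.
    by case: b {h2 m2 h3 m24 m3 rp2 m3E} => /=; lia.
  + case: rp2 => r0 r1 r2 r3 rV rB rA; split; rewrite ?m3E ?/nregs //; try lia.
    * by move=> j jd; rewrite m3E; [apply: rV | rewrite /nregs; lia].
    * by move=> i iK; rewrite m3E // rB.
    * move=> r' x' y' rR' xn' yn'; rewrite /m3 /set_arr /upd.
      have [|ne] := eqVneq; first by move/(cell_inj xn' yn' xn yn) => ->.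
      rewrite (negbTE (_ : ~~ [&& r' == r, x' == env x & y' == env y])) ?rA //.
      by apply: contra ne => /and3P[/eqP-> /eqP-> /eqP->].
  + by move=> j jd; rewrite m3E ?/nregs; [rewrite /m2 upd_other ?s1 //; lia | lia].
Qed.
End Compile.

(** * Input and output conventions *)

Definition polyb (f : nat -> nat) := exists a k, forall n, f n <= a * n.+1 ^ k.

Lemma polyb_const c : polyb (fun=> c).
Proof. by exists c, 0 => n; rewrite expn0 muln1. Qed.

Lemma polyb_id : polyb id.
Proof. by exists 1, 1 => n; rewrite expn1 mul1n leqnSn. Qed.

Lemma polyb_add f g : polyb f -> polyb g -> polyb (fun n => f n + g n).
Proof.
move=> [a [k fP]] [b [l gP]]; exists (a + b), (k + l) => n.
rewrite mulnDl leq_add //.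
  by apply: leq_trans (fP n) _; rewrite leq_mul2l leq_pexp2l ?orbT // leq_addr.
by apply: leq_trans (gP n) _; rewrite leq_mul2l leq_pexp2l ?orbT // leq_addl.
Qed.

Lemma polyb_mul f g : polyb f -> polyb g -> polyb (fun n => f n * g n).
Proof.
move=> [a [k fP]] [b [l gP]]; exists (a * b), (k + l) => n.
by rewrite expnD mulnACA leq_mul.
Qed.

Ltac polyb_tac := first
  [ assumption
  | match goal with
    | |- polyb (fun n => addn (@?f n) (@?g n)) => apply: (@polyb_add f g); polyb_tac
    | |- polyb (fun n => muln (@?f n) (@?g n)) => apply: (@polyb_mul f g); polyb_tac
    | |- polyb (fun n => n) => exact: polyb_id
    | |- polyb (fun _ => _) => exact: polyb_const
    end ].

(** * Moving the input away from the registers, and the output back *)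

Section Program.
Variables D Rn : nat.
Local Notation K := (nregs D).
Local Notation base := (cells_start D).
Local Notation bound := (addr_bound D Rn).

Lemma polyb_bound : polyb bound.
Proof. by rewrite /addr_bound /cells_start; polyb_tac. Qed.

Lemma polyb_cost c : polyb (fun n => cost D Rn n c).
Proof.
have pb := polyb_bound.
have pa : polyb (addr_cost D Rn) by rewrite /addr_cost; polyb_tac.
by elim: c => [|c1 IH1 c2 IH2|c IH|r x y c1 IH1 c2 IH2|r x y b] /=; polyb_tac.
Qed.

Fixpoint zeros i f := if f is f'.+1 then ISeq (MZero i) (zeros i.+1 f') else ISkip.

Lemma runs_zeros i f m : 1 < i -> m 1 = 0 -> (forall a, i <= a < i + f -> m a <= 1) ->
  runs (zeros i f) (f * 4) m (fun a => if i <= a < i + f then 0 else m a).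
Proof.
elim: f i m => [|f IH] i m i1 m1 mb /=.
  have -> : (fun a => if i <= a < i + 0 then 0 else m a) = m.
    by apply: functional_extensionality => a; case: ifP => //; lia.
  exact: runs_skip.
have i1' : i != 1 by lia.
have h1 := runs_zero i1' m1.
have m1' : upd m i 0 1 = 0 by rewrite upd_other // eq_sym.
have mb' a : i.+1 <= a < i.+1 + f -> upd m i 0 a <= 1.
  by move=> ai; rewrite upd_other; [apply: mb | ]; lia.
have h2 := IH i.+1 (upd m i 0) (ltnW i1) m1' mb'.
have -> : (fun a => if i <= a < i + f.+1 then 0 else m a) =
   (fun a => if i.+1 <= a < i.+1 + f then 0 else upd m i 0 a).
  apply: functional_extensionality => a; rewrite /upd; have [->|ai] := eqVneq a i.
    by rewrite leqnn ltnn /= addnS ltnS leq_addr.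
  by congr (if _ then _ else _); lia.
have mi : m i <= 1 by apply: mb; lia.
by apply: runs_le (runs_seq h1 h2); lia.
Qed.

Definition copyloop s t :=
  IWhile 6 (ISeq (ILd 7 s) (ISeq (ISt t 7) (ISeq (IInc s) (ISeq (IInc t) (IDec 6))))).

(** The source may begin inside the registers, which change during the copy. Those cells are copied
    with unspecified content, hence the condition [K < a0 + j]. *)
Lemma runs_copyloop s t m a0 b0 N B : s \in [:: 4; 5] -> t \in [:: 4; 8] -> s != t ->
  m 1 = 0 -> m s = a0 -> m t = b0 -> m 6 = N -> K < b0 -> a0 + N <= b0 \/ b0 + N <= a0 ->
  (forall i, i <= K -> m i <= B) -> (forall j, j < N -> m (a0 + j) <= B) ->
  a0 + N <= B -> b0 + N <= B ->
  exists m', [/\ runs (copyloop s t) (N * 7 + 1) m m',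
    forall j, j < N -> K < a0 + j -> m' (b0 + j) = m (a0 + j),
    forall a, K < a -> ~~ (b0 <= a < b0 + N) -> m' a = m a,
    forall i, i <= K -> i != s -> i != t -> i != 6 -> i != 7 -> m' i = m i &
    forall i, i <= K -> m' i <= B].
Proof.
move=> s45 t48 st m1 ms mt m6 Kb dis mB aB aN bN.
have K8 : 8 <= K by rewrite /nregs; lia.
have s4 : s = 4 \/ s = 5 by move: s45; rewrite !inE; lia.
have t4 : t = 4 \/ t = 8 by move: t48; rewrite !inE; lia.
pose I j m' := [/\ j <= N, [/\ m' s = a0 + (N - j), m' t = b0 + (N - j) & m' 6 = j],
    (forall q, q < N - j -> K < a0 + q -> m' (b0 + q) = m (a0 + q)),
    (forall a, K < a -> ~~ (b0 <= a < b0 + (N - j)) -> m' a = m a) &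
    (forall i, i <= K -> i != s -> i != t -> i != 6 -> i != 7 -> m' i = m i) /\ (forall i, i <= K -> m' i <= B)].
have step j m' : I j.+1 m' -> m' 6 != 0 /\ exists m'',
   [/\ runs (ISeq (ILd 7 s) (ISeq (ISt t 7) (ISeq (IInc s) (ISeq (IInc t) (IDec 6))))) 5 m' m'',
    I j m'' & m'' 1 = 0].
  case=> jN [ms' mt' m6'] cp oth [reg bnd]; rewrite m6'; split=> //.
  have jN' : N - j = (N - j.+1).+1 by lia.
  move: (N - j.+1) jN' ms' mt' cp oth (leq_subr j.+1 N) => q jN' ms' mt' cp oth qN.
  have g1 := runs_ld 7 s m'; rewrite ms' in g1; set v := m' (a0 + q) in g1; set n1 := upd _ _ _ in g1.
  have g2 := runs_st t 7 n1.
  have n1t : n1 t = b0 + q by rewrite /n1 upd_other ?mt' //; lia.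
  have n17 : n1 7 = v by rewrite /n1 upd_same.
  rewrite n1t n17 in g2; set n2 := upd n1 _ _ in g2.
  have n2s : n2 s = a0 + q by rewrite /n2 /n1 !upd_other ?ms' //; lia.
  have g3 := runs_inc s n2; rewrite n2s in g3; set n3 := upd n2 _ _ in g3.
  have n3t : n3 t = b0 + q by rewrite /n3 upd_other 1?eq_sym // /n2 upd_other //; lia.
  have g4 := runs_inc t n3; rewrite n3t in g4; set n4 := upd n3 _ _ in g4.
  have n46 : n4 6 = j.+1 by rewrite /n4 /n3 /n2 /n1 !upd_other ?m6' //; lia.
  have g5 := runs_dec 6 n4; rewrite n46 in g5; set n5 := upd n4 _ _ in g5.
  have n5E a : a != s -> a != t -> a != 6 -> a != 7 -> a != b0 + q -> n5 a = m' a.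
    by move=> *; rewrite /n5 /n4 /n3 /n2 /n1 !upd_other.
  have n5b : n5 (b0 + q) = v by rewrite /n5 /n4 /n3 !upd_other ?/n2 ?upd_same //; lia.
  have n5s : n5 s = (a0 + q).+1 by rewrite /n5 /n4 !upd_other ?/n3 ?upd_same //; lia.
  have n5t : n5 t = (b0 + q).+1 by rewrite /n5 upd_other ?/n4 ?upd_same //; lia.
  have n56 : n5 6 = j by rewrite /n5 upd_same.
  have n57 : n5 7 = v by rewrite /n5 /n4 /n3 /n2 !upd_other //; lia.
  have vB : v <= B.
    rewrite /v; have [le|gt] := leqP (a0 + q) K; first exact: bnd.
    by rewrite oth //; [apply: aB | ]; lia.
  exists n5; split.
  - exact: runs_le (runs_seq g1 (runs_seq g2 (runs_seq g3 (runs_seq g4 g5)))).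
  - split; first by lia.
    + by rewrite jN' n5s n5t n56 !addnS.
    + move=> p pq Kp; rewrite jN' ltnS leq_eqVlt in pq; case/orP: pq => [/eqP pq|pq].
        by rewrite pq n5b /v oth -?pq //; lia.
      by rewrite n5E ?cp //; lia.
    + move=> a Ka na; rewrite n5E ?oth //; lia.
    + split; first by move=> i iK is' it i6 i7; rewrite n5E ?reg //; lia.
      move=> i iK; have [->|is'] := eqVneq i s; first by rewrite n5s; lia.
      have [->|it] := eqVneq i t; first by rewrite n5t; lia.
      have [->|i6] := eqVneq i 6; first by rewrite n56; lia.
      have [->|i7] := eqVneq i 7; first by rewrite n57.
      by rewrite n5E ?bnd //; lia.
  - by rewrite n5E ?reg ?m1 //; lia.
have stop m' : I 0 m' -> m' 6 = 0 by case=> _ [].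
have start : I N m.
  by split=> //; rewrite ?subnn ?addn0.
have [m' h [_ _ cp oth [reg bnd]]] := runs_loop step stop start.
by rewrite !subn0 in cp oth; exists m'; split.
Qed.

Fixpoint patch (bits : seq bool) := if bits is b :: bs then
  ISeq (MConst 7 b) (ISeq (ISt 4 7) (ISeq (IInc 4) (patch bs))) else ISkip.

Lemma runs_patch bits m a B : m 1 = 0 -> m 4 = a -> K < a -> m 7 <= B -> 0 < B -> 
  exists m', [/\ runs (patch bits) (size bits * (3 * B + 4)) m m',
    forall j, j < size bits -> m' (a + j) = nth false bits j,
    forall c, c != 4 -> c != 7 -> ~~ (a <= c < a + size bits) -> m' c = m c,
    m' 4 = a + size bits & m' 7 <= B].
Proof.
have K8 : 8 <= K by rewrite /nregs; lia.
elim: bits m a => [|b bits IH] m a m1 m4 Ka m7 B0 /=.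
  by exists m; split=> //; [exact: runs_skip | rewrite addn0].
have h1 := @runs_const 7 b m isT m1; set n1 := upd _ _ _ in h1.
have n14 : n1 4 = a by [].
have h2 := runs_st 4 7 n1; rewrite n14 [n1 7]upd_same in h2; set n2 := upd n1 _ _ in h2.
have n24 : n2 4 = a by rewrite /n2 upd_other ?n14 //; lia.
have h3 := runs_inc 4 n2; rewrite n24 in h3; set n3 := upd n2 _ _ in h3.
have n3E c : c != 4 -> c != 7 -> c != a -> n3 c = m c.
  by move=> *; rewrite /n3 /n2 /n1 !upd_other.
have n37 : n3 7 = b by rewrite /n3 /n2 !upd_other ?/n1 ?upd_same //; lia.
have n3a : n3 a = b by rewrite /n3 upd_other ?/n2 ?upd_same //; lia.
have n31 : n3 1 = 0 by rewrite n3E //; lia.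
have n34 : n3 4 = a.+1 by rewrite /n3 upd_same.
have n37B : n3 7 <= B by rewrite n37; apply: leq_trans (leq_b1 b) B0.
have [m' [h4 cp oth m'4 m'7]] := IH n3 a.+1 n31 n34 (ltnW Ka) n37B B0.
have b1 := leq_b1 b.
exists m'; split=> //; last by lia.
- apply: runs_le (runs_seq h1 (runs_seq h2 (runs_seq h3 h4))); rewrite mulSn.
  by move: b1 m7; clear; lia.
- case=> [|j] jb; first by rewrite addn0 oth ?n3a //; lia.
  by rewrite addnS -addSn cp.
- by move=> c c4 c7 ca; rewrite oth ?n3E //; lia.
Qed.

(** The whole input is copied, including the cells already destroyed by the registers, whose bits
    [patch] then restores. The arrays start beyond cell [n * n], where memory is zero, so every
    array but the adjacency is initially false. *)
Definition setup bits :=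
  ISeq (zeros 2 K.-1) (ISeq (MCopy 6 0) (ISeq (IWhile 6 (ISeq (MAdd 3 0 5) (IDec 6)))
  (ISeq (MCopy 2 3) (ISeq (incs 2 K.+1) (ISeq (MCopy 4 2) (ISeq (MConst 5 1) (ISeq (MCopy 6 3)
  (ISeq (copyloop 5 4) (ISeq (MCopy 4 2) (patch bits)))))))))).

Definition setup_cost n := K * 4 + (n * (7 * n + 6) + (3 * n + 20 + K) + 3 * n + K + 10 +
   (n * n * 7 + 1) + (3 * bound n + 4) + K * (3 * bound n + 4)).

Lemma runs_setup bits (m0 : memory) n : 0 < n -> 1 < Rn ->
  m0 0 = n -> m0 1 = 0 -> size bits = K -> (forall j, j < K -> m0 j.+1 = nth false bits j) ->
  (forall a, n * n < a -> m0 a = 0) -> (forall a, 0 < a -> m0 a <= 1) ->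
  exists m', [/\ runs (setup bits) (setup_cost n) m0 m',
    [/\ m' 0 = n, m' 1 = 0, m' 2 = base n & m' 3 = n * n],
    forall i, i <= K -> m' i <= bound n & forall b, m' (base n + b) = m0 b.+1].
Proof.
move=> n0 R1 m00 m01 sb bE far bit.
have K8 : 8 <= K by rewrite /nregs; lia.
have h1 : runs (zeros 2 K.-1) (K.-1 * 4) m0 (fun a => if 2 <= a < 2 + K.-1 then 0 else m0 a).
  by apply: runs_zeros => // a ak; apply: bit; lia.
set m1 := fun a => _ in h1.
have m1z a : 2 <= a <= K -> m1 a = 0 by move=> ak; rewrite /m1 ifT //; lia.
have m1E a : K < a -> m1 a = m0 a by move=> ak; rewrite /m1 ifF //; lia.
have m10 : m1 0 = n by [].
have m11 : m1 1 = 0 by [].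
have h2 := @runs_copy 6 0 m1 isT isT m11; rewrite (m1z 6) ?m10 in h2; last by lia.
set m2 := upd _ _ _ in h2.
have [||v vn h3] := @runs_mul 3 m2 n n n isT isT isT isT m11 m10 erefl.
- by rewrite /m2 upd_other // m1z; lia.
- by [].
have m23 : m2 3 = 0 by rewrite /m2 upd_other // m1z; lia.
rewrite m23 add0n in h3; set m3 := upd (upd (upd _ _ _) _ _) _ _ in h3.
have m31 : m3 1 = 0 by [].
have h4 := @runs_copy 2 3 m3 isT isT m31.
have m32 : m3 2 = 0 by rewrite /m3 !upd_other // m1z; lia.
rewrite m32 [m3 3]upd_same in h4; set m4 := upd _ _ _ in h4.
have h5 := runs_incs 2 K.+1 m4; rewrite [m4 2]upd_same addnC in h5; set m5 := upd _ _ _ in h5.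
have m51 : m5 1 = 0 by [].
have h6 := @runs_copy 4 2 m5 isT isT m51.
have m54 : m5 4 = 0 by rewrite /m5 /m4 /m3 !upd_other // m1z; lia.
rewrite m54 [m5 2]upd_same -/(base n) in h6; set m6 := upd _ _ _ in h6.
have m61 : m6 1 = 0 by [].
have h7 := @runs_const 5 1 m6 isT m61.
have m65 : m6 5 = v by [].
rewrite m65 in h7; set m7 := upd _ _ _ in h7.
have m71 : m7 1 = 0 by [].
have h8 := @runs_copy 6 3 m7 isT isT m71.
have m76 : m7 6 = 0 by [].
have m73 : m7 3 = n * n by [].
rewrite m76 m73 in h8; set m8 := upd _ _ _ in h8.
have m8E a : 6 < a -> m8 a = m1 a.
  by move=> a6; rewrite /m8 /m7 /m6 /m5 /m4 /m3 /m2 !upd_other //; lia.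
have [m80 m81 m82] : [/\ m8 0 = n, m8 1 = 0 & m8 2 = base n] by [].
have [m83 m84 m85 m86] : [/\ m8 3 = n * n, m8 4 = base n, m8 5 = 1 & m8 6 = n * n] by [].
have nn : n <= n * n by rewrite leq_pmulr.
have Rnn : 2 * (n * n) <= Rn * n * n by rewrite -mulnA leq_mul2r R1 orbT.
have bn : n * n + base n <= bound n by rewrite /addr_bound; lia.
have Kb : K < base n by rewrite /cells_start; lia.
have reg8 i : i <= K -> m8 i <= bound n.
  move=> iK; have [i6|] := leqP i 6; last by move=> i7; rewrite m8E // m1z //; lia.
  by case: i iK i6 => [|[|[|[|[|[|[|i]]]]]]] // *; rewrite ?m80 ?m81 ?m82 ?m83 ?m84 ?m85 ?m86; lia.
have src8 j : j < n * n -> m8 (1 + j) <= bound n.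
  move=> jn; have [jK|jK] := leqP (1 + j) K; first exact: reg8.
  by rewrite m8E ?m1E //; [apply: leq_trans (bit _ _) _ | ]; lia.
have dis : 1 + n * n <= base n \/ base n + n * n <= 1 by left; rewrite /cells_start; lia.
have aN : 1 + n * n <= bound n by lia.
have bN : base n + n * n <= bound n by rewrite addnC.
have [m9 [h9 cp oth reg bnd]] := @runs_copyloop 5 4 m8 1 (base n) (n * n) (bound n)
  isT isT isT m81 m85 m84 m86 Kb dis reg8 src8 aN bN.
have m91 : m9 1 = 0 by rewrite reg //; lia.
have m92 : m9 2 = base n by rewrite reg //; lia.
have h10 := @runs_copy 4 2 m9 isT isT m91; rewrite m92 in h10; set m10' := upd _ _ _ in h10.
have m107 : m10' 7 <= bound n by apply: bnd; lia.
have m101 : m10' 1 = 0 := m91.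
have B0 : 0 < bound n by lia.
have [m11' [h11 pt oth' m114 m117]] := @runs_patch bits m10' (base n) (bound n) m101 erefl Kb m107 B0.
have rest c : c <= K -> c != 4 -> c != 7 -> m11' c = m9 c.
  by move=> cK c4 c7; rewrite oth' //; [rewrite /m10' upd_other | lia].
exists m11'; split.
- apply: runs_le (runs_seq h1 (runs_seq h2 (runs_seq h3 (runs_seq h4 (runs_seq h5 (runs_seq h6
    (runs_seq h7 (runs_seq h8 (runs_seq h9 (runs_seq h10 h11)))))))))).
  have m94 : m9 4 <= bound n by apply: bnd; lia.
  by rewrite /setup_cost sb; lia.
- by split; rewrite rest ?reg //; lia.
- move=> i iK; have [->|i4] := eqVneq i 4; first by rewrite m114 sb /addr_bound; lia.
  have [->//|i7] := eqVneq i 7.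
  by rewrite rest // bnd.
- move=> b; have [bK|bK] := ltnP b K; first by rewrite pt ?sb // bE.
  rewrite oth' ?sb; try lia.
  rewrite /m10' upd_other; last by lia.
  have [bn2|bn2] := ltnP b (n * n); first by rewrite cp // m8E ?m1E //; lia.
  rewrite oth ?m8E ?m1E ?far //; lia.
Qed.

(* No register is free before the input bits in cells 2 to K have been saved, so
   they are saved in the program counter. *)
Fixpoint branch f i bits := if f is f'.+1 then
  IIf i (branch f' i.+1 (rcons bits true)) (branch f' i.+1 (rcons bits false)) else setup bits.

Lemma runs_branch (m : memory) T (Q : memory -> Prop) f i bits :
  i + f = K.+1 -> size bits = i.-1 -> 0 < i ->
  (forall a, 0 < a -> m a <= 1) -> (forall j, j < i.-1 -> m j.+1 = nth false bits j) ->
  (forall bits, size bits = K -> (forall j, j < K -> m j.+1 = nth false bits j) ->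
     exists2 m', runs (setup bits) T m m' & m' 1 = 0 /\ Q m') ->
  exists2 m', runs (branch f i bits) (T + 2 * f) m m' & m' 1 = 0 /\ Q m'.
Proof.
move=> fi sb i0 bit bE leaf.
elim: f i bits fi sb i0 bE => [|f IH] i bits fi sb i0 bE /=.
  have [||m' h Qm] := leaf bits; rewrite ?sb; try lia.
    by move=> j jK; apply: bE; lia.
  by exists m' => //; apply: runs_le h; lia.
have next (b : bool) : m i = b -> exists2 m', runs (branch f i.+1 (rcons bits b)) (T + 2 * f) m m' & m' 1 = 0 /\ Q m'.
  move=> mi; apply: IH; rewrite ?size_rcons ?sb; try lia.
  move=> j ji; rewrite nth_rcons sb; case: ltngtP => h; try lia.
    exact: bE.
  have -> : j.+1 = i by lia.
  by rewrite mi.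
have mi := bit i i0.
have [m0|m0] := eqVneq (m i) 0.
  have [m' h [m1 Qm]] := next false m0; exists m' => //.
  have h' := @runs_if0 i (branch f i.+1 (rcons bits true)) _ _ _ _ m0 h.
  by apply: runs_le h'; lia.
have [|m' h [m1 Qm]] := next true; first by move: m0 mi => /=; lia.
exists m' => //.
have h' := @runs_if i _ (branch f i.+1 (rcons bits false)) _ _ _ m0 m1 h.
by apply: runs_le h'; lia.
Qed.

(* The first K output cells are registers; they are written last, using only the
   pointer in cell 0. *)
Fixpoint outs i f := if f is f'.+1 then ISeq (ILd i 0) (ISeq (IInc 0) (outs i.+1 f')) else ISkip.

Lemma runs_outs i f m a : 0 < i -> i + f <= a -> m 0 = a ->
  exists m', [/\ runs (outs i f) (2 * f) m m', forall j, j < f -> m' (i + j) = m (a + j) &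
    forall c, c != 0 -> ~~ (i <= c < i + f) -> m' c = m c].
Proof.
elim: f i m a => [|f IH] i m a i0 ia m0 /=.
  by exists m; split=> //; exact: runs_skip.
have h1 := runs_ld i 0 m; rewrite m0 in h1; set n1 := upd _ _ _ in h1.
have n10 : n1 0 = a by rewrite /n1 upd_other ?m0 //; lia.
have h2 := runs_inc 0 n1; rewrite n10 in h2; set n2 := upd _ _ _ in h2.
have n20 : n2 0 = a.+1 by rewrite /n2 upd_same.
have ia' : i.+1 + f <= a.+1 by lia.
have [m' [h3 cp oth]] := IH i.+1 n2 a.+1 isT ia' n20.
have n2E c : c != 0 -> c != i -> n2 c = m c by move=> *; rewrite /n2 /n1 !upd_other.
exists m'; split.
- by apply: runs_le (runs_seq h1 (runs_seq h2 h3)); lia.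
- case=> [|j] jf.
    by rewrite !addn0 oth; [rewrite /n2 upd_other ?/n1 ?upd_same // |  | ]; lia.
  by rewrite addnS -addSn cp // addSnnS n2E //; lia.
- by move=> c c0 ci; rewrite oth ?n2E //; lia.
Qed.

(** The answer is row 0 of array 1, at [base n + n * n]. Its entries from [K] on are moved above the
    registers while these are still in use; the truncated [n - K] makes this empty for small [n]. *)
Definition finish :=
  ISeq (MCopy 4 2) (ISeq (MAdd 4 3 5) (ISeq (incs 4 K) (ISeq (MCopy 6 0) (ISeq (decs 6 K)
  (ISeq (MConst 8 K.+1) (ISeq (copyloop 4 8) (ISeq (MCopy 4 2) (ISeq (MAdd 4 3 5)
  (ISeq (MCopy 0 4) (outs 1 K)))))))))).

Definition finish_cost n := 30 * bound n + 10 * K + 7 * n + 40.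

Lemma runs_finish n d env A m : 0 < n -> 1 < Rn -> d <= D -> rep D Rn n d env A m ->
  exists2 m', runs finish (finish_cost n) m m' & forall q, q < n -> m' q.+1 = A 1 0 q.
Proof.
move=> n0 R1 dD [r0 r1 r2 r3 _ rB rA].
have K8 : 8 <= K by rewrite /nregs; lia.
have Kb : K < base n by rewrite /cells_start; lia.
have nn : n <= n * n by rewrite leq_pmulr.
have nb : n * n < base n by rewrite /cells_start; lia.
have Rnn : 2 * (n * n) <= Rn * n * n by rewrite -mulnA leq_mul2r R1 orbT.
have bn : base n + 2 * (n * n) + n <= bound n by rewrite /addr_bound; lia.
have cE q : cell D n 1 0 q = base n + n * n + q by rewrite /cell; lia.
have b4 : m 4 <= bound n by apply: rB; lia.
have b5 : m 5 <= bound n by apply: rB; lia.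
have b6 : m 6 <= bound n by apply: rB; lia.
have b8 : m 8 <= bound n by apply: rB; lia.
have h1 := @runs_copy 4 2 m isT isT r1; rewrite r2 in h1; set m1 := upd _ _ _ in h1.
have m11 : m1 1 = 0 := r1.
have h2 := @runs_addto 4 3 5 m1 isT isT isT isT m11.
have m13 : m1 3 = n * n := r3.
have m15 : m1 5 = m 5 by [].
rewrite m13 m15 [m1 4]upd_same in h2; set m2 := upd (upd _ _ _) _ _ in h2.
have h3 := runs_incs 4 K m2; rewrite [m2 4]upd_same in h3; set m3 := upd m2 _ _ in h3.
have m31 : m3 1 = 0 := r1.
have h4 := @runs_copy 6 0 m3 isT isT m31.
have m36 : m3 6 = m 6 by [].
have m30 : m3 0 = n := r0.
rewrite m36 m30 in h4; set m4 := upd m3 _ _ in h4.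
have h5 := runs_decs 6 K m4; rewrite [m4 6]upd_same in h5; set m5 := upd m4 _ _ in h5.
have m51 : m5 1 = 0 := r1.
have h6 := @runs_const 8 K.+1 m5 isT m51.
have m58 : m5 8 = m 8 by [].
rewrite m58 in h6; set m6 := upd m5 _ _ in h6.
have m6E a : 8 < a -> m6 a = m a.
  by move=> a8; rewrite /m6 /m5 /m4 /m3 /m2 /m1 !upd_other //; lia.
have [m60 m61 m62 m63] : [/\ m6 0 = n, m6 1 = 0, m6 2 = base n & m6 3 = n * n].
  by split; rewrite /m6 /m5 /m4 /m3 /m2 /m1 !upd_other.
have [m64 m65 m66 m68] : [/\ m6 4 = base n + n * n + K, m6 5 = 0, m6 6 = n - K & m6 8 = K.+1] by [].
have m67 : m6 7 = m 7 by [].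
have reg6 i : i <= K -> m6 i <= K + bound n.
  move=> iK; have [i8|i8] := leqP i 8; last by rewrite m6E //; apply: leq_trans (rB i iK) _; lia.
  case: i iK i8 => [|[|[|[|[|[|[|[|[|i]]]]]]]]] // iK _;
    rewrite ?m60 ?m61 ?m62 ?m63 ?m64 ?m65 ?m66 ?m67 ?m68; try lia.
  by have := rB 7 iK; lia.
have src j : j < n - K -> m6 (base n + n * n + K + j) <= K + bound n.
  move=> jn; rewrite m6E; last by lia.
  have -> : base n + n * n + K + j = cell D n 1 0 (K + j) by rewrite cE; lia.
  by rewrite rA //; [case: (A _ _ _) | ]; lia.
have dis : base n + n * n + K + (n - K) <= K.+1 \/ K.+1 + (n - K) <= base n + n * n + K by right; lia.
have aN : base n + n * n + K + (n - K) <= K + bound n by lia.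
have bN : K.+1 + (n - K) <= K + bound n by lia.
have [m7 [h7 cp oth reg bnd]] := @runs_copyloop 4 8 m6 (base n + n * n + K) K.+1 (n - K) (K + bound n)
   isT isT isT m61 m64 m68 m66 (ltnSn K) dis reg6 src aN bN.
have [m70 m71 m72 m73] : [/\ m7 0 = n, m7 1 = 0, m7 2 = base n & m7 3 = n * n].
  by split; rewrite reg //; lia.
have m74 : m7 4 <= K + bound n by apply: bnd; lia.
have m75 : m7 5 = 0 by rewrite reg //; lia.
have h8 := @runs_copy 4 2 m7 isT isT m71; rewrite m72 in h8; set m8 := upd _ _ _ in h8.
have m81 : m8 1 = 0 := m71.
have h9 := @runs_addto 4 3 5 m8 isT isT isT isT m81.
have m83 : m8 3 = n * n := m73.
have m85 : m8 5 = 0 := m75.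
rewrite m83 m85 [m8 4]upd_same in h9; set m9 := upd (upd _ _ _) _ _ in h9.
have m91 : m9 1 = 0 := m71.
have h10 := @runs_copy 0 4 m9 isT isT m91.
have m90 : m9 0 = n := m70.
rewrite m90 [m9 4]upd_same in h10; set m10 := upd m9 _ _ in h10.
have Kb' : 1 + K <= base n + n * n by lia.
have [m11' [h11 out keep]] := @runs_outs 1 K m10 (base n + n * n) isT Kb' erefl.
have m10E a : 5 < a -> m10 a = m7 a.
  by move=> a5; rewrite /m10 /m9 /m8 !upd_other //; lia.
exists m11'.
  apply: runs_le (runs_seq h1 (runs_seq h2 (runs_seq h3 (runs_seq h4 (runs_seq h5 (runs_seq h6
    (runs_seq h7 (runs_seq h8 (runs_seq h9 (runs_seq h10 h11)))))))))).
  by rewrite /finish_cost; lia.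
move=> q qn; have [qK|qK] := ltnP q K.
  rewrite -[q.+1]/(1 + q) out // m10E; last by lia.
  by rewrite oth; [rewrite m6E; [rewrite -cE rA | ] | | ]; lia.
rewrite keep; try lia.
rewrite m10E; last by lia.
have -> : q.+1 = K.+1 + (q - K) by lia.
rewrite cp; try lia.
have -> : base n + n * n + K + (q - K) = cell D n 1 0 q by rewrite cE; lia.
by rewrite m6E ?rA // cE; lia.
Qed.

(** The empty graph is dispatched at once, because variable 0 must denote a vertex. Running off the
    end halts, [Halt] being the default of [nth]. *)
Definition guarded body : program := Jz 0 (isize body).+1 :: code 1 body.

Lemma guarded_halted body m : halted (guarded body) ((isize body).+1, m).
Proof. by rewrite /halted /= nth_default // size_code. Qed.

Lemma guarded_zero body m : m 0 = 0 -> run (guarded body) 1 (0, m) = ((isize body).+1, m).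
Proof. by rewrite /run /= => ->. Qed.

Lemma guarded_run body m m' T : m 0 != 0 -> runs body T m m' ->
  exists2 t, t <= T.+1 & run (guarded body) t (0, m) = ((isize body).+1, m').
Proof.
move=> m0 h; have [|t tT et] := h (guarded body) 1.
  by exists [:: Jz 0 (isize body).+1], [::]; rewrite cats0.
exists (1 + t); rewrite ?ltnS // run_add {1}/run /= (negbTE m0); exact: et.
Qed.

Definition initial n (e : rel 'I_n) : arrays := fun r x y => (r == 0) && adjn e x y.

Theorem ram_program c : wf D Rn 0 c -> 1 < Rn ->
  exists (P : program) (a k : nat), forall (n : nat) (e : rel 'I_n), irreflexive e ->
    exists t, [/\ t <= a * n.+1 ^ k, halted P (run P t (init_config e)) &
      output_set n (run P t (init_config e)) =
        [set i : 'I_n | sem n 0 c (fun=> 0) (initial e) 1 0 i]].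
Proof.
move=> wc R1.
pose body := ISeq (branch K.-1 2 [:: false]) (ISeq (compile 0 c) finish).
pose P := guarded body.
pose total n := 1 + (setup_cost n + 2 * K.-1 + (cost D Rn n c + finish_cost n)).
have pt : polyb total.
  have pb := polyb_bound; have pc := polyb_cost c.
  have p1 : polyb setup_cost by rewrite /setup_cost; polyb_tac.
  have p2 : polyb finish_cost by rewrite /finish_cost; polyb_tac.
  by rewrite /total; polyb_tac.
have [a [k tP]] := pt; exists P, a, k => n e eirr.
have K8 : 8 <= K by rewrite /nregs; lia.
case: (posnP n) => [nz|n0].
  have E : run P 1 (init_config e) = ((isize body).+1, (init_config e).2).
    by apply: guarded_zero; exact: nz.
  exists 1; rewrite E; split.
  - by apply: leq_trans (tP n); rewrite /total.
  - exact: guarded_halted.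
  - by apply/setP=> -[i i0]; exfalso; rewrite nz in i0.
set m0 := (init_config e).2.
have m00 : m0 0 = n by [].
have adj0 x : adjn e x x = false by rewrite /adjn; case: insubP => // u _ _; rewrite eirr.
(* Cell 1 holds the adjacency bit of vertex 0 with itself. By irreflexivity it is a zero register
   from the start, and the first saved bit is [false]. *)
have m01 : m0 1 = 0 by rewrite /m0 /= div0n mod0n adj0; case: ifP.
have bit q : 0 < q -> m0 q <= 1.
  by case: q => // q _; rewrite /m0 /=; case: ifP => // _; case: adjn.
have far q : n * n < q -> m0 q = 0.
  by case: q => // q nq; rewrite /m0 /= ifF //; lia.
pose Q m' := rep D Rn n 0 (fun=> 0) (initial e) m'.
have leaf bits : size bits = K -> (forall j, j < K -> m0 j.+1 = nth false bits j) ->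
    exists2 m', runs (setup bits) (setup_cost n) m0 m' & m' 1 = 0 /\ Q m'.
  move=> sb bE.
  have [m1 [h1 [e0 e1 e2 e3] bnd cells]] := runs_setup n0 R1 m00 m01 sb bE far bit.
  exists m1 => //; split=> //; split=> // r x y rR xn yn.
  rewrite /cell -addnA cells /m0 /=; case: r rR => [|r] rR.
    rewrite mul0n add0n /initial /=.
    have lt : x * n + y < n * n by nia.
    by rewrite lt divnMDl // divn_small // addn0 modnMDl modn_small.
  by rewrite ifF //; nia.
have iK : 2 + K.-1 = K.+1 by lia.
have b0 j : j < 1 -> m0 j.+1 = nth false [:: false] j by case: j.
have [m1 h1 [_ rp]] := @runs_branch m0 (setup_cost n) Q K.-1 2 [:: false] iK erefl isT bit b0 leaf.
have [m2 [h2 rp2 _]] := compile_correct n0 erefl wc (leq0n D) rp.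
have [m3 h3 out] := runs_finish n0 R1 (leq0n D) rp2.
have hb := runs_seq h1 (runs_seq h2 h3).
have m0n : m0 0 != 0 by rewrite m00 -lt0n.
have [t tT et] := guarded_run m0n hb.
exists t; rewrite (et : run P t (init_config e) = _); split.
- by apply: leq_trans (tP n); rewrite /total; move: tT; clear; lia.
- exact: guarded_halted.
- by apply/setP=> i; rewrite !inE /= out // eqb0 negbK.
Qed.
End Program.

(** * Boolean expressions and loops *)

Inductive bexp : Type :=
| Cst of bool
| At of nat & nat & nat
| Neg of bexp
| And of bexp & bexp
| Or of bexp & bexp.

Fixpoint beval b (env : nat -> nat) (A : arrays) : bool := match b with
  | Cst t => t
  | At r x y => A r (env x) (env y)
  | Neg b => ~~ beval b env A
  | And b1 b2 => beval b1 env A && beval b2 env A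
  | Or b1 b2 => beval b1 env A || beval b2 env A end.

(** Evaluation by branching stores no truth value; the price is duplicated code, not running
    time. *)
Fixpoint ifb b c1 c2 := match b with
  | Cst t => if t then c1 else c2
  | At r x y => IfA r x y c1 c2
  | Neg b => ifb b c2 c1
  | And b1 b2 => ifb b1 (ifb b2 c1 c2) c2
  | Or b1 b2 => ifb b1 c1 (ifb b2 c1 c2) end.

Fixpoint bwf Rn d b : bool := match b with
  | Cst _ => true
  | At r x y => [&& r < Rn, x <= d & y <= d]
  | Neg b => bwf Rn d b
  | And b1 b2 | Or b1 b2 => bwf Rn d b1 && bwf Rn d b2 end.

Fixpoint reads (r : nat) b : bool := match b with
  | Cst _ => false
  | At r' _ _ => r == r'
  | Neg b => reads r b
  | And b1 b2 | Or b1 b2 => reads r b1 || reads r b2 end.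

Fixpoint writes (r : nat) c : bool := match c with
  | Skip => false
  | Seq c1 c2 | IfA _ _ _ c1 c2 => writes r c1 || writes r c2
  | For c => writes r c
  | SetA r' _ _ _ => r == r' end.

Lemma wf_ifb D Rn d b c1 c2 : bwf Rn d b -> wf D Rn d c1 -> wf D Rn d c2 -> wf D Rn d (ifb b c1 c2).
Proof.
elim: b c1 c2 => [[]|r x y|b IH|b1 IH1 b2 IH2|b1 IH1 b2 IH2] c1 c2 //=.
- by case/and3P=> -> -> -> -> ->.
- by move=> h h1 h2; apply: IH.
- by case/andP=> h1 h2 w1 w2; apply: IH1 => //; apply: IH2.
- by case/andP=> h1 h2 w1 w2; apply: IH1 => //; apply: IH2.
Qed.

Lemma writes_ifb r b c1 c2 : ~~ writes r c1 -> ~~ writes r c2 -> ~~ writes r (ifb b c1 c2).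
Proof.
elim: b c1 c2 => [[]|r' x y|b IH|b1 IH1 b2 IH2|b1 IH1 b2 IH2] c1 c2 //=.
- by rewrite negb_or => -> ->.
- by move=> h1 h2; apply: IH.
- by move=> w1 w2; apply: IH1 => //; apply: IH2.
- by move=> w1 w2; apply: IH1 => //; apply: IH2.
Qed.

Lemma eq_beval b env A A' : (forall r, reads r b -> A' r = A r) -> beval b env A' = beval b env A.
Proof.
elim: b => //= [r x y|b IH|b1 IH1 b2 IH2|b1 IH1 b2 IH2] h.
- by rewrite h.
- by rewrite IH.
- by rewrite IH1 ?IH2 // => r hr; apply: h; rewrite hr ?orbT.
- by rewrite IH1 ?IH2 // => r hr; apply: h; rewrite hr ?orbT.
Qed.

(** The complete decision tree over the tests [L]: any function [F] of their outcomes, however it is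
    defined, becomes a finite expression. *)
Fixpoint btree (L : seq bexp) (F : seq bool -> bool) : bexp := match L with
  | [::] => Cst (F [::])
  | b :: L => Or (And b (btree L (fun s => F (true :: s))))
                 (And (Neg b) (btree L (fun s => F (false :: s)))) end.

Lemma beval_btree L F env A : beval (btree L F) env A = F [seq beval b env A | b <- L].
Proof. by elim: L F => //= b L IH F; rewrite !IH; case: (beval b env A); rewrite ?orbF. Qed.

Lemma bwf_btree Rn d L F : all (bwf Rn d) L -> bwf Rn d (btree L F).
Proof. by elim: L F => //= b L IH F /andP[-> h]; rewrite !IH. Qed.

(** * Reasoning about loops *)

Section Semantics.
Variable n : nat.
Local Notation sem := (sem n).

Lemma sem_ifb d b c1 c2 env A :
  sem d (ifb b c1 c2) env A = if beval b env A then sem d c1 env A else sem d c2 env A.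
Proof.
elim: b c1 c2 => [[]|r x y|b IH|b1 IH1 b2 IH2|b1 IH1 b2 IH2] c1 c2 //=.
- by rewrite IH; case: beval.
- by rewrite IH1; case: (beval b1) => //=; rewrite IH2.
- by rewrite IH1; case: (beval b1) => //=; rewrite IH2.
Qed.

Lemma sem_frame r d c env A : ~~ writes r c -> sem d c env A r = A r.
Proof.
elim: c d env A => [|c1 IH1 c2 IH2|c IH|r' x y c1 IH1 c2 IH2|r' x y b] d env A //=.
- by rewrite negb_or => /andP[w1 w2]; rewrite IH2 // IH1.
- by move=> w; elim: (iota 0 n) A => //= i s IHs A; rewrite IHs IH.
- by rewrite negb_or => /andP[w1 w2]; case: ifP => _; rewrite ?IH1 ?IH2.
- by move=> h; rewrite /set_arr (negbTE h).
Qed.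

Lemma for_ind (I : nat -> arrays -> Prop) d c env A : I 0 A ->
  (forall (i : 'I_n) A', (forall r, ~~ writes r c -> A' r = A r) -> I i A' ->
     I i.+1 (sem d.+1 c (upd env d.+1 i) A')) ->
  I n (sem d (For c) env A).
Proof.
move=> I0 IS /=.
suff H k i A' : i + k = n -> (forall r, ~~ writes r c -> A' r = A r) -> I i A' ->
    I n (foldl (fun A i => sem d.+1 c (upd env d.+1 i) A) A' (iota i k)).
  by apply: (H n 0).
elim: k i A' => [|k IH] i A' /= ik fr Ii; first by rewrite -ik addn0.
have iN : i < n by lia.
apply: IH; first by lia.
  by move=> r w; rewrite sem_frame // fr.
exact: (IS (Ordinal iN)).
Qed.

Fixpoint loops k c := if k is k'.+1 then For (loops k' c) else c.

Fixpoint bind (env : nat -> nat) d (s : seq 'I_n) :=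
  if s is i :: s' then bind (upd env d.+1 i) d.+1 s' else env.

Lemma writes_loops r k c : writes r (loops k c) = writes r c.
Proof. by elim: k. Qed.

(** Nested loops are treated as one loop over [k]-tuples: [Q s] is achieved in the round of [s] and
    survives because states only move up in [le]. *)
Lemma loops_ind k (I : arrays -> Prop) (le : arrays -> arrays -> Prop)
    (Q : seq 'I_n -> arrays -> Prop) d c env A :
  (forall A, le A A) -> (forall A1 A2 A3, le A1 A2 -> le A2 A3 -> le A1 A3) ->
  (forall s A1 A2, le A1 A2 -> Q s A1 -> Q s A2) -> I A ->
  (forall s A', size s = k -> (forall r, ~~ writes r c -> A' r = A r) -> I A' ->
     let A'' := sem (d + k) c (bind env d s) A' in [/\ I A'', le A' A'' & Q s A'']) ->
  let A' := sem d (loops k c) env A in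
  [/\ I A', le A A' & forall s, size s = k -> Q s A'].
Proof.
move=> lexx letr; elim: k d env A Q => [|k IH] d env A Q Qle IA H.
  have [h1 h2 h3] := H [::] A erefl (fun r _ => erefl) IA.
  by rewrite addn0 in h1 h2 h3; split=> // -[].
pose J m A' := [/\ I A', le A A' & forall (i : 'I_n) s, i < m -> size s = k -> Q (i :: s) A'].
suff: J n (sem d (loops k.+1 c) env A).
  by case=> h1 h2 h3; split=> // -[//|i s] [] sk; apply: h3.
apply: for_ind => [|i A' fr [h1 h2 h3]]; first by split.
have [|s A1 sk fr1 IA1|g1 g2 g3] := IH d.+1 (upd env d.+1 i) A' (fun s => Q (i :: s)) _ h1.
- by move=> s A1 A2; apply: Qle.
- have := H (i :: s) A1; rewrite /= sk addSnnS; apply=> // r w.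
  by rewrite fr1 // fr // writes_loops.
split=> //; first exact: letr h2 g2.
move=> j s; rewrite ltnS leq_eqVlt => /orP[/eqP/val_inj-> /g3 //|ji sk].
by apply: Qle g2 _; apply: h3.
Qed.

(** Set comprehension: a set of vertices is stored as row 0 of an array. *)
Definition compr d r b := For (ifb b (SetA r 0 d.+1 true) (SetA r 0 d.+1 false)).

Lemma writes_compr d r b r' : r' != r -> ~~ writes r' (compr d r b).
Proof. by move=> h; apply: writes_ifb; rewrite /= h. Qed.

Lemma sem_compr d r b env A (y : 'I_n) : env 0 = 0 -> ~~ reads r b ->
  sem d (compr d r b) env A r 0 y = beval b (upd env d.+1 y) A.
Proof.
move=> e0 nr.
pose I k (A' : arrays) := forall y : 'I_n, y < k -> A' r 0 y = beval b (upd env d.+1 y) A.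
suff: I n (sem d (compr d r b) env A) by apply.
apply: for_ind => // i A' fr Ii j ji.
have -> : sem d.+1 (ifb b (SetA r 0 d.+1 true) (SetA r 0 d.+1 false)) (upd env d.+1 i) A' =
    set_arr A' r 0 i (beval b (upd env d.+1 i) A).
  rewrite sem_ifb (@eq_beval _ _ A A') /=; last first.
    move=> r' rr; apply: fr; apply: writes_ifb => /=; apply: contraNneq nr => <- //.
  by rewrite upd_same upd_other // e0; case: beval.
rewrite /set_arr !eqxx /=; case: eqP => [/val_inj-> //|ne].
by apply: Ii; move: ji ne; rewrite ltnS leq_eqVlt => /orP[/eqP|].
Qed.

Lemma sem_loop_set d r b env A : env 0 = 0 -> ~~ reads r b ->
  sem d (Seq (SetA r 0 0 false) (For (ifb b (SetA r 0 0 true) Skip))) env A r 0 0 =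
  [exists i : 'I_n, beval b (upd env d.+1 i) A].
Proof.
move=> e0 nr /=; rewrite e0; set A0 := set_arr _ _ _ _ _.
have A0r r' : r' != r -> A0 r' = A r' by move=> h; rewrite /A0 /set_arr (negbTE h).
pose I k (A' : arrays) := A' r 0 0 = [exists i : 'I_n, (i < k) && beval b (upd env d.+1 i) A].
suff: I n (sem d (For (ifb b (SetA r 0 0 true) Skip)) env A0).
  by rewrite /I => h; rewrite -[LHS]/(sem d (For (ifb b (SetA r 0 0 true) Skip)) env A0 r 0 0) h;
    apply: eq_existsb => i; rewrite ltn_ord.
apply: for_ind => [|i A' fr Ii].
  rewrite /I /A0 /set_arr !eqxx; apply/esym/existsP; case=> i.
  by [].
rewrite /I sem_ifb (@eq_beval _ _ A A') /=; last first.
  move=> r' rr; have ne : r' != r by apply: contraNneq nr => <-.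
  by rewrite fr ?A0r //; apply: writes_ifb => /=.
rewrite upd_other // e0; case: ifP => bi.
  by rewrite /set_arr !eqxx; apply/esym/existsP; exists i; rewrite ltnSn.
rewrite Ii; apply: eq_existsb => j; rewrite ltnS [(j <= i)]leq_eqVlt.
by case: eqP => [/val_inj->|//]; rewrite bi andbF.
Qed.
End Semantics.

(** * Reachability and counting in the loop language *)

Section Macros.
Variable n : nat.
Local Notation sem := (sem n).
Definition row (A : arrays) r := [set i : 'I_n | A r 0 i].

Lemma row_compr d r b env A : env 0 = 0 -> ~~ reads r b ->
  row (sem d (compr d r b) env A) r = [set i : 'I_n | beval b (upd env d.+1 i) A].
Proof. by move=> e0 nr; apply/setP=> i; rewrite !inE sem_compr. Qed.

Definition reach_step W R p q :=
  ifb (And (At R 0 p) (And (At W 0 p) (And (At W 0 q) (At 0 p q)))) (SetA R 0 q true) Skip.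
Definition reach d W R x := Seq (compr d R (Cst false)) (Seq (SetA R 0 x true)
  (For (loops 2 (reach_step W R d.+2 d.+3)))).

Lemma row_set A r (x : 'I_n) b : row (set_arr A r 0 x b) r = if b then x |: row A r else row A r :\ x.
Proof.
apply/setP=> i; case: b; rewrite !inE /set_arr !eqxx /=; case: (i =P x) => [->|ne]; rewrite ?eqxx //.
  by case: eqP => // /val_inj.
by case: eqP => // /val_inj.
Qed.

(** Updates in place may advance by several edges in one round. The new row is therefore only
    bounded: above by every closed set [C], below by one step. *)
Lemma reach_round (e : rel 'I_n) d (W R : nat) env (A : arrays) : env 0 = 0 -> W != R -> R != 0 ->
  (forall u v : 'I_n, A 0 u v = e u v) ->
  let A' := sem d.+1 (loops 2 (reach_step W R d.+2 d.+3)) env A in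
  [/\ row A R \subset row A' R,
      forall C : {set 'I_n}, row A R \subset C ->
        (forall u v, u \in C -> er e (row A W) u v -> v \in C) -> row A' R \subset C &
      forall u v, u \in row A R -> er e (row A W) u v -> v \in row A' R].
Proof.
move=> e0 WR R0 adj A'.
pose good (C : {set 'I_n}) := row A R \subset C /\ forall u v, u \in C -> er e (row A W) u v -> v \in C.
pose I A1 := row A R \subset row A1 R /\ forall C, good C -> row A1 R \subset C.
pose le A1 A2 := row A1 R \subset row A2 R.
pose Q s A1 := if s is [:: u; v] then u \in row A R -> er e (row A W) u v -> v \in row A1 R else True.
have [|A1 A2 A3|s A1 A2|||[h1 h2] h3 h4] := @loops_ind n 2 I le Q d.+1 (reach_step W R d.+2 d.+3) env A.
- by move=> A1; apply: subxx.
- exact: subset_trans.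
- by rewrite /Q; case: s => [|u [|v []]] // s12 h uR uv; apply: (subsetP s12); apply: h.
- by split=> // C [].
- case=> [|u [|v []]] // A1 _ fr [I1 I2].
  have fr' r : r != R -> A1 r = A r.
    by move=> h; apply: fr; rewrite /= (negbTE h).
  rewrite /reach_step sem_ifb /=.
  have E0 : upd (upd env d.+2 u) d.+3 v 0 = 0 by rewrite !upd_other.
  have E2 : upd (upd env d.+2 u) d.+3 v d.+2 = u.
    by rewrite upd_other ?upd_same // neq_ltn ltnSn.
  have E3 : upd (upd env d.+2 u) d.+3 v d.+3 = v by rewrite upd_same.
  rewrite E0 E2 E3 !(fr' W) // (fr' 0) 1?eq_sym // adj.
  have -> : [&& A1 R 0 u, A W 0 u, A W 0 v & e u v] = (u \in row A1 R) && er e (row A W) u v.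
    by rewrite /er /= !inE.
  case: ifP => [/andP[uR uv]|nE].
    rewrite /I /le row_set; split; last by move=> _ _; rewrite !inE eqxx.
      split; first exact: subset_trans I1 (subsetUr _ _).
      move=> C gC; rewrite subUset (I2 C gC) andbT sub1set; case: (gC) => _; apply; last exact: uv.
      by apply: (subsetP (I2 C gC)).
    exact: subsetUr.
  split=> //; first exact: subxx.
  move=> uR uv; move: nE; rewrite uv andbT; move/negP; case.
  exact: (subsetP I1).
split=> //.
- by move=> C s1 s2; apply: h2.
- by move=> u v; apply: (h4 [:: u; v]).
Qed.

(** Each round gains at least one edge of a path, and a path without repetition has fewer than [n]
    edges. *)
Lemma row_reach (e : rel 'I_n) d (W R x : nat) (v : 'I_n) env (A : arrays) : env 0 = 0 -> W != R -> R != 0 -> env x = v ->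
  (forall u v : 'I_n, A 0 u v = e u v) ->
  row (sem d (reach d W R x) env A) R = [set u | connect (er e (row A W)) v u].
Proof.
move=> e0 WR R0 ex adj.
pose A0 := sem d (SetA R 0 x true) env (sem d (compr d R (Cst false)) env A).
rewrite -[sem d _ _ _]/(sem d (For (loops 2 (reach_step W R d.+2 d.+3))) env A0).
have A0R : row A0 R = [set v].
  have -> : A0 = set_arr (sem d (compr d R (Cst false)) env A) R 0 v true by rewrite /A0 /= e0 ex.
  rewrite row_set row_compr //.
  by apply/setP=> i; rewrite !inE /= orbF.
have A0o r : r != R -> A0 r = A r.
  move=> h; rewrite /A0 sem_frame //; apply: sem_frame; exact: writes_compr.
pose E := er e (row A W).
pose I k A' := row A' R \subset [set u | connect E v u] /\
   forall p, path E v p -> size p <= k -> last v p \in row A' R.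
have: I n (sem d (For (loops 2 (reach_step W R d.+2 d.+3))) env A0).
  apply: for_ind => [|i A1 fr [I1 I2]].
    split; first by rewrite A0R sub1set inE connect0.
    by case=> // _ _; rewrite A0R set11.
  have fr' r : r != R -> A1 r = A r.
    by move=> h; rewrite fr ?A0o //= (negbTE h).
  have rW : row A1 W = row A W by rewrite /row fr'.
  have [||g1 g2 g3] := @reach_round e d W R (upd env d.+1 i) A1 _ WR R0.
  - by rewrite upd_other.
  - by rewrite fr' // eq_sym.
  rewrite rW in g2 g3; split.
    apply: g2 => // a b; rewrite !inE => va ab; exact: connect_trans va (connect1 ab).
  case/lastP => [|p z] pp.
    by move=> _; apply: (subsetP g1); apply: (I2 [::]).
  rewrite size_rcons ltnS last_rcons => sp; move: pp; rewrite rcons_path => /andP[pp pz].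
  by apply: g3 pz; apply: I2.
case=> h1 h2; apply/eqP; rewrite eqEsubset h1 /=; apply/subsetP=> u.
rewrite inE => /connectP[p pp ->]; case/shortenP: pp => q pq uq _.
have : size (v :: q) <= size (enum 'I_n) by apply: uniq_leq_size => // z _; rewrite mem_enum.
by rewrite size_enum_ord /= => /ltnW; apply: h2.
Qed.

(** Successor in unary: the first free position is filled, and the flag [f] blocks the later
    ones. *)
Definition incr dst f p := For (ifb (And (Neg (At dst 0 p)) (Neg (At f 0 0)))
  (Seq (SetA dst 0 p true) (SetA f 0 0 true)) Skip).
(* Row dst becomes the cardinality of row src in unary. *)
Definition counter d src dst f := Seq (compr d dst (Cst false))
  (For (ifb (At src 0 d.+1) (Seq (SetA f 0 0 false) (incr dst f d.+2)) Skip)).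

Lemma sem_incr d (dst f : nat) env (A : arrays) m : env 0 = 0 -> dst != f -> A f 0 0 = false ->
  (forall y : 'I_n, A dst 0 y = (y < m)) ->
  forall y : 'I_n, sem d (incr dst f d.+1) env A dst 0 y = (y < m.+1).
Proof.
move=> e0 df f0 dm.
pose I k (A' : arrays) := A' f 0 0 = (m < k) /\ forall y : 'I_n, A' dst 0 y = (y < m + (m < k)).
have: I n (sem d (incr dst f d.+1) env A).
  apply: for_ind => [|i A' _ [I1 I2]]; first by split=> // y; rewrite ltn0 addn0.
  rewrite sem_ifb /= upd_other // e0 upd_same I1 I2.
  case: ifP => h.
    have im : m = i by lia.
    split; first by rewrite /set_arr !eqxx im ltnSn.
    move=> y; rewrite /set_arr (negbTE df) /= !eqxx /=; case: eqP => yi; first by lia.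
    by rewrite I2; lia.
  by split=> [|y]; rewrite ?I1 ?I2; lia.
by case=> _ h y; rewrite h; have := ltn_ord y; lia.
Qed.

Lemma sem_counter d (src dst f : nat) env (A : arrays) : env 0 = 0 -> src != dst -> src != f -> dst != f ->
  forall y : 'I_n, sem d (counter d src dst f) env A dst 0 y = (y < #|row A src|).
Proof.
move=> e0 sd sf df.
pose A0 := sem d (compr d dst (Cst false)) env A.
pose body := ifb (At src 0 d.+1) (Seq (SetA f 0 0 false) (incr dst f d.+2)) Skip.
rewrite -[sem d _ _ _]/(sem d (For body) env A0).
have A0s : A0 src = A src by apply: sem_frame; apply: writes_compr.
pose B k := [set i in row A src | i < k].
pose I k (A' : arrays) := forall y : 'I_n, A' dst 0 y = (y < #|B k|).
suff: I n (sem d (For body) env A0).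
  move=> h y; rewrite h; congr (_ < #|pred_of_set _|); apply/setP=> i.
  by rewrite !inE ltn_ord andbT.
apply: for_ind => [y|i A' fr Ii y].
  rewrite /A0 sem_compr //= (_ : B 0 = set0) ?cards0 //; apply/setP=> i.
  by rewrite !inE ltn0 andbF.
rewrite sem_ifb [beval _ _ _]/= upd_other // e0 upd_same fr; last by rewrite !negb_or sf sd.
rewrite A0s; case: ifP => si.
  have -> : B i.+1 = i |: B i.
    apply/setP=> j; rewrite !inE ltnS [j <= i]leq_eqVlt -val_eqE /= andb_orr.
    by congr (_ || _); case: eqP => [/val_inj->|_]; rewrite ?si ?andbF.
  have iB : i \notin B i by rewrite !inE ltnn andbF.
  rewrite cardsU1 iB add1n.
  rewrite -[sem _ (Seq _ _) _ _]/(sem d.+1 (incr dst f d.+2) (upd env d.+1 i)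
    (set_arr A' f (upd env d.+1 i 0) (upd env d.+1 i 0) false)).
  have -> : upd env d.+1 i 0 = 0 by rewrite upd_other.
  apply: sem_incr; [by rewrite upd_other | by [] | by rewrite /set_arr !eqxx | ].
  by move=> z; rewrite /set_arr (negbTE df) /= Ii.
rewrite [sem _ _ _ _]/= Ii; congr (_ < #|pred_of_set _|); apply/setP=> j.
rewrite !inE ltnS [j <= i]leq_eqVlt andb_orr.
by case: eqP => [/val_inj->|_]; rewrite ?si ?andbF.
Qed.
End Macros.

(** * Approximate deletion sets *)

(* Distinct vertices with the same image under f become parallel segments next to each other. *)
Lemma bip_perm_pull n n' (e : rel 'I_n) (e' : rel 'I_n') (S : {set 'I_n}) (S' : {set 'I_n'}) f :
  {in S', forall u, f u \in S} -> {in S' &, forall u v, e' u v = e (f u) (f v)} -> irreflexive e ->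
  bip_perm_on e S -> bip_perm_on e' S'.
Proof.
move=> fS fe eirr [[col bp] [p1 [p2 [i1 [i2 H]]]]]; split.
  by exists (fun u => col (f u)) => x y xS yS; rewrite fe //; apply: bp; apply: fS.
have mono (p : 'I_n -> nat) : {in S &, injective p} -> {in S' &, forall x y,
    (p (f x) * n' + x < p (f y) * n' + y) = if f x == f y then x < y else p (f x) < p (f y)}.
  move=> ip x y xS yS; case: eqP => [->|ne]; first by rewrite ltn_add2l.
  have nep : p (f x) <> p (f y) by move/(ip _ _ (fS x xS) (fS y yS)).
  by have := ltn_ord x; have := ltn_ord y; move: nep; clear; nia.
have inj (p : 'I_n -> nat) : {in S' &, injective (fun x : 'I_n' => p (f x) * n' + x)}.
  move=> x y _ _ /eqP /= h; apply/val_inj/eqP; move/eqP: h => h; apply/eqP.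
  have := congr1 (modn^~ n') h; rewrite /= !modnMDl !modn_small //.
exists (fun x => p1 (f x) * n' + x), (fun x => p2 (f x) * n' + x); split; first exact: inj.
split; first exact: inj.
move=> x y xS yS xy; rewrite (mono p1 i1 x y xS yS) (mono p2 i2 x y xS yS) fe //; case: (f x =P f y) => [->|/eqP ne]; first by rewrite eirr eqxx.
by apply: H => //; apply: fS.
Qed.

Section Approx.
Variables (n : nat) (e : rel 'I_n).
Hypotheses (esym : symmetric e) (eirr : irreflexive e).
Local Notation T := 'I_n.
Implicit Types X Y Z S B : {set T}.

(** The invariant of the whole algorithm: every solution [Y] pays nine per vertex, and this covers
    [Z] together with a solution [Y'] of what remains. *)
Definition approx Z := forall Y, bip_perm_on e (~: Y) ->
  exists Y', [/\ bip_perm_on e (~: Z :\: Y'), Y' \subset ~: Z & #|Z| + 9 * #|Y'| <= 9 * #|Y|].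

Lemma approx0 : approx set0.
Proof. by move=> Y bY; exists Y; rewrite setC0 setTD subsetT cards0. Qed.

(** [Y'] has to meet [X], and one vertex dropped from it pays for the nine vertices of [X]. *)
Lemma approx_small Z X : approx Z -> X \subset ~: Z -> #|X| <= 9 -> ~ bip_perm_on e X -> approx (Z :|: X).
Proof.
move=> aZ XZ X9 nX Y /aZ[Y' [bY YZ cY]]; exists (Y' :\: X); split.
- apply: bipS bY; apply/subsetP=> v; rewrite !inE.
  by case: (v \in X); case: (v \in Z); case: (v \in Y').
- by apply/subsetP=> v; rewrite !inE => /andP[vX /(subsetP YZ)]; rewrite inE negb_or vX => ->.
have YX : 0 < #|Y' :&: X|.
  rewrite card_gt0; apply: contra_notN nX => /eqP YX0; apply: bipS bY; apply/subsetP=> v vX.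
  by rewrite inE (subsetP XZ) // andbT; apply/negP=> vY; have := in_set0 v; rewrite -YX0 inE vY vX.
by have := cardsID X Y'; have := cardsU Z X; move: cY X9 YX; clear; lia.
Qed.

(** An exchange: [B] replaces the part of [Y'] in the component. By [cand_exists] that part contains
    a valid candidate, so it is at least as large as [B]. *)
Lemma approx_component Z r B : approx Z -> small_free e (~: Z) -> r \in ~: Z ->
  let H := component e (~: Z) r in B \subset H -> nh e (H :\: B) ->
  (forall c u v w x, nh e (H :\: cand e H c u v w x) -> #|B| <= #|cand e H c u v w x|) ->
  approx (Z :|: B).
Proof.
move=> aZ sf rZ H BH nB mB Y /aZ[Y' [bY YZ cY]].
have HZ : H \subset ~: Z := component_sub e rZ.
have rH : r \in H by rewrite inE connect0.
have bH : bip_perm_on e (H :\: (Y' :&: H)).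
  apply: bipS bY; apply/subsetP=> v /setDP[vH]; rewrite in_setI vH andbT => vY.
  by rewrite in_setD vY (subsetP HZ).
have [c [u [v [w [x [cY' bc]]]]]] : exists c u v w x, cand e H c u v w x \subset Y' :&: H /\
    bip_perm_on e (H :\: cand e H c u v w x).
  apply: cand_exists => //.
  - exact: small_freeS HZ sf.
  - exact: component_connected.
  - by apply/set0Pn; exists r.
  - exact: subsetIr.
have cB : #|B| <= #|Y' :&: H|.
  by apply: leq_trans (mB c u v w x _) (subset_leq_card cY'); apply: bip_nh.
exists (Y' :\: H); split.
- have -> : ~: (Z :|: B) :\: (Y' :\: H) = (H :\: B) :|: ((~: Z :\: Y') :\: H).
    apply/setP=> z; have := subsetP HZ z; have := subsetP BH z; rewrite !(in_setD, in_setU, in_setC).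
    case: (z \in B); case: (z \in H) => //=; case: (z \in Z) => //=;
    case: (z \in Y') => //=; by [move=> /(_ isT) | move=> _ /(_ isT)].
  apply: union_bip_perm => //.
  + apply: hole_free_bip_perm => //; apply: small_freeS sf.
    by apply: subset_trans HZ; apply: subsetDl.
  + by apply: bipS bY; apply: subsetDl.
  move=> p q /setDP[pH _] /setDP[/setDP[qZ _] qH]; apply/negP=> epq; move/negP: qH; apply.
  by apply: component_closed epq => //; apply: (subsetP HZ).
- apply/subsetP=> z /setDP[zY zH]; rewrite in_setC in_setU negb_or; apply/andP; split.
    by have := subsetP YZ z zY; rewrite inE.
  by apply: contraNN zH => /(subsetP BH).
have cU : #|Z :|: B| <= #|Z| + #|B| by rewrite cardsU leq_subr.
have cI : #|Y' :&: H| + #|Y' :\: H| = #|Y'| := cardsID H Y'.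
apply: leq_trans cY; rewrite -cI; apply: leq_trans (leq_add cU (leqnn _)) _.
by rewrite -addnA leq_add2l mulnDr leq_add2r (leq_trans cB) // leq_pmull.
Qed.

Lemma component_bip_perm Z r B : small_free e (~: Z) -> r \in ~: Z ->
  let H := component e (~: Z) r in nh e (H :\: B) ->
  bip_perm_on e (component e (~: (Z :|: B)) r :\: (Z :|: B)).
Proof.
move=> sf rZ H nB; have HZ : H \subset ~: Z := component_sub e rZ.
have bH : bip_perm_on e (H :\: B).
  apply: hole_free_bip_perm => //; apply: small_freeS sf.
  by apply: subset_trans HZ; apply: subsetDl.
apply: bipS bH; apply/subsetP=> v; rewrite !in_setD in_setU negb_or => /andP[/andP[_ vB]].
by rewrite vB !inE; apply: er_mono; rewrite setCS subsetUl.
Qed.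

(** [component] always contains its root; subtracting the deleted set keeps the claim valid when the
    root is deleted later. *)
Lemma component_bip_permS Z Z' r : Z \subset Z' -> bip_perm_on e (component e (~: Z) r :\: Z) ->
  bip_perm_on e (component e (~: Z') r :\: Z').
Proof.
move=> ZZ; apply: bipS; apply/subsetP=> v; rewrite !in_setD => /andP[vZ vC].
rewrite (contraNN _ vZ); last exact: (subsetP ZZ).
by move: vC; rewrite !inE; apply: er_mono; rewrite setCS.
Qed.

Lemma components_bip_permC Z : {in ~: Z, forall r, bip_perm_on e (component e (~: Z) r :\: Z)} ->
  bip_perm_on e (~: Z).
Proof.
move=> h; apply: components_bip_perm => // r rZ; apply: bipS (h r rZ).
apply/subsetP=> v vC; rewrite in_setD vC andbT.
by have := subsetP (component_sub e rZ) v vC; rewrite in_setC.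
Qed.

Lemma approx_card Z Y : approx Z -> bip_perm_on e (~: Y) -> #|Z| <= 9 * #|Y|.
Proof. by move=> aZ /aZ[Y' [_ _]]; apply: leq_trans; apply: leq_addr. Qed.
End Approx.

(** * The algorithm *)

Definition nine := iota 1 9.
Definition pairs := [seq (i, j) | i <- nine, j <- nine].
Definition pattern n (e : rel 'I_n) (x : nat -> 'I_n) := [seq e (x p.1) (x p.2) | p <- pairs].
Definition image9 n (x : nat -> 'I_n) := [set u | u \in [seq x i | i <- nine]].

(** Quantifying over all graphs makes [badb] one fixed function on lists of 81 bits, independent of
    the input. It may be chosen classically, since the program only contains its finite table. *)
Definition bad_pattern (s : seq bool) : Prop := exists n (e : rel 'I_n) x,
  [/\ irreflexive e, pattern e x = s & ~ bip_perm_on e (image9 x)].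
Definition badb s : bool := if excluded_middle_informative (bad_pattern s) then true else false.

(** A pattern records adjacency but not equality, so a repeated vertex looks like a nonadjacent
    twin; [bip_perm_pull] shows that this makes no difference. *)
Lemma pattern_bip_perm n n' (e : rel 'I_n) (e' : rel 'I_n') x x' : irreflexive e ->
  pattern e x = pattern e' x' -> bip_perm_on e (image9 x) -> bip_perm_on e' (image9 x').
Proof.
move=> eirr /eq_in_map h; pose g u := nth 0 nine (index u [seq x' i | i <- nine]).
have gP u : u \in image9 x' -> g u \in nine /\ x' (g u) = u.
  rewrite inE => uI; have lt : index u [seq x' i | i <- nine] < size nine.
    by rewrite -(size_map x') index_mem.
  by split; [apply: mem_nth | rewrite /g -(nth_map 0 u) // nth_index].
apply: (@bip_perm_pull _ _ _ _ _ _ (fun u => x (g u))) => // [u /gP[gu _]|u v /gP[gu xu] /gP[gv xv]].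
  by rewrite inE map_f.
have gP' : (g u, g v) \in pairs.
  by rewrite /pairs; move: (g u) (g v) gu gv; move: nine => l i j; apply: allpairs_f.
by have := h _ gP'; move: (g u) (g v) xu xv => i j <- <-.
Qed.

Lemma badbP n (e : rel 'I_n) x : irreflexive e ->
  badb (pattern e x) <-> ~ bip_perm_on e (image9 x).
Proof.
move=> eirr; rewrite /badb; case: excluded_middle_informative => [[n' [e' [x' [ei pE nb]]]]|nb]; split=> //.
  by move=> _ b; apply: nb; apply: pattern_bip_perm b.
by move=> b; case: nb; exists n, e, x.
Qed.

Definition outside := foldr (fun i b => And (Neg (At 1 0 i)) b) (Cst true) nine.
Definition mark l := foldr (fun i c => Seq (SetA 1 0 i true) c) Skip l.
Definition bad_tuple := btree [seq At 0 p.1 p.2 | p <- pairs] badb.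
(* Abstracting the test b keeps the huge tree bad_tuple from being computed. *)
Definition stage1 b := loops 9 (ifb (And outside b) (mark nine) Skip).

Lemma bind_other n env d (s : seq 'I_n) j : j <= d -> bind env d s j = env j.
Proof.
elim: s env d => //= i s IH env d jd; rewrite IH; last by lia.
by rewrite upd_other //; lia.
Qed.

Lemma bind_nth n env d (s : seq 'I_n) i0 j : d < j <= d + size s ->
  bind env d s j = nth i0 s (j - d.+1).
Proof.
elim: s env d => [|i s IH] env d /=; first by lia.
case/andP; rewrite leq_eqVlt => /orP[/eqP<- _|dj js].
  by rewrite bind_other // upd_same subnn.
rewrite IH; last by lia.
by have -> : j - d.+1 = (j - d.+2).+1 by lia.
Qed.

Lemma row_mark n d l (x : nat -> 'I_n) env A : env 0 = 0 -> {in l, forall i, env i = x i} ->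
  row n (sem n d (mark l) env A) 1 = row n A 1 :|: [set u | u \in [seq x i | i <- l]].
Proof.
move=> e0; elim: l A => [|i l IH] A h /=; first by apply/setP=> u; rewrite !inE orbF.
rewrite IH; last by move=> j jl; apply: h; rewrite inE jl orbT.
rewrite e0 h ?mem_head // row_set; apply/setP=> u; rewrite !inE.
by case: (u == x i); rewrite /= ?orbT.
Qed.

(* Arrays: 0 adjacency, 1 deleted set, 2 equality, 3 and 4 domain and result of a
   search, 5 component, 6 best candidate so far, 7 current candidate, 8 and 9
   their sizes (of 7 and of 6), 12 component without candidate, 10, 11, 13 flags.
   Variables: 1 root of the component, 2-6 the parameters c, u, v, w, x of the
   candidate, 7-10 the path of a possible hole. *)
Definition cand_row := compr 6 7 (And (At 5 0 7) (And (Neg (At 2 7 2)) (And (Neg (At 0 2 7))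
  (Or (And (At 0 3 7) (At 0 4 7)) (And (At 0 5 7) (At 0 6 7)))))).
Definition rest_row := compr 6 12 (And (At 5 0 7) (Neg (At 7 0 7))).
Definition smaller := Seq (SetA 11 0 0 false) (For (ifb (And (At 9 0 7) (Neg (At 8 0 7))) (SetA 11 0 0 true) Skip)).
Definition path4 := And (And (At 12 0 7) (And (At 12 0 8) (And (At 12 0 9) (At 12 0 10))))
  (And (At 0 7 8) (And (At 0 8 9) (And (At 0 9 10) (And (Neg (At 0 7 9))
  (And (Neg (At 0 8 10)) (Neg (At 0 7 10))))))).
Definition avoid_row := compr 10 3 (Or (And (At 12 0 11) (And (Neg (At 0 8 11)) (Neg (At 0 9 11))))
  (Or (At 2 11 7) (At 2 11 10))).
Definition hole_step := ifb path4 (Seq avoid_row (Seq (reach 10 3 4 7)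
  (ifb (At 4 0 10) (SetA 13 0 0 true) Skip))) Skip.
Definition find_hole := Seq (SetA 13 0 0 false) (loops 4 hole_step).
Definition improve := Seq cand_row (Seq (counter 6 7 8 10) (Seq (counter 6 6 9 10) (Seq smaller
  (Seq rest_row (Seq find_hole
  (ifb (And (At 11 0 0) (Neg (At 13 0 0))) (compr 6 6 (At 7 0 7)) Skip)))))).
Definition clean_component := Seq (compr 1 3 (Neg (At 1 0 2))) (Seq (reach 1 3 4 1)
  (Seq (compr 1 5 (At 4 0 2)) (Seq (compr 1 6 (At 4 0 2)) (Seq (loops 5 improve)
  (Seq (compr 1 3 (Or (At 1 0 2) (At 6 0 2))) (compr 1 1 (At 3 0 2))))))).
Definition stage2 := For (ifb (At 1 0 1) Skip clean_component).
Definition algorithm b := Seq (For (SetA 2 1 1 true)) (Seq (stage1 b) stage2).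

(** * Correctness of the two stages *)

Section Algorithm.
Variables (n : nat) (e : rel 'I_n).
Hypotheses (esym : symmetric e) (eirr : irreflexive e).
Local Notation T := 'I_n.
Local Notation sem := (sem n).
Local Notation row := (row n).
Local Notation Zr A := (row A 1).

Lemma bip_perm0 : bip_perm_on e set0.
Proof.
split; first by exists (fun=> true) => x y; rewrite inE.
by exists (fun=> 0), (fun=> 0); split; [|split] => x y; rewrite inE.
Qed.

Lemma stage1_correct b (A : arrays) :
  (forall env A, beval b env A = badb [seq A 0 (env p.1) (env p.2) | p <- pairs]) ->
  (forall u v : T, A 0 u v = e u v) -> approx e (Zr A) ->
  let A' := sem 0 (stage1 b) (fun=> 0) A in approx e (Zr A') /\ small_free e (~: Zr A').
Proof.
move=> bE adj aA.
pose le A1 A2 := Zr A1 \subset Zr A2.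
pose Q (s : seq T) A1 := [set u | u \in s] \subset ~: Zr A1 -> bip_perm_on e [set u | u \in s].
have [|A1 A2 A3|s A1 A2|||h1 _ h3] := @loops_ind n 9 (fun A1 => approx e (Zr A1)) le Q 0
  (ifb (And outside b) (mark nine) Skip) (fun=> 0) A.
- by move=> A1; apply: subxx.
- exact: subset_trans.
- by move=> s12 h sub; apply: h; apply: subset_trans sub _; rewrite setCS.
- exact: aA.
- move=> s A1 s9 fr aA1.
  have A10 : A1 0 = A 0 by apply: fr; apply: writes_ifb.
  have [i0 i0s] : exists i0, i0 = head i0 s by case: (s) s9 => // i s' _; exists i.
  pose x i := nth i0 s i.-1.
  set env := bind _ _ _.
  have e0 : env 0 = 0 by rewrite /env bind_other.
  have ex : {in nine, forall i, env i = x i}.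
    move=> i; rewrite mem_iota => ir; rewrite /env (bind_nth _ i0); last by rewrite s9; lia.
    by rewrite subn1.
  have sx : [seq x i | i <- nine] = s.
    apply: (@eq_from_nth _ i0); first by rewrite size_map s9.
    move=> i; rewrite size_map => i9; rewrite (nth_map 0) // nth_iota //.
  have pE : [seq A1 0 (env p.1) (env p.2) | p <- pairs] = pattern e x.
    apply/eq_in_map => -[i j] /allpairsP[[i' j'] [/= hi hj [-> ->]]].
    by rewrite A10 !ex.
  have oE : beval outside env A1 = ([set u | u \in s] \subset ~: Zr A1).
    have -> : beval outside env A1 = all (fun i => ~~ A1 1 0 (env i)) nine by rewrite /= e0.
    rewrite -sx; apply/allP/subsetP => [h u|h i i9].
      by rewrite in_set => /mapP[i i9 ->]; rewrite in_setC in_set -ex //; apply: h.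
    by rewrite ex //; have := h (x i); rewrite in_setC !in_set; apply; apply: map_f.
  have im : image9 x = [set u | u \in s] by rewrite /image9 sx.
  have cE : beval (And outside b) env A1 = ([set u | u \in s] \subset ~: Zr A1) && badb (pattern e x).
    by rewrite -oE -pE -bE.
  rewrite sem_ifb cE.
  case: ifP => [/andP[sub /(badbP _ eirr)]|].
    rewrite im => nb; rewrite /le /Q (row_mark _ _ e0 ex) sx; split.
    + apply: approx_small => //; apply: leq_trans (_ : size s <= 9); last by rewrite s9.
      by rewrite cardsE; apply: card_size.
    + exact: subsetUl.
    by move=> h; case: nb; apply: bipS (bip_perm0); apply/subsetP=> u us; have := subsetP h u us;
      rewrite !inE in us *; rewrite us orbT.
  move=> nE; split=> //; first exact: subxx.
  move=> sub; apply: NNPP; rewrite -im => nb; move: nE; rewrite sub /=.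
  by move/(badbP _ eirr): nb => ->.
split=> // X XZ X9; have [->|/set0Pn[x0 x0X]] := eqVneq X set0; first exact: bip_perm0.
(* Smaller sets are padded by repetition, so the nine nested loops reach them too. *)
pose s := enum X ++ nseq (9 - #|X|) x0.
have s9 : size s = 9 by rewrite size_cat size_nseq -cardE subnKC.
have sX : [set u | u \in s] = X.
  apply/setP=> u; rewrite inE mem_cat mem_enum mem_nseq; case uX: (u \in X) => //=.
  by apply/negbTE; rewrite negb_and; apply/orP; right; apply: contraFneq uX => ->.
by have := h3 s s9; rewrite /Q sX; apply.
Qed.

Definition basic (A : arrays) := (forall u v : T, A 0 u v = e u v) /\ (forall u v : T, A 2 u v = (u == v)).

Lemma basic_frame A A' : A' 0 = A 0 -> A' 2 = A 2 -> basic A -> basic A'.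
Proof. by move=> h0 h2 [b0 b2]; split=> u v; rewrite ?h0 ?h2. Qed.

Lemma find_hole_correct env A : env 0 = 0 -> basic A ->
  sem 6 find_hole env A 13 0 0 = ~~ nh e (row A 12).
Proof.
move=> e0 bA; set S := row A 12.
pose A0 := set_arr A 13 0 0 false.
have -> : sem 6 find_hole env A = sem 6 (loops 4 hole_step) env A0.
  by rewrite -[LHS]/(sem 6 (loops 4 hole_step) env (set_arr A 13 (env 0) (env 0) false)) e0.
have bA0 : basic A0 by apply: basic_frame bA.
pose I (A1 : arrays) := A1 13 0 0 -> ~~ nh e S.
pose le (A1 A2 : arrays) := A1 13 0 0 -> A2 13 0 0 : Prop.
pose Q (s : seq T) (A1 : arrays) := if s is [:: a; b; c; d] then hole4 e S a b c d -> A1 13 0 0 : Prop else True.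
have [|A1 A2 A3|s A1 A2|||h1 _ h3] := @loops_ind n 4 I le Q 6 hole_step env A0.
- by move=> A1.
- by move=> h12 h23 /h12.
- by rewrite /Q; case: s => [|a [|b [|c [|d []]]]] // h12 h /h.
- by rewrite /I /A0 /set_arr.
- case=> [|a [|b [|c [|d []]]]] // A1 _ fr IA1.
  have bA1 : basic A1 by apply: basic_frame bA0; apply: fr.
  have [adj eqE] := bA1.
  have S1 : row A1 12 = S by rewrite /row fr.
  set E := bind env 6 _.
  have E0 : E 0 = 0 by rewrite /E bind_other.
  have [E7 E8 E9 E10] : [/\ E 7 = a, E 8 = b, E 9 = c & E 10 = d] by [].
  have S1E (u : T) : A1 12 0 u = (u \in S) by rewrite -S1 inE.
  have pE : beval path4 E A1 = [&& a \in S, b \in S, c \in S & d \in S] &&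
      [&& e a b, e b c, e c d, ~~ e a c, ~~ e b d & ~~ e a d].
    by rewrite /path4 [LHS]/= E0 E7 E8 E9 E10 !adj !S1E.
  rewrite /hole_step sem_ifb pE; case: ifP => [p4|np]; last first.
    by split=> //; rewrite /Q /hole4 np.
  pose A2 := sem 10 avoid_row E A1.
  have A2W : row A2 3 = avoid2 e S a b c d.
    rewrite row_compr //; apply/setP=> u; rewrite [in LHS]inE.
    rewrite [beval _ _ _]/= -/E.
    rewrite (upd_same E 11 u) !upd_other // E0 E7 E8 E9 E10 !adj !eqE S1E.
    by rewrite !inE; case: (u \in S).
  have bA2 : basic A2 by apply: basic_frame bA1; apply: sem_frame; apply: writes_compr.
  have [adj2 _] := bA2.
  pose A3 := sem 10 (reach 10 3 4 7) E A2.
  have A3R : row A3 4 = [set u | connect (er e (avoid2 e S a b c d)) a u].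
    by rewrite /A3 (@row_reach n e 10 3 4 7 a E A2) // A2W.
  have A313 : A3 13 = A1 13.
    by rewrite /A3 sem_frame //; apply: sem_frame; apply: writes_compr.
  rewrite -[sem _ (Seq _ _) _ _]/(sem 10 (ifb (At 4 0 10) (SetA 13 0 0 true) Skip) E A3).
  rewrite sem_ifb [beval _ _ _]/= E0 E10.
  have -> : A3 4 0 d = connect (er e (avoid2 e S a b c d)) a d.
    by have := congr1 (fun X : {set T} => d \in X) A3R; rewrite !inE.
  case: ifP => con.
    rewrite /I /le /Q /= E0 /set_arr /=; split=> // _.
    by apply/negP=> /nhP/(_ a b c d); rewrite /hole4 p4 con.
  by rewrite /I /le /Q /= A313; split=> //; rewrite /hole4 con andbF.
apply/idP/idP => [/h1 //|/nhPn[a [b [c [d h]]]]].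
exact: (h3 [:: a; b; c; d]).
Qed.
Lemma improve_correct env A (c u v w x : T) : env 0 = 0 -> basic A ->
  [/\ env 2 = c, env 3 = u, env 4 = v, env 5 = w & env 6 = x] ->
  let H := row A 5 in let C := cand e H c u v w x in
  row (sem 6 improve env A) 6 = if (#|C| < #|row A 6|) && nh e (H :\: C) then C else row A 6.
Proof.
move=> e0 bA [e2 e3 e4 e5 e6] H C.
pose A1 := sem 6 cand_row env A.
have A1o r : r != 7 -> A1 r = A r by move=> h; apply: sem_frame; apply: writes_compr.
have A1C : row A1 7 = C.
  rewrite row_compr //; apply/setP=> q; have [adj eqE] := bA.
  rewrite [in LHS]inE [beval _ _ _]/= (upd_same env 7 q) !upd_other // e0 e2 e3 e4 e5 e6 !adj eqE.
  by rewrite !inE.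
pose A2 := sem 6 (counter 6 7 8 10) env A1.
have A2c (y : T) : A2 8 0 y = (y < #|C|) by rewrite /A2 sem_counter // A1C.
have A2o r : r != 8 -> r != 10 -> A2 r = A1 r.
  by move=> h8 h10; apply: sem_frame; rewrite /= (negbTE h8) (negbTE h10).
pose A3 := sem 6 (counter 6 6 9 10) env A2.
have A3c (y : T) : A3 9 0 y = (y < #|row A 6|).
  by rewrite /A3 sem_counter //; congr (_ < #|pred_of_set _|); rewrite /row A2o // A1o.
have A3o r : r != 9 -> r != 10 -> A3 r = A2 r.
  by move=> h8 h10; apply: sem_frame; rewrite /= (negbTE h8) (negbTE h10).
pose A4 := sem 6 smaller env A3.
have A4c : A4 11 0 0 = (#|C| < #|row A 6|).
  (* Two unary numbers are compared by looking for a position in the second but not in the first;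
     position [#|C|] serves as witness. *)
  rewrite /A4 sem_loop_set //; apply/existsP/idP => [[i]|lt].
    rewrite /= upd_same upd_other // e0 A3c A3o // A2c -leqNgt => /andP[iB Ci].
    exact: leq_ltn_trans Ci iB.
  have CN : #|C| < n.
    by apply: leq_trans lt _; apply: leq_trans (max_card _) _; rewrite card_ord.
  have [k kC] : exists k : T, k = #|C| :> nat by exists (Ordinal CN).
  exists k; rewrite [beval _ _ _]/= (upd_same env 7 k) upd_other // e0 A3c A3o // A2c.
  by rewrite kC lt ltnn.
have A4o r : r != 11 -> A4 r = A3 r.
  by move=> h; apply: sem_frame; rewrite /= (negbTE h).
pose A5 := sem 6 rest_row env A4.
have A5o r : r != 12 -> A5 r = A4 r by move=> h; apply: sem_frame; apply: writes_compr.
have A4CE (q : T) : A4 7 0 q = (q \in C) by rewrite A4o // A3o // A2o // -A1C inE.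
have A5r : row A5 12 = H :\: C.
  rewrite row_compr //; apply/setP=> q.
  rewrite [in LHS]inE [beval _ _ _]/= (upd_same env 7 q) !upd_other // e0 A4CE.
  by rewrite A4o // A3o // A2o // A1o // in_setD andbC; congr (_ && _); rewrite inE.
have bA5 : basic A5.
  by apply: basic_frame bA; rewrite A5o // A4o // A3o // A2o // A1o.
pose A6 := sem 6 find_hole env A5.
have A6o r : r != 13 -> r != 3 -> r != 4 -> A6 r = A5 r.
  by move=> h h3 h4; apply: sem_frame; rewrite /= (negbTE h) (negbTE h3) (negbTE h4).
have A6v : A6 13 0 0 = ~~ nh e (H :\: C) by rewrite /A6 (find_hole_correct e0 bA5) A5r.
rewrite -[sem 6 improve env A]/(sem 6 (ifb (And (At 11 0 0) (Neg (At 13 0 0)))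
   (compr 6 6 (At 7 0 7)) Skip) env A6).
rewrite sem_ifb [beval _ _ _]/= e0 A6v negbK A6o // A5o // A4c; case: ifP => _.
  rewrite row_compr //; apply/setP=> q.
  by rewrite inE [beval _ _ _]/= (upd_same env 7 q) upd_other // e0 A6o // A5o // A4CE.
by rewrite /= /row A6o // A5o // A4o // A3o // A2o // A1o.
Qed.

Lemma nh0 : nh e set0.
Proof. by apply: bip_nh => //; apply: bip_perm0. Qed.

Lemma clean_component_correct env A (r : T) : env 0 = 0 -> env 1 = r -> basic A ->
  let H := component e (~: Zr A) r in
  exists B, [/\ row (sem 1 clean_component env A) 1 = Zr A :|: B, B \subset H, nh e (H :\: B) &
    forall c u v w x, nh e (H :\: cand e H c u v w x) -> #|B| <= #|cand e H c u v w x| ].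
Proof.
move=> e0 e1 bA H.
pose A1 := sem 1 (compr 1 3 (Neg (At 1 0 2))) env A.
have A1o q : q != 3 -> A1 q = A q by move=> h; apply: sem_frame; apply: writes_compr.
have A1W : row A1 3 = ~: Zr A.
  by rewrite row_compr //; apply/setP=> q; rewrite !inE [beval _ _ _]/= (upd_same env 2 q) upd_other // e0.
pose A2 := sem 1 (reach 1 3 4 1) env A1.
have A2o q : q != 4 -> A2 q = A1 q.
  by move=> h; apply: sem_frame; rewrite /= (negbTE h).
have A2R : row A2 4 = H.
  rewrite /A2 (@row_reach n e 1 3 4 1 r env A1) // ?A1W //.
  by case: bA => b0 _ a b; rewrite A1o.
have A2E (q : T) : A2 4 0 q = (q \in H) by rewrite -A2R inE.
pose A3 := sem 1 (compr 1 5 (At 4 0 2)) env A2.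
have A3o q : q != 5 -> A3 q = A2 q by move=> h; apply: sem_frame; apply: writes_compr.
have A3H : row A3 5 = H.
  by rewrite row_compr //; apply/setP=> q; rewrite inE [beval _ _ _]/= (upd_same env 2 q) upd_other // e0 A2E.
pose A4 := sem 1 (compr 1 6 (At 4 0 2)) env A3.
have A4o q : q != 6 -> A4 q = A3 q by move=> h; apply: sem_frame; apply: writes_compr.
have A4B : row A4 6 = H.
  rewrite row_compr //; apply/setP=> q.
  by rewrite inE [beval _ _ _]/= (upd_same env 2 q) upd_other // e0 A3o // A2E.
have A4H : row A4 5 = H by rewrite /row A4o.
have bA4 : basic A4 by apply: basic_frame bA; rewrite A4o // A3o // A2o // A1o.
pose A5 := sem 1 (loops 5 improve) env A4.
pose I A' := row A' 6 \subset H /\ nh e (H :\: row A' 6).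
pose le A' A'' := #|row A'' 6| <= #|row A' 6|.
pose Q s A' := if s is [:: c; u; v; w; x] then
  nh e (H :\: cand e H c u v w x) -> #|row A' 6| <= #|cand e H c u v w x| : Prop else True.
have [|A' A'' A'''|s A' A''|||h1 _ h3] := @loops_ind n 5 I le Q 1 improve env A4.
- by move=> A'; rewrite /le.
- by move=> h12 h23; apply: leq_trans h23 h12.
- rewrite /Q; case: s => [|c [|u [|v [|w [|x []]]]]] // h12 h /h; exact: leq_trans.
(* The search starts from deleting the whole component, which leaves no hole, so the stored set is
   valid before any candidate is. *)
- by rewrite /I A4B setDv; split=> //; apply: nh0.
- move=> s A' s5 fr [I1 I2].
  have [c [u [v [w [x ->]]]]] : exists c u v w x, s = [:: c; u; v; w; x].
    by case: s s5 => [|c [|u [|v [|w [|x []]]]]] // _; exists c, u, v, w, x.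
  have bA' : basic A' by apply: basic_frame bA4; apply: fr.
  have H' : row A' 5 = H by rewrite /row fr.
  set E := bind env 1 _.
  have E0 : E 0 = 0 by rewrite /E bind_other.
  have EE : [/\ E 2 = c, E 3 = u, E 4 = v, E 5 = w & E 6 = x] by [].
  have cH : cand e H c u v w x \subset H by apply/subsetP=> q; rewrite inE => /andP[].
  have := improve_correct E0 bA' EE; rewrite H' /I /le /Q => ->; case: ifP => [/andP[lt nhC]|nE].
    by split=> //; apply: ltnW.
  split=> // nhC; rewrite leqNgt; apply/negP=> lt; move: nE; rewrite nhC andbT.
  by rewrite lt.
have A51 : A5 1 = A 1 by rewrite /A5 sem_frame // A4o // A3o // A2o // A1o.
exists (row A5 6); have [g1 g2] := h1; split=> //; last first.
  by move=> c u v w x; apply: (h3 [:: c; u; v; w; x]).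
pose A6 := sem 1 (compr 1 3 (Or (At 1 0 2) (At 6 0 2))) env A5.
rewrite -[sem _ _ _ _]/(sem 1 (compr 1 1 (At 3 0 2)) env A6).
rewrite row_compr //; apply/setP=> q.
rewrite inE [beval _ _ _]/= (upd_same env 2 q) upd_other // e0 /A6 sem_compr //.
by rewrite [beval _ _ _]/= (upd_same env 2 q) upd_other // e0 !inE A51.
Qed.

Lemma algorithm_correct b :
  (forall env A, beval b env A = badb [seq A 0 (env p.1) (env p.2) | p <- pairs]) ->
  let Z := Zr (sem 0 (algorithm b) (fun=> 0) (initial e)) in
  bip_perm_on e (~: Z) /\ forall Y, bip_perm_on e (~: Y) -> #|Z| <= 9 * #|Y|.
Proof.
move=> bE Z.
pose A1 := sem 0 (For (SetA 2 1 1 true)) (fun=> 0) (initial e).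
have adj0 (u v : T) : initial e 0 u v = e u v by rewrite /initial /adjn !valK.
have A1o q : q != 2 -> A1 q = initial e q by move=> h; apply: sem_frame; rewrite /= (negbTE h).
have bA1 : basic A1.
  split; first by move=> u v; rewrite A1o.
  pose I k (A' : arrays) := forall u v : T, A' 2 u v = (u == v) && (u < k).
  suff: I n A1 by move=> h u v; rewrite h ltn_ord andbT.
  apply: for_ind => [u v|i A' _ h u v]; first by rewrite ltn0 andbF.
  rewrite /= /set_arr !upd_same /= h ltnS [u <= i]leq_eqVlt -!val_eqE /=.
  by case: (u =P i :> nat) => [->|]; case: (v =P i :> nat) => [->|]; rewrite ?eqxx ?andbT ?andbF //=; lia.
have Z1 : Zr A1 = set0 by apply/setP=> q; rewrite !inE A1o.
pose A2 := sem 0 (stage1 b) (fun=> 0) A1.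
have [a2 sf2] : approx e (Zr A2) /\ small_free e (~: Zr A2).
  apply: stage1_correct => //; first by case: bA1.
  by rewrite Z1; apply: approx0.
have bA2 : basic A2.
  by apply: basic_frame bA1; apply: sem_frame; rewrite writes_loops; apply: writes_ifb.
pose I A' := approx e (Zr A') /\ small_free e (~: Zr A').
pose le A' A'' := Zr A' \subset Zr A''.
pose Q s A' := if s is [:: r] then r \in ~: Zr A' ->
  bip_perm_on e (component e (~: Zr A') r :\: Zr A') else True.
have [|A' A'' A'''|s A' A''|||h1 _ h3] := @loops_ind n 1 I le Q 0 (ifb (At 1 0 1) Skip clean_component) (fun=> 0) A2.
- by move=> A'; apply: subxx.
- exact: subset_trans.
- rewrite /Q; case: s => [|r []] // h12 h rZ; apply: component_bip_permS (h12) _.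
  by apply: h; apply: subsetP rZ; rewrite setCS.
- by [].
- case=> [|r []] // A' _ fr [I1 I2].
  have bA' : basic A' by apply: basic_frame bA2; apply: fr.
  rewrite sem_ifb [beval _ _ _]/= (upd_same _ 1 r); case: ifP => rZ.
    by rewrite /le /Q; split=> //=; rewrite inE in_set rZ.
  have rZ' : r \in ~: Zr A' by rewrite inE in_set rZ.
  have [B [ZB BH nB mB]] := @clean_component_correct (upd (fun=> 0) 1 r) A' r erefl erefl bA'.
  rewrite /I /le /Q -[0 + 1]/1 [bind _ _ _]/= ZB; split.
  + split; first exact: approx_component nB mB.
    by apply: small_freeS I2; rewrite setCS subsetUl.
  + exact: subsetUl.
  by move=> _; apply: component_bip_perm nB.
have [g1 g2] := h1; split.
  apply: components_bip_permC => // r; exact: (h3 [:: r]).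
by move=> Y; apply: approx_card.
Qed.
End Algorithm.

(** The depth 13 is one root, five candidate parameters, four path vertices and three loops of the
    search; the arrays are numbered 0 to 13. The tree [b] sits under nine loops. *)
Lemma wf_algorithm b : bwf 14 9 b -> wf 13 14 0 (algorithm b).
Proof.
move=> wb; have w1 : wf 13 14 0 (stage1 b).
  by rewrite /stage1 /= ; apply: wf_ifb.
by rewrite -[wf _ _ _ _]/(wf 13 14 0 (stage1 b) && wf 13 14 0 stage2) w1.
Qed.

Theorem theorem1p2 :
  exists (P : program) (a k : nat),
    forall (n : nat) (e : rel 'I_n), symmetric e -> irreflexive e ->
      exists t : nat,
        t <= a * (n.+1) ^ k /\
        halted P (run P t (init_config e)) /\
        (let Z := output_set n (run P t (init_config e)) in
         bip_perm_on e (~: Z) /\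
         forall Y : {set 'I_n}, bip_perm_on e (~: Y) -> #|Z| <= 9 * #|Y|).
Proof.
have wb : bwf 14 9 bad_tuple by apply: bwf_btree.
have bE env A : beval bad_tuple env A = badb [seq A 0 (env p.1) (env p.2) | p <- pairs].
  by rewrite beval_btree -map_comp.
have [P [a [k H]]] := ram_program (wf_algorithm wb) isT.
exists P, a, k => n e esym eirr; have [t [tl ht out]] := H n e eirr.
exists t; split; first exact: tl.
split; first exact: ht.
rewrite out; exact: (algorithm_correct esym eirr bE).
Qed.
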